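(* For any subset $S\subseteq[n-1]$ and partition $\mu\vdash n$, the multiplicity in $R_{\lambda_S}$ of the irreducible $S_n$-representation corresponding to $\mu$ equals $$|\{T\in SYT(\mu)\mid {\it Des}(T)=S\}|.$$
   Context: $P_n=\mathbf{Q}[x_1,\dots,x_n]$ with $S_n$ permuting variables; $I_n$ is the ideal generated by symmetric polynomials without constant term; $\psi:P_n\to P_n/I_n$ the projection. For a monomial $m=\prod x_i^{p_i}$, $\lambda(m)$ is $(p_1,\dots,p_n)$ sorted weakly decreasingly. For a partition $\lambda$ with at most $n$ parts, $P^{\trianglelefteq}_\lambda$ (resp. $P^{\triangleleft}_\lambda$) is the span of monomials with $\lambda(m)$ dominated (resp. strictly dominated) by $\lambda$, and $R_\lambda:=\psi(P^{\trianglelefteq}_\lambda)/\psi(P^{\triangleleft}_\lambda)$. For $S\subseteq[n]$, $\lambda_S=(\lambda_1,\dots,\lambda_n)$ with $\lambda_i=|S\cap\{i,\dots,n\}|$. Irreducible $S_n$-representations are indexed by partitions of $n$ in the standard way. $SYT(\mu)$ is the set of standard Young tableaux of shape $\mu$ (English notation); ${\it Des}(T)$ is the set of entries $i$ such that $i+1$ lies in a row strictly below the row of $i$. *)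

(* Defs.v *)
From HB Require Import structures.
From mathcomp Require Import all_boot all_algebra all_fingroup.
From mathcomp Require Import generic_quotient boolp.
From mathcomp Require Import mpoly.

Set Implicit Arguments.
Unset Strict Implicit.
Unset Printing Implicit Defensive.

Import GRing.Theory.
Local Open Scope ring_scope.
Local Open Scope quotient_scope.

(* The library only has matrix representations; the spaces below come without *)
(* a preferred basis, so representations are carried by arbitrary F-modules.  *)
(* As in mxrepresentation, groups act on the right: this matches the product  *)
(* of permutations, (s * t) i = t (s i).                                      *)

Section Representations.

Variables (F : fieldType) (gT : finGroupType).

Record rep := Rep {
  rep_sort :> lmodType F;
  act : gT -> {linear rep_sort -> rep_sort};
  act1 : forall v, act 1%g v = v;
  actM : forall g h v, act (g * h)%g v = act h (act g v)
}.
Arguments act {r} g.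

Record subrep (W : rep) := Subrep {
  sr_mem :> {pred W};
  sr_closed : submod_closed sr_mem;
  sr_act : forall g v, v \in sr_mem -> act g v \in sr_mem
}.

HB.instance Definition _ (W : rep) (U : subrep W) :=
  GRing.isSubmodClosed.Build F W (sr_mem U) (sr_closed U).

Section SubRepresentation.

Variables (W : rep) (U : subrep W).

Record sub_sort := SubElt { sub_val : W; sub_valP : sub_val \in sr_mem U }.

HB.instance Definition _ := [isSub for sub_val].
HB.instance Definition _ := [Choice of sub_sort by <:].
HB.instance Definition _ := [SubChoice_isSubLmodule of sub_sort by <:].

Definition sub_act g (u : sub_sort) : sub_sort :=
  SubElt (sr_act g (sub_valP u)).

Lemma sub_act_linear g : linear (sub_act g).
Proof. by move=> a u v; apply: val_inj; rewrite /= linearP. Qed.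

HB.instance Definition _ g :=
  GRing.isLinear.Build F sub_sort sub_sort *:%R (sub_act g) (sub_act_linear g).

Lemma sub_act1 u : sub_act 1%g u = u.
Proof. by apply: val_inj; rewrite /= act1. Qed.

Lemma sub_actM g h u : sub_act (g * h)%g u = sub_act h (sub_act g u).
Proof. by apply: val_inj; rewrite /= actM. Qed.

Definition sub_rep : rep := Rep sub_act1 sub_actM.

End SubRepresentation.

Section QuotientRepresentation.

Variables (W : rep) (U : subrep W).

Local Notation Q := (Quotient.quot (sr_mem U)).

Definition quo_sort : Type := Q.
HB.instance Definition _ := GRing.Zmodule.on quo_sort.

Definition quo_proj (w : W) : quo_sort := \pi_Q w.

Lemma quo_projP w1 w2 :
  reflect (quo_proj w1 = quo_proj w2) (w1 - w2 \in sr_mem U).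
Proof. by rewrite Quotient.idealrBE; apply: eqP. Qed.

Lemma quo_reprK : cancel (fun x : quo_sort => repr x : W) quo_proj.
Proof. exact: reprK. Qed.

Lemma quo_projB w1 w2 : quo_proj (w1 - w2) = quo_proj w1 - quo_proj w2.
Proof. exact: (raddfB (\pi_Q)). Qed.

Lemma quo_projD w1 w2 : quo_proj (w1 + w2) = quo_proj w1 + quo_proj w2.
Proof. exact: (raddfD (\pi_Q)). Qed.

Definition quo_scale a (x : quo_sort) : quo_sort := quo_proj (a *: (repr x : W)).

Lemma quo_projZ a w : quo_proj (a *: w) = quo_scale a (quo_proj w).
Proof.
apply/quo_projP; rewrite -scalerBr; apply: rpredZ.
by apply/quo_projP; rewrite quo_reprK.
Qed.

Lemma quo_scaleA a b x : quo_scale a (quo_scale b x) = quo_scale (a * b) x.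
Proof. by rewrite -[x]quo_reprK -!quo_projZ scalerA. Qed.

Lemma quo_scale1 : left_id 1 quo_scale.
Proof. by move=> x; rewrite -[x]quo_reprK -quo_projZ scale1r. Qed.

Lemma quo_scaleDr : right_distributive quo_scale +%R.
Proof.
move=> a x y; rewrite -[x]quo_reprK -[y]quo_reprK.
by rewrite -quo_projD -!quo_projZ -quo_projD scalerDr.
Qed.

Lemma quo_scaleDl x : {morph quo_scale^~ x : a b / a + b}.
Proof.
by move=> a b; rewrite -[x]quo_reprK -!quo_projZ -quo_projD scalerDl.
Qed.

HB.instance Definition _ := GRing.Zmodule_isLmodule.Build F quo_sort
  quo_scaleA quo_scale1 quo_scaleDr quo_scaleDl.

Lemma quo_proj_linear : linear quo_proj.
Proof. by move=> a u v; rewrite quo_projD quo_projZ. Qed.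

HB.instance Definition _ :=
  GRing.isLinear.Build F W quo_sort *:%R quo_proj quo_proj_linear.

Definition quo_act g (x : quo_sort) : quo_sort := quo_proj (act g (repr x : W)).

Lemma quo_projJ g w : quo_proj (act g w) = quo_act g (quo_proj w).
Proof.
apply/quo_projP; rewrite -linearB; apply: sr_act.
by apply/quo_projP; rewrite quo_reprK.
Qed.

Lemma quo_act_linear g : linear (quo_act g).
Proof.
move=> a x y; rewrite -[x]quo_reprK -[y]quo_reprK -linearP -!quo_projJ.
by rewrite !linearP.
Qed.

HB.instance Definition _ g :=
  GRing.isLinear.Build F quo_sort quo_sort *:%R (quo_act g) (quo_act_linear g).

Lemma quo_act1 x : quo_act 1%g x = x.
Proof. by rewrite -[x]quo_reprK -quo_projJ act1. Qed.

Lemma quo_actM g h x : quo_act (g * h)%g x = quo_act h (quo_act g x).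
Proof. by rewrite -[x]quo_reprK -!quo_projJ actM. Qed.

Definition quo_rep : rep := Rep quo_act1 quo_actM.

End QuotientRepresentation.

Section Span.

Variables (W : rep) (X : W -> Prop).

Definition span_pred : {pred W} := fun v =>
  `[< exists (k : nat) (a : 'I_k -> F) (x : 'I_k -> W),
        (forall i, X (x i)) /\ v = \sum_i a i *: x i >].

Lemma span_predP v : reflect
  (exists (k : nat) (a : 'I_k -> F) (x : 'I_k -> W),
     (forall i, X (x i)) /\ v = \sum_i a i *: x i) (v \in span_pred).
Proof. exact: asboolP. Qed.

Lemma span_closed : submod_closed span_pred.
Proof.
split=> [|c u v /span_predP[k [a [x [Xx ->]]]] /span_predP[l [b [y [Xy ->]]]]].
  apply/span_predP; exists 0%N, (fun=> 0), (fun=> 0).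
  by split=> [[]|] //; rewrite big_ord0.
apply/span_predP; exists (k + l)%N,
  (fun i => match split i with inl i => c * a i | inr i => b i end),
  (fun i => match split i with inl i => x i | inr i => y i end).
split=> [i|]; first by case: (split i).
rewrite big_split_ord scaler_sumr; congr (_ + _); apply: eq_bigr => i _.
  by rewrite (unsplitK (inl i)) scalerA.
by rewrite (unsplitK (inr i)).
Qed.

Hypothesis XJ : forall g v, X v -> X (act g v).

Lemma span_act g v : v \in span_pred -> act g v \in span_pred.
Proof.
move=> /span_predP[k [a [x [Xx ->]]]]; apply/span_predP.
exists k, a, (fun i => act g (x i)); split=> [i|]; first exact: XJ.
by rewrite linear_sum; apply: eq_bigr => i _; rewrite linearZ.
Qed.

Definition span_subrep : subrep W := Subrep span_closed span_act.

End Span.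

Section ImageRestriction.

Variables (W : rep) (U A B : subrep W).

Definition im_pred : {pred quo_rep U} := fun x =>
  `[< exists2 w, w \in sr_mem A & x = quo_proj U w >].

Lemma im_closed : submod_closed im_pred.
Proof.
split=> [|a x y /asboolP[v Av ->] /asboolP[w Aw ->]]; apply/asboolP.
  by exists 0; rewrite ?rpred0 ?raddf0.
by exists (a *: v + w); rewrite ?linearP // rpredD ?rpredZ.
Qed.

Lemma im_act g x : x \in im_pred -> act g x \in im_pred.
Proof.
move=> /asboolP[w Aw ->]; apply/asboolP.
by exists (act g w); rewrite ?sr_act // quo_projJ.
Qed.

Definition im_subrep : subrep (quo_rep U) := Subrep im_closed im_act.

Definition restrict_pred : {pred sub_rep A} := fun u => sub_val u \in sr_mem B.

Lemma restrict_closed : submod_closed restrict_pred.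
Proof.
split=> [|a u v Bu Bv]; rewrite unfold_in /=; first exact: rpred0.
by rewrite rpredD ?rpredZ.
Qed.

Lemma restrict_act g u : u \in restrict_pred -> act g u \in restrict_pred.
Proof. by move=> Bu; rewrite unfold_in /= sr_act. Qed.

Definition restrict_subrep : subrep (sub_rep A) :=
  Subrep restrict_closed restrict_act.

(* A / B; it is only used when B is contained in A.                           *)
Definition section_rep : rep := quo_rep restrict_subrep.

End ImageRestriction.

Definition rep_iso (V W : rep) : Prop :=
  exists2 f : {linear V -> W},
    bijective f & forall g v, f (act g v) = act g (f v).

Definition irreducible_rep (V : rep) : Prop :=
  (exists v : V, v != 0) /\
  forall U : subrep V,
    (forall v, v \in sr_mem U -> v = 0) \/ (forall v, v \in sr_mem U).

Definition direct_decomposition (W : rep) k (U : 'I_k -> subrep W) : Prop :=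
  forall w : W, exists! u : {ffun 'I_k -> W},
    (forall i, u i \in sr_mem (U i)) /\ w = \sum_i u i.

(* V is meant to be irreducible. If W is finite-dimensional and #|gT| is       *)
(* invertible in F, exactly one m satisfies this (Maschke, Krull-Schmidt).    *)
Definition has_multiplicity (V W : rep) (m : nat) : Prop :=
  exists (k : nat) (U : 'I_k -> subrep W),
    [/\ direct_decomposition U,
        forall i, irreducible_rep (sub_rep (U i)) &
        exists2 J : {set 'I_k},
          #|J| = m & forall i, i \in J <-> rep_iso (sub_rep (U i)) V].

End Representations.

Arguments act {F gT r} g.

Section DescentRepresentations.

Variable n : nat.

(* s maps 'X_i to 'X_(s i).                                                   *)
Definition poly_rep : rep rat 'S_n :=
  @Rep rat 'S_n {mpoly rat[n]} (fun s => msym s)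
    (@msym1m n rat) (fun s t p => msymMm p s t).

Definition coinv_pred : {pred {mpoly rat[n]}} := fun p =>
  `[< exists (k : nat) (q f : 'I_k -> {mpoly rat[n]}),
        (forall i, f i \is symmetric /\ (f i)@_0%MM = 0) /\
        p = \sum_i q i * f i >].

Lemma coinv_closed : submod_closed coinv_pred.
Proof.
split=> [|c u v /asboolP[k [a [x [Xx ->]]]] /asboolP[l [b [y [Xy ->]]]]].
  apply/asboolP; exists 0%N, (fun=> 0), (fun=> 0).
  by split=> [[]|] //; rewrite big_ord0.
apply/asboolP; exists (k + l)%N,
  (fun i => match split i with inl i => c *: a i | inr i => b i end),
  (fun i => match split i with inl i => x i | inr i => y i end).
split=> [i|]; first by case: (split i).
rewrite big_split_ord scaler_sumr; congr (_ + _); apply: eq_bigr => i _.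
  by rewrite (unsplitK (inl i)) scalerAl.
by rewrite (unsplitK (inr i)).
Qed.

Lemma coinv_act s p : p \in coinv_pred -> msym s p \in coinv_pred.
Proof.
move=> /asboolP[k [a [x [Xx ->]]]]; apply/asboolP.
exists k, (fun i => msym s (a i)), x; split=> //.
rewrite linear_sum; apply: eq_bigr => i _ /=; rewrite msymM.
by have [/issymP-> _] := Xx i.
Qed.

Definition coinv_ideal : subrep poly_rep :=
  @Subrep _ _ poly_rep coinv_pred coinv_closed coinv_act.

Definition exp_part (m : 'X_{1..n}) : seq nat := sort geq m.

Definition dominated (la mu : seq nat) : Prop :=
  sumn la = sumn mu /\ forall k, (sumn (take k la) <= sumn (take k mu))%N.

Definition monomial_in (P : seq nat -> Prop) (p : poly_rep) : Prop :=
  exists2 m : 'X_{1..n}, P (exp_part m) & p = 'X_[m].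

Lemma monomial_in_act P s p : monomial_in P p -> monomial_in P (act s p).
Proof.
case=> m Pm ->; rewrite /= msymX; eexists; last by [].
congr P: Pm; apply/perm_sortP.
- by move=> x y; apply: leq_total.
- by move=> y x z /= yx zy; apply: leq_trans zy yx.
- by move=> x y /= /anti_leq.
apply/tuple_permP; exists s; congr (val _); apply: eq_from_tnth => i.
by rewrite !tnth_mktuple permK.
Qed.

(* la has exactly n entries, trailing zeros included, as has exp_part m.      *)
Definition P_le (la : seq nat) : subrep poly_rep :=
  span_subrep (@monomial_in_act (fun nu => dominated nu la)).

Definition P_lt (la : seq nat) : subrep poly_rep :=
  span_subrep (@monomial_in_act (fun nu => dominated nu la /\ nu <> la)).

Definition R_rep (la : seq nat) : rep rat 'S_n :=
  section_rep (im_subrep coinv_ideal (P_le la)) (im_subrep coinv_ideal (P_lt la)).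

(* Elements of [n-1] are the nonzero elements of 'I_n, standing for           *)
(* themselves.                                                                *)
Definition lambda_set (S : {set 'I_n}) : seq nat :=
  [seq #|[set s in S | (i <= s)%N]| | i <- iota 1 n].

Definition is_partition (mu : seq nat) : bool :=
  [&& sorted geq mu, 0%N \notin mu & sumn mu == n].

(* Row tag c, column tagged c, both counted from 0.                           *)
Definition cell (mu : seq nat) : finType :=
  {r : 'I_(size mu) & 'I_(nth 0%N mu r)}.

Definition cell_row mu (c : cell mu) : nat := tag c.
Definition cell_col mu (c : cell mu) : nat := tagged c.

(* When mu is a partition of n, an injective filling is a bijection. A value  *)
(* j : 'I_n stands for the tableau entry j.+1, that is, the variable 'X_j.    *)
Definition tableau mu (T : {ffun cell mu -> 'I_n}) : bool := injectiveb T.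

(* Specht's construction of the irreducible attached to mu: the span of the   *)
(* products, over the columns of a tableau T, of the Vandermonde products in  *)
(* the variables of the column. Mapping a tabloid to the monomial 'X_[m], m j *)
(* the row of j, identifies these with the polytabloids up to sign. One row   *)
(* gives the trivial representation, one column the sign.                     *)
Definition specht_poly mu (T : {ffun cell mu -> 'I_n}) : {mpoly rat[n]} :=
  \prod_c \prod_(d | (cell_col c == cell_col d) && (cell_row c < cell_row d)%N)
    ('X_(T c) - 'X_(T d)).

Definition is_specht_poly mu (p : poly_rep) : Prop :=
  exists2 T : {ffun cell mu -> 'I_n}, tableau T & p = specht_poly T.

Lemma is_specht_poly_act mu s p :
  is_specht_poly mu p -> is_specht_poly mu (act s p).
Proof.
case=> T /injectiveP injT ->; exists [ffun c => s (T c)].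
  by apply/injectiveP => c d; rewrite !ffunE => /perm_inj/injT.
rewrite /= /specht_poly rmorph_prod; apply: eq_bigr => c _.
rewrite rmorph_prod; apply: eq_bigr => d _.
by rewrite rmorphB /= !msymX !ffunE; congr ('X_[_] - 'X_[_]);
  apply/mnmP=> i; rewrite !mnmE -[i in RHS](permKV s) (inj_eq perm_inj).
Qed.

Definition specht_rep mu : rep rat 'S_n :=
  sub_rep (span_subrep (@is_specht_poly_act mu)).

Definition standard mu (T : {ffun cell mu -> 'I_n}) : bool :=
  [forall c, forall d,
    ((cell_row c == cell_row d) && (cell_col c < cell_col d)%N ==> (T c < T d)%N) &&
    ((cell_col c == cell_col d) && (cell_row c < cell_row d)%N ==> (T c < T d)%N)].

Definition SYT mu : {set {ffun cell mu -> 'I_n}} :=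
  [set T | tableau T && standard T].

(* The cell c holds the entry i, the cell d the entry i.+1.                   *)
Definition Des mu (T : {ffun cell mu -> 'I_n}) : {set 'I_n} :=
  [set i : 'I_n | [exists c, exists d,
     [&& (T c).+1 == i, T d == i & (cell_row c < cell_row d)%N]]].

End DescentRepresentations.

(* Main.v *)
(* For S a subset of [n-1], let Y_S be the stabilizer of lambda_S. The          *)
(* representation R_{lambda_S} is generated by the class z of the monomial     *)
(* x^{lambda_S}, which is fixed by Y_S, and multiplying x^{lambda_{S-s}} by an  *)
(* elementary symmetric polynomial shows that the sum of z over Y_{S-s} is     *)
(* zero. Hence evaluation at z embeds Hom(R_{lambda_S}, V) into the space D_S  *)
(* of the Y_S-invariant vectors of V killed by all Y_{S-s}-sums.               *)
(* For every V one has V^{Y_S} = sum_{S' in S} D_{S'} by orthogonality, and     *)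
(* the sum is direct: in the space of all functions on words, vectors of D_S   *)
(* are determined by their values at words with descent set S, and these words *)
(* are as many as there are words in total. For V the Specht module, V^{Y_S}   *)
(* has a basis indexed by the standard tableaux with descent set inside S, so  *)
(* dim D_S counts the tableaux with descent set S.                             *)
(* Conversely, evaluating polynomials on a regular orbit and filtering the     *)
(* resulting copies of V by degree and dominance gives                         *)
(* dim V <= sum_S dim Hom(R_{lambda_S}, V) <= sum_S dim D_S = dim V, so every  *)
(* vector of D_S comes from a homomorphism.                                    *)
(* That standard polytabloids span the Specht module is seen from raising      *)
(* operators: they kill polytabloids, and a vector they kill is determined by  *)
(* its values at lattice words.                                                *)

From HB Require Import structures.
Require Import Defs.
From mathcomp Require Import all_boot all_order all_algebra all_fingroup.
From mathcomp Require Import generic_quotient boolp.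
From mathcomp Require Import mpoly.
From mathcomp Require Import zify ring lra.

Set Implicit Arguments.
Unset Strict Implicit.
Unset Printing Implicit Defensive.

Import Order.TTheory GRing.Theory Num.Theory.
Local Open Scope ring_scope.

(** Let V be the Specht module, realized as [specht_space] in the functions on words with letters
    below [size mu]. The descent representation is cyclic, generated by the class of x^lambda_S
    ([top_class_generates]). A homomorphism to V is thus given by its value at this class, and by
    Maschke and Schur the multiplicity is the dimension of the space of such values
    ([multiplicity_dim]). The point is that these values form exactly the intersection of V with
    [new_space S].

    That every value lies there ([top_class_new]) comes from multiplying x^lambda_(S-s) by a
    symmetric polynomial: modulo the ideal and strictly dominated monomials this gives 0, and it is
    a nonzero multiple of an orbit sum of x^lambda_S ([sym_orbit_lraise]).

    That every vector there is a value ([new_top_class]) is forced by counting. A vector v of V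
    gives a map [ev_map v] from polynomials to V, by evaluation on a regular orbit. Its values at
    monomials of lowest level lie in the spaces [new_space]. Filtering V by that level bounds dim V
    by the total dimension of the leading values. The spaces [new_space] are independent
    ([new_space_directv]), so their parts in V have total dimension at most dim V. Hence all the
    bounds are equalities ([lead_surjective], [ev_map_realize]).

    The dimension itself is found by induction on S ([dim_specht_new]): invariants of the Young
    subgroup split over the subsets of S ([dim_inv_new]), and symmetrized standard polytabloids with
    descents inside S are a basis of them ([dim_specht_inv]). This uses the standard basis theorem
    [specht_space_std], whose spanning half rests on [lattice_det]. *)

Section Subspaces.

Variables (F : fieldType) (vT : vectType F).

(** A subspace of maximal dimension inside P is all of P, since another vector of P would enlarge
    it. Subspaces cut out by propositions thus acquire a dimension. *)
Lemma vspace_of_submod (P : {pred vT}) : submod_closed P ->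
  exists U : {vspace vT}, forall v, (v \in U) = (v \in P).
Proof.
move=> [P0 Pl].
pose Q d := `[< exists2 U : {vspace vT}, {subset U <= P} & \dim U = d >].
have exQ : exists d, Q d.
  exists 0%N; apply/asboolP; exists 0%VS; last exact: dimv0.
  by move=> v; rewrite memv0 => /eqP->.
have ubQ d : Q d -> (d <= \dim {:vT})%N.
  by move=> /asboolP[U _ <-]; apply/dimvS/subvf.
case: (ex_maxnP exQ ubQ) => d /asboolP[U UP dU] maxd; exists U => v.
apply/idP/idP => [/UP//|Pv]; apply/negPn/negP => nUv.
have UvP : {subset (U + <[v]>)%VS <= P}.
  move=> w /memv_addP[u /UP Pu [_ /vlineP[a ->] ->]].
  by rewrite addrC; apply: Pl.
have /maxd : Q (\dim (U + <[v]>)) by apply/asboolP; exists (U + <[v]>)%VS.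
rewrite -dU leqNgt => /negP; apply.
rewrite ltn_neqAle dimvS ?addvSl // andbT; apply: contraNneq nUv => eqd.
have /eqP-> : U == (U + <[v]>)%VS by rewrite eqEdim addvSl eqd /=.
by apply: subvP (addvSr _ _) _ _; apply: memv_line.
Qed.

Definition pvs (P : {pred vT}) (cP : submod_closed P) : {vspace vT} :=
  sval (cid (vspace_of_submod cP)).

Lemma mem_pvs P cP v : (v \in @pvs P cP) = (v \in P).
Proof. by rewrite /pvs; case: (cid _) => U /= ->. Qed.

Lemma subv_sum_in (I : finType) (P : pred I) (U : I -> {vspace vT}) i v :
  P i -> v \in U i -> v \in (\sum_(i | P i) U i)%VS.
Proof. by move=> Pi; apply: subvP; apply: sumv_sup (subvv _). Qed.

End Subspaces.

(** * Rational functions on a finite set, with the standard inner product *)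

Section FunctionSpaces.

Variable I : finType.
Local Notation B := {ffun I -> rat^o}.
Implicit Types (x y : B) (U W : {vspace B}).

Definition delta (i : I) : B := [ffun j => (j == i)%:R].

Lemma ffun_delta x : x = \sum_i x i *: delta i.
Proof.
apply/ffunP => j; rewrite sum_ffunE (bigD1 j) //= big1 ?addr0 => [|i ij].
  by rewrite !ffunE eqxx [_ *: _]mulr1.
by rewrite !ffunE eq_sym (negPf ij) [_ *: _]mulr0.
Qed.

(** Restriction to A is injective on U, with image in the span of the delta functions of A. *)
Lemma dim_le_det (U : {vspace B}) (A : {set I}) :
  (forall x, x \in U -> (forall i, i \in A -> x i = 0) -> x = 0) ->
  (\dim U <= #|A|)%N.
Proof.
move=> UA; pose r x : B := [ffun i => if i \in A then x i else 0].
have r_lin : linear r.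
  move=> a x y; apply/ffunP => i; rewrite !ffunE; case: ifP => // _.
  by rewrite scaler0 addr0.
pose rl : {linear B -> B} := HB.pack r (GRing.isLinear.Build rat B B *:%R r r_lin).
have ker0 : (U :&: lker (linfun rl) = 0)%VS.
  apply/eqP; rewrite -subv0; apply/subvP => x; rewrite memv_cap memv_ker lfunE /=.
  case/andP=> Ux /eqP/ffunP rx0; rewrite memv0; apply/eqP/UA => // i Ai.
  by have := rx0 i; rewrite !ffunE Ai.
rewrite -(limg_dim_eq ker0).
apply: leq_trans (_ : \dim <<[seq delta i | i in A]>> <= _)%N.
  apply/dimvS/subvP => _ /memv_imgP[x _ ->]; rewrite lfunE /= [r x]ffun_delta.
  apply: memv_suml => i _; rewrite ffunE; case: ifP => Ai.
    by apply/memvZ/memv_span/map_f; rewrite mem_enum.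
  by rewrite scale0r mem0v.
by apply: leq_trans (dim_span _) _; rewrite size_map cardE.
Qed.

Definition dot x y : rat := \sum_i x i * y i.

Lemma dotC x y : dot x y = dot y x.
Proof. by apply: eq_bigr => i _; rewrite mulrC. Qed.

Lemma dot_linear x : linear (dot x : B -> rat^o).
Proof.
move=> a y z; rewrite /dot scaler_sumr -big_split; apply: eq_bigr => i _ /=.
by rewrite !ffunE /= mulrDr /GRing.scale /= mulrCA.
Qed.

HB.instance Definition _ x :=
  GRing.isLinear.Build rat B rat^o *:%R (dot x) (dot_linear x).

Lemma dot_eq0 x : dot x x = 0 -> x = 0.
Proof.
move=> /eqP; rewrite psumr_eq0 => [/allP x0|i _]; last by rewrite -expr2 sqr_ge0.
apply/ffunP => i; rewrite ffunE; apply/eqP.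
by have := x0 i (mem_index_enum _); rewrite /= mulf_eq0 orbb.
Qed.

(** Pairing with a basis of U is injective on U, the form being positive definite, hence onto by
    dimension; u is chosen with the same pairings as w. *)
Lemma orthogonal_decomposition U W w : (U <= W)%VS -> w \in W ->
  exists2 u, u \in U & w - u \in W /\ forall v, v \in U -> dot v (w - u) = 0.
Proof.
move=> sUW Ww.
pose c y : {ffun 'I_(\dim U) -> rat^o} := [ffun i : 'I_(\dim U) => dot (vbasis U)`_i y].
have c_lin : linear c.
  by move=> a y z; apply/ffunP => i; rewrite !ffunE linearP.
pose cl : {linear B -> {ffun 'I_(\dim U) -> rat^o}} :=
  HB.pack c (GRing.isLinear.Build rat B _ *:%R c c_lin).
have orthU y : c y = 0 -> forall v, v \in U -> dot v y = 0.
  move=> /ffunP cy0 v /coord_vbasis->; rewrite dotC linear_sum big1 // => i _.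
  by rewrite linearZ /= dotC; have := cy0 i; rewrite !ffunE => ->; rewrite scaler0.
have dU : \dim (linfun cl @: U) = \dim U.
  apply: limg_dim_eq; apply/eqP; rewrite -subv0; apply/subvP => y.
  rewrite memv_cap memv_ker lfunE memv0 /= => /andP[Uy /eqP/orthU/(_ _ Uy)].
  by move/dot_eq0->.
have: linfun cl w \in (linfun cl @: U)%VS.
  suff -> : (linfun cl @: U = fullv)%VS by apply: memvf.
  apply/eqP; rewrite eqEdim subvf dU dimvf /dim /=.
  by rewrite card_ord muln1.
case/memv_imgP=> u Uu; rewrite !lfunE /= => eqc; exists u => //; split.
  by rewrite rpredB // (subvP sUW).
by apply: orthU; rewrite -[c _]/(cl _) linearB /= eqc subrr.
Qed.

End FunctionSpaces.

(** * Highest weight vectors in tensor powers *)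

Section HighestWeight.

Implicit Types (g h : seq nat -> rat) (u v : seq nat) (i k N : nat).

(** Tensors are given by their coefficients at words. The operator sends the basis vector e_(i+1) to
    e_i in one factor at a time, so the coefficient at u reads g at u with a letter i replaced by
    i+1. *)
Fixpoint raise i g u : rat :=
  if u is a :: u' then
    (if a == i then g (i.+1 :: u') else 0) + raise i (fun v => g (a :: v)) u'
  else 0.

Fixpoint lower i g u : rat :=
  if u is a :: u' then
    (if a == i.+1 then g (i :: u') else 0) + lower i (fun v => g (a :: v)) u'
  else 0.

Lemma eq_lower i g h u :
  (forall v, size v = size u -> g v = h v) -> lower i g u = lower i h u.
Proof.
elim: u g h => //= a u IHu g h gh; rewrite gh //; congr (_ + _).
by apply: IHu => v szv; rewrite gh //= szv.
Qed.

Lemma raise0 i u : raise i (fun=> 0) u = 0.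
Proof. by elim: u => //= a u ->; rewrite if_same addr0. Qed.

Lemma lower0 i u : lower i (fun=> 0) u = 0.
Proof. by elim: u => //= a u ->; rewrite if_same addr0. Qed.

Lemma raiseD i g h u : raise i (fun v => g v + h v) u = raise i g u + raise i h u.
Proof.
by elim: u g h => [|a u IHu] g h /=; rewrite ?addr0 // IHu; case: ifP => _; ring.
Qed.

Lemma lowerD i g h u : lower i (fun v => g v + h v) u = lower i g u + lower i h u.
Proof.
by elim: u g h => [|a u IHu] g h /=; rewrite ?addr0 // IHu; case: ifP => _; ring.
Qed.

(** The relation [E, F] = H on tensors: contributions from two different factors cancel, and each
    factor adds its own weight. *)
Lemma raise_lowerB i g u :
  raise i (lower i g) u - lower i (raise i g) u =
  ((count_mem i u)%:R - (count_mem i.+1 u)%:R) * g u.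
Proof.
elim: u g => [|a u IHu] g /=; first by rewrite !subrr mul0r.
rewrite raiseD lowerD; move/(_ (fun v => g (a :: v))): IHu => /= IHu.
have -> (b : bool) (f : seq nat -> rat) :
    raise i (fun v => if b then f v else 0) u = if b then raise i f u else 0.
  by case: b; rewrite ?raise0.
have -> (b : bool) (f : seq nat -> rat) :
    lower i (fun v => if b then f v else 0) u = if b then lower i f u else 0.
  by case: b; rewrite ?lower0.
move/eqP: IHu; rewrite subr_eq => /eqP->.
have [->|ni] := eqVneq a i.
  rewrite !eqxx (ltn_eqF (ltnSn i)) /= !natrD; ring.
have [->|nSi] := eqVneq a i.+1; first by rewrite !eqxx !natrD /=; ring.
by rewrite !natrD /=; ring.
Qed.

Fixpoint wsum k N g : rat :=
  if N is N'.+1 then \sum_(a < k) wsum k N' (fun v => g ((a : nat) :: v))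
  else g [::].

Lemma eq_wsum k N g h : (forall u, size u = N -> g u = h u) ->
  wsum k N g = wsum k N h.
Proof.
elim: N g h => /= [|N IHN] g h gh; first exact: gh.
by apply: eq_bigr => a _; apply: IHN => u szu; apply: gh; rewrite /= szu.
Qed.

Lemma wsumD k N g h : wsum k N (fun u => g u + h u) = wsum k N g + wsum k N h.
Proof.
elim: N g h => //= N IHN g h; rewrite -big_split; apply: eq_bigr => a _.
exact: IHN.
Qed.

Lemma wsumN k N g : wsum k N (fun u => - g u) = - wsum k N g.
Proof.
by elim: N g => //= N IHN g; rewrite -sumrN; apply: eq_bigr => a _; apply: IHN.
Qed.

Lemma wsum_ge0 k N g : (forall u, size u = N -> 0 <= g u) -> 0 <= wsum k N g.
Proof.
elim: N g => /= [|N IHN] g g0; first exact: g0.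
by apply: sumr_ge0 => a _; apply: IHN => u szu; apply: g0; rewrite /= szu.
Qed.

Lemma wsum_eq0 k N g : (forall u, size u = N -> 0 <= g u) -> wsum k N g = 0 ->
  forall u, size u = N -> all (gtn k) u -> g u = 0.
Proof.
elim: N g => /= [|N IHN] g g0 sg0 [|a u] //= [szu] /andP[ak uk].
have ge0 b u' : size u' = N -> 0 <= g (b :: u').
  by move=> szu'; apply: g0; rewrite /= szu'.
apply: (IHN (fun v => g (a :: v))) => //; first by move=> v; apply: ge0.
move/eqP: sg0; rewrite psumr_eq0 => [/allP/(_ (Ordinal ak))|b _].
  by rewrite mem_index_enum => /(_ isT)/eqP.
by apply: wsum_ge0 => v; apply: ge0.
Qed.

Lemma lower_adj k N i g h : (i.+1 < k)%N ->
  wsum k N (fun u => lower i g u * h u) = wsum k N (fun u => g u * raise i h u).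
Proof.
move=> ik; elim: N g h => [|N IHN] g h /=; first by rewrite mul0r mulr0.
have ik' : (i < k)%N by apply: ltn_trans ik.
pose f1 := fun v => g (i :: v) * h (i.+1 :: v).
transitivity (wsum k N f1 + \sum_(a < k) wsum k N (fun v =>
    lower i (fun v => g ((a : nat) :: v)) v * h ((a : nat) :: v))).
  rewrite (bigD1 (Ordinal ik)) //= [in RHS](bigD1 (Ordinal ik)) //= addrA.
  congr (_ + _).
    by rewrite -wsumD; apply: eq_wsum => u _; rewrite eqxx mulrDl.
  apply: eq_bigr => a /eqP/val_eqP/= ai; apply: eq_wsum => u _.
  by rewrite (negPf ai) add0r.
rewrite (eq_bigr _ (fun (a : 'I_k) _ => IHN (fun v => g ((a : nat) :: v)) (fun v => h ((a : nat) :: v)))).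
rewrite (bigD1 (Ordinal ik')) //= [in RHS](bigD1 (Ordinal ik')) //= addrA.
congr (_ + _).
  by rewrite -wsumD; apply: eq_wsum => u _; rewrite eqxx mulrDr.
apply: eq_bigr => a /eqP/val_eqP/= ai; apply: eq_wsum => u _.
by rewrite (negPf ai) add0r.
Qed.

(* The sl2 relation [E, F] = H gives |F g|^2 = <g, H g> when E g = 0, so a     *)
(* vector of negative weight killed by E vanishes.                             *)
Lemma raise_inj k N i g :
  (forall u, size u = N -> g u != 0 -> all (gtn k) u) ->
  (forall u, size u = N -> g u != 0 -> (count_mem i u < count_mem i.+1 u)%N) ->
  (forall u, size u = N -> raise i g u = 0) ->
  forall u, size u = N -> g u = 0.
Proof.
move=> gk gw Eg0 u szu; apply/eqP/negPn/negP => nz_gu.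
have ik : (i.+1 < k)%N.
  have := gw u szu nz_gu; have /allP uk := gk u szu nz_gu.
  case: (ltnP i.+1 k) => // ki lt_c; suff /uk : i.+1 \in u by rewrite /= ltnNge ki.
  by rewrite -has_pred1 has_count (leq_ltn_trans _ lt_c).
(* Q is minus the weight times g^2, nonnegative by the hypothesis on weights; its sum will be -|F
   g|^2, so Q vanishes. *)
pose Q v := ((count_mem i.+1 v)%:R - (count_mem i v)%:R) * g v * g v.
have Q0 v : size v = N -> 0 <= Q v.
  move=> szv; rewrite /Q; have [->|nz] := eqVneq (g v) 0; first by rewrite mulr0.
  rewrite -mulrA -expr2 mulr_ge0 ?sqr_ge0 // subr_ge0 ler_nat.
  exact/ltnW/gw.
have sQ : wsum k N Q = - wsum k N (fun v => lower i g v * lower i g v).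
  rewrite lower_adj // -wsumN; apply: eq_wsum => v szv.
  have := raise_lowerB i g v; rewrite (@eq_lower _ (raise i g) (fun=> 0)); last first.
    by move=> w szw; rewrite Eg0 ?szw.
  by rewrite lower0 subr0 => ->; rewrite /Q; ring.
have sQ0 : wsum k N Q = 0.
  apply/eqP; rewrite eq_le wsum_ge0 // andbT sQ oppr_le0.
  by apply: wsum_ge0 => v _; rewrite -expr2 sqr_ge0.
have := wsum_eq0 Q0 sQ0 szu (gk _ szu nz_gu).
move/eqP; rewrite /Q !mulf_eq0 (negPf nz_gu) !orbF subr_eq0 eqr_nat.
by have := gw u szu nz_gu; rewrite ltn_neqAle eq_sym => /andP[/negPf->].
Qed.

(** The ballot (Yamanouchi) condition, imposed on suffixes. *)
Fixpoint lattice u :=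
  if u is a :: u' then
    lattice u' && ((a == 0%N) || (count_mem a u' < count_mem a.-1 u')%N)
  else true.

Lemma lattice_count u i : lattice u -> (count_mem i.+1 u <= count_mem i u)%N.
Proof.
elim: u => //= a u IHu /andP[/IHu le_u].
have [->|ai] := eqVneq a i.+1 => /=; last by move=> _; lia.
by rewrite eqn_leq ltnn add0n.
Qed.

(** Induction on length, slicing by the first letter a from the largest down. Once the slice at a+1
    vanishes, the slice at a is killed by every raising operator, that slice being the only cross
    term. If removing an a leaves nu weakly decreasing, induction applies; otherwise the slice has
    negative weight for a, a+1 and [raise_inj] kills it. *)
Lemma lattice_det k N (nu : nat -> nat) g :
  (forall i, (nu i.+1 <= nu i)%N) ->
  (forall i, (k <= i)%N -> nu i = 0%N) ->
  (forall u, size u = N -> g u != 0 -> forall i, count_mem i u = nu i) ->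
  (forall i u, size u = N -> raise i g u = 0) ->
  (forall u, size u = N -> lattice u -> g u = 0) ->
  forall u, size u = N -> g u = 0.
Proof.
elim: N nu g => [|N IHN] nu g nu_dec nu_k g_nu Eg0 g_lat.
  by case=> // _; apply: g_lat.
suff slice m a : (k <= a + m)%N -> forall u, size u = N -> g (a :: u) = 0.
  by case=> // a u [szu]; apply: (slice k) => //; apply: leq_addl.
elim: m a => [|m IHm] a ka u szu.
  apply/eqP/negPn/negP => /g_nu/=; rewrite szu => /(_ erefl a).
  by rewrite nu_k ?eqxx //; lia.
have {}IHm := IHm a.+1; rewrite addSnnS in IHm; have {IHm} Sa0 := IHm ka.
have Ega i v : size v = N -> raise i (fun v => g (a :: v)) v = 0.
  move=> szv; have := Eg0 i (a :: v); rewrite /= szv => /(_ erefl).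
  by case: eqP => [<-|_]; rewrite ?(Sa0 v szv) add0r.
pose nu' i := (nu i - (i == a))%N.
have ga_nu v : size v = N -> g (a :: v) != 0 ->
    (0 < nu a)%N /\ forall i, count_mem i v = nu' i.
  move=> szv /g_nu/=; rewrite szv => /(_ erefl) cv; split.
    by rewrite -(cv a) eqxx.
  by move=> i; rewrite /nu' -(cv i) eq_sym; lia.
have nu'_k i : (k <= i)%N -> nu' i = 0%N by rewrite /nu' => /nu_k->.
have [le_nu|gt_nu] := leqP (nu a) (nu a.+1).
  apply: (@raise_inj k N a (fun v => g (a :: v)) _ _ (Ega a)) => // v szv nz.
    have [_ cv] := ga_nu v szv nz; apply/allP => i; rewrite -has_pred1 has_count cv /=.
    by case: (ltnP i k) => // ki; rewrite nu'_k.
  have [nua cv] := ga_nu v szv nz; rewrite !cv /nu' eqxx.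
  by rewrite (gtn_eqF (ltnSn a)); lia.
apply: (IHN nu' (fun v => g (a :: v))) => // [i|v szv nz|v szv lat_v].
- rewrite /nu'; have := nu_dec i; case: (eqVneq i a) => [->|]; lia.
- by have [] := ga_nu v szv nz.
apply/eqP/negPn/negP => nz; have [nua cv] := ga_nu v szv nz.
move/negP: nz; apply; apply/eqP/g_lat; rewrite /= ?szv // lat_v /=.
case: a {Sa0 Ega ga_nu ka} @nu' nu'_k gt_nu nua cv => // a nu' _ gt_nu nua cv /=.
rewrite !cv /nu' eqxx (ltn_eqF (ltnSn a)); have := nu_dec a; lia.
Qed.

End HighestWeight.

(** * Block stabilizers and descents of words *)

Section Compositions.

Variable n : nat.
Implicit Types (f u v w : 'I_n -> nat) (S : {set 'I_n}).

Definition stab f : {set 'S_n} := [set g : 'S_n | [forall i, f (g i) == f i]].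

Lemma stabP f (g : 'S_n) : reflect (forall i, f (g i) = f i) (g \in stab f).
Proof. by rewrite inE; apply: (iffP forallP) => fg i; apply/eqP/fg. Qed.

Lemma stab_group_set f : group_set (stab f).
Proof.
apply/group_setP; split=> [|g h /stabP fg /stabP fh].
  by apply/stabP => i; rewrite perm1.
by apply/stabP => i; rewrite permM fh fg.
Qed.

Canonical stab_group f := Group (stab_group_set f).

Lemma tperm_stab f i j : f i = f j -> tperm i j \in stab f.
Proof. by move=> fij; apply/stabP => l; case: tpermP => [->|->|]. Qed.

Lemma mono_adjacent u : (forall i j : 'I_n, i.+1 = j :> nat -> u i <= u j)%N ->
  forall i j : 'I_n, (i <= j -> u i <= u j)%N.
Proof.
move=> uS i j; move def_m: (j - i)%N => m ij.
elim: m j def_m ij => [|m IHm] j def_m ij.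
  have -> : i = j by apply: val_inj => /=; lia.
  exact: leqnn.
have j0 : (j.-1 < n)%N by have := ltn_ord j; lia.
apply: leq_trans (IHm (Ordinal j0) _ _) (uS (Ordinal j0) j _) => /=; lia.
Qed.

Lemma sorted_unique u v (g : 'S_n) :
  (forall i j : 'I_n, i <= j -> u i <= u j)%N ->
  (forall i j : 'I_n, i <= j -> v i <= v j)%N ->
  (forall i, v i = u (g i)) -> u =1 v.
Proof.
move=> su sv vug i.
have srt w : (forall i j : 'I_n, i <= j -> w i <= w j)%N -> sorted leq (codom w).
  move=> sw; rewrite codomE sorted_map; apply: (@sub_sorted _ (relpre val leq)).
    by move=> a b; apply: sw.
  by rewrite -sorted_map val_enum_ord iota_sorted.
have eqc : codom u = codom v.
  apply: (sorted_eq leq_trans anti_leq (srt u su) (srt v sv)).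
  rewrite perm_sym !codomE (eq_map vug) (map_comp u g); apply/perm_map/uniq_perm.
  - by rewrite map_inj_uniq ?enum_uniq //; apply: perm_inj.
  - exact: enum_uniq.
  by move=> j; rewrite mem_enum -(permKV g j) map_f ?mem_enum.
by move: eqc; rewrite !codomE => /eq_in_map; apply; rewrite mem_enum.
Qed.

(** One step of the rearrangement inequality: the sum grows by (f b - f a) * (w a - w b). *)
Lemma swap_sum f w (a b : 'I_n) : (f a < f b)%N -> (w b < w a)%N ->
  (\sum_i f i * w i < \sum_i f i * w (tperm a b i))%N.
Proof.
move=> fab wab; have nab : b != a by apply: contraTneq fab => ->; rewrite ltnn.
rewrite (bigD1 a) //= (bigD1 b) //= [X in (_ < X)%N](bigD1 a) //=.
rewrite [X in (_ < _ + X)%N](bigD1 b) //= tpermL tpermR.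
rewrite [X in (_ < _ + (_ + X))%N](eq_bigr (fun i => f i * w i)%N); first by nia.
by move=> i /andP[ia ib]; rewrite tpermD // eq_sym.
Qed.

(** The part of lambda_S at position i+1, positions being counted from 0, hence the strict
    inequality. Its level sets are the blocks into which S cuts the positions. *)
Definition lam S (i : 'I_n) : nat := #|[set s in S | (i < s)%N]|.

Lemma lam_between S (i j : 'I_n) : (i <= j)%N ->
  lam S i = (lam S j + #|[set s in S | (i < s <= j)%N]|)%N.
Proof.
move=> ij; rewrite /lam -cardsUI -[LHS]addn0; congr (_ + _)%N; last first.
  symmetry; apply/eqP; rewrite cards_eq0; apply/eqP/setP => s; rewrite !inE.
  by case: (s \in S) => //=; lia.
by apply: eq_card => s; rewrite !inE; case: (s \in S) => //=; lia.
Qed.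

Lemma lam_adj S (i j : 'I_n) : i.+1 = j :> nat -> lam S i = (lam S j + (j \in S))%N.
Proof.
move=> ij; rewrite (@lam_between S i j) -?ij //; congr (_ + _)%N.
rewrite (_ : [set s in S | _] = if j \in S then [set j] else set0).
  by case: ifP; rewrite ?cards1 ?cards0.
apply/setP => s; rewrite inE; have -> : (i < s <= i.+1)%N = (s == j).
  by rewrite -eqn_leq ij eq_sym.
by case: ifP => jS; rewrite !inE; case: eqVneq => [->|]; rewrite ?jS ?andbF.
Qed.

Lemma lam_leq S (i j : 'I_n) : (i <= j)%N -> (lam S j <= lam S i)%N.
Proof. by move/(lam_between S)->; apply: leq_addr. Qed.

Lemma lam_sub S S' i j : S' \subset S -> lam S i = lam S j -> lam S' i = lam S' j.
Proof.
move=> sSS'; wlog ij : i j / (i <= j)%N.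
  by move=> WL; case/orP: (leq_total i j) => ij eqf; [|symmetry]; apply: WL.
rewrite !(lam_between _ ij) => /eqP; rewrite -[X in _ == X]addn0 eqn_add2l.
rewrite cards_eq0 => /eqP eq0; rewrite (_ : [set s in S' | _] = set0) ?cards0 ?addn0 //.
apply/setP => s; rewrite !inE; apply/negbTE; apply: contra_eqN eq0 => /andP[S's sij].
by apply/set0Pn; exists s; rewrite inE (subsetP sSS').
Qed.

Lemma stab_lam_sub S S' : S' \subset S -> stab (lam S) \subset stab (lam S').
Proof.
by move=> sSS'; apply/subsetP => g /stabP gS; apply/stabP => i; apply: lam_sub (gS i).
Qed.

Lemma lam_nonmem S (i j : 'I_n) :
  lam S i = lam S j -> forall s : 'I_n, (i < s <= j)%N -> s \notin S.
Proof.
move=> eqf s /andP[is_ sj]; apply: contraTN isT => Ss.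
move: eqf; rewrite (lam_between S (ltnW (leq_trans is_ sj))) => /eqP.
rewrite -[X in _ == X]addn0 eqn_add2l cards_eq0 => /eqP/setP/(_ s).
by rewrite !inE Ss is_ sj.
Qed.

End Compositions.

(** * Functions on words and their block symmetrizations *)

Section WordAction.

Variables n k : nat.
Local Notation word := {ffun 'I_n -> 'I_k}.
Local Notation B := {ffun word -> rat^o}.
Implicit Types (w : word) (g h : 'S_n) (x y : B) (S : {set 'I_n}).

Definition wact w g : word := [ffun i => w (g i)].

Lemma wact1 w : wact w 1%g = w.
Proof. by apply/ffunP => i; rewrite ffunE perm1. Qed.

Lemma wactM w g h : wact w (g * h)%g = wact (wact w h) g.
Proof. by apply/ffunP => i; rewrite !ffunE permM. Qed.

Lemma wact_inj g : injective (wact ^~ g).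
Proof.
by move=> w w' /(congr1 (wact ^~ g^-1%g)); rewrite -!wactM mulVg !wact1.
Qed.

Definition bact g x : B := [ffun w => x (wact w g)].

Lemma bact_linear g : linear (bact g).
Proof. by move=> a x y; apply/ffunP => w; rewrite !ffunE. Qed.

HB.instance Definition _ g :=
  GRing.isLinear.Build rat B B *:%R (bact g) (bact_linear g).

Lemma bact1 x : bact 1%g x = x.
Proof. by apply/ffunP => w; rewrite ffunE wact1. Qed.

Lemma bactM g h x : bact (g * h)%g x = bact h (bact g x).
Proof. by apply/ffunP => w; rewrite !ffunE wactM. Qed.

Lemma dot_bact g x y : dot (bact g x) (bact g y) = dot x y.
Proof.
rewrite /dot [RHS](reindex_inj (wact_inj (g := g))).
by apply: eq_bigr => w _; rewrite !ffunE.
Qed.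

Lemma dot_bactV g x y : dot (bact g x) y = dot x (bact g^-1%g y).
Proof. by rewrite -(dot_bact g^-1%g) -bactM mulgV bact1. Qed.

Definition symz (f : 'I_n -> nat) x : B := \sum_(g in stab f) bact g x.

Lemma symz_linear f : linear (symz f).
Proof.
move=> a x y; rewrite /symz scaler_sumr -big_split; apply: eq_bigr => g _.
exact: linearP.
Qed.

HB.instance Definition _ f :=
  GRing.isLinear.Build rat B B *:%R (symz f) (symz_linear f).

Lemma bact_symz f g x : g \in stab f -> bact g (symz f x) = symz f x.
Proof.
move=> fg; rewrite /symz linear_sum [RHS](reindex_inj (mulIg g)).
by apply: eq_big => h; rewrite ?groupMr // => _; rewrite bactM.
Qed.

Lemma symz_bact f g x : g \in stab f -> symz f (bact g x) = symz f x.
Proof.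
move=> fg; rewrite /symz [RHS](reindex_inj (mulgI g)).
by apply: eq_big => h; rewrite ?groupMl // => _; rewrite bactM.
Qed.

Lemma symz_fixed f x : (forall g, g \in stab f -> bact g x = x) ->
  symz f x = #|stab f|%:R *: x.
Proof.
by move=> fx; rewrite /symz (eq_bigr _ fx) sumr_const scaler_nat.
Qed.

Lemma card_stab_neq0 (f : 'I_n -> nat) : #|stab f|%:R != 0 :> rat.
Proof. by rewrite pnatr_eq0 -lt0n cardG_gt0. Qed.

Lemma dot_symz f x y : dot (symz f x) y = dot x (symz f y).
Proof.
rewrite dotC /symz !linear_sum [RHS](reindex_inj invg_inj).
by apply: eq_big => [g|g _] /=; rewrite ?groupV // dotC dot_bactV.
Qed.

Definition inv_pred S : {pred B} := fun x =>
  `[< forall g, g \in stab (lam S) -> bact g x = x >].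

Lemma inv_closed S : submod_closed (inv_pred S).
Proof.
split=> [|a x y /asboolP fx /asboolP fy]; apply/asboolP => g Sg.
  exact: raddf0.
by rewrite linearP /= fx ?fy.
Qed.

Definition inv_space S : {vspace B} := pvs (inv_closed S).

Lemma inv_spaceP S x :
  reflect (forall g, g \in stab (lam S) -> bact g x = x) (x \in inv_space S).
Proof. by rewrite mem_pvs; apply: asboolP. Qed.

(* Values at the monomial of exponent lam S of the homomorphisms killing the   *)
(* multiples of elementary symmetric polynomials, up to dominated monomials.   *)
Definition new_pred S : {pred B} := fun x =>
  `[< x \in inv_space S /\ forall s, s \in S -> symz (lam (S :\ s)) x = 0 >].

Lemma new_closed S : submod_closed (new_pred S).
Proof.
split=> [|a x y /asboolP[Sx fx] /asboolP[Sy fy]]; apply/asboolP.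
  by split=> [|s _]; rewrite ?mem0v ?raddf0.
by split=> [|s Ss]; rewrite ?rpredD ?rpredZ // linearP /= fx ?fy // scaler0 addr0.
Qed.

Definition new_space S : {vspace B} := pvs (new_closed S).

Lemma new_spaceP S x :
  reflect (x \in inv_space S /\ forall s, s \in S -> symz (lam (S :\ s)) x = 0)
          (x \in new_space S).
Proof. by rewrite [x \in new_space S]mem_pvs; apply: asboolP. Qed.

Definition wDes w : {set 'I_n} :=
  [set i : 'I_n | [exists j : 'I_n, (j.+1 == i :> nat) && (w i < w j)%N]].

Lemma wDesPn w (i j : 'I_n) : i.+1 = j :> nat -> j \notin wDes w -> (w i <= w j)%N.
Proof.
move=> ij; rewrite inE negb_exists => /forallP/(_ i).
by rewrite ij eqxx /= -leqNgt.
Qed.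

Definition key w : nat := \sum_(i < n) i * w i.

(* Within the blocks of S a word without descents is weakly increasing; adding *)
(* k times the block index makes it weakly increasing throughout.              *)
Lemma block_sorted_unique S w g : wDes w \subset S -> wDes (wact w g) \subset S ->
  g \in stab (lam S) -> wact w g = w.
Proof.
move=> Sw Swg /stabP Sg; pose b i := (#|S| - lam S i)%N.
have lamS i : (lam S i <= #|S|)%N.
  by apply/subset_leq_card/subsetP => s; rewrite inE => /andP[].
have srt (v : word) : wDes v \subset S ->
    forall i j : 'I_n, (i <= j -> b i * k + v i <= b j * k + v j)%N.
  move=> Sv; apply: (@mono_adjacent _ (fun i => b i * k + v i)%N) => i j ij.
  have := lam_adj S ij; have := lamS i; have := ltn_ord (v i); rewrite /b.
  have [jS|jS] := boolP (j \in S); first by nia.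
  have := @wDesPn v i j ij (contra (subsetP Sv j) jS).
  by move=> vij _ _; rewrite addn0 => ->; rewrite leq_add2l.
have := @sorted_unique _ _ _ g (srt w Sw) (srt _ Swg).
move=> eqw; apply/ffunP => i; apply: val_inj; apply: (@addnI (b i * k)).
by rewrite eqw // => j; rewrite /b Sg ffunE.
Qed.

(** A descent outside S lies within one block; exchanging its two letters would stay in the orbit
    and raise [key]. *)
Lemma max_key_sorted S w :
  (forall g, g \in stab (lam S) -> (key (wact w g) <= key w)%N) -> wDes w \subset S.
Proof.
move=> max_w; apply/subsetP => i; rewrite inE => /existsP[j /andP[/eqP ji lt_w]].
apply/negPn/negP => nSi; have /max_w : tperm j i \in stab (lam S).
  by apply: tperm_stab; rewrite (lam_adj S ji) (negPf nSi) addn0.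
rewrite leqNgt => /negP; apply.
rewrite /key; under [X in (_ < X)%N]eq_bigr do rewrite ffunE.
by apply: (@swap_sum n (@nat_of_ord n) (fun i => w i)); rewrite -?ji.
Qed.

Lemma key_max S w : exists2 g, g \in stab (lam S) &
  forall h, h \in stab (lam S) -> (key (wact w h) <= key (wact w g))%N.
Proof.
case: (arg_maxnP (fun g => key (wact w g)) (group1 (stab_group (lam S)))) => g Sg max.
by exists g.
Qed.

Lemma exists_block_sorted S w :
  exists2 g, g \in stab (lam S) & wDes (wact w g) \subset S.
Proof.
have [g Sg max] := key_max S w; exists g => //; apply: max_key_sorted => h Sh.
by rewrite -wactM; apply: max; exact: (groupM Sh Sg).
Qed.

(** Every maximum of [key] on the orbit is block-sorted, hence equal to w, so the other words have
    smaller key. *)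
Lemma key_sorted S w g : wDes w \subset S -> g \in stab (lam S) ->
  wact w g = w \/ (key (wact w g) < key w)%N.
Proof.
move=> Sw Sg; have [h Sh max] := key_max S w.
have sortedP h' : h' \in stab (lam S) -> key (wact w h') = key (wact w h) ->
    wact w h' = w.
  move=> Sh' eqk; apply: (block_sorted_unique Sw _ Sh'); apply: max_key_sorted => l Sl.
  by rewrite -wactM eqk; apply: max; exact: (groupM Sl Sh').
have eqw := sortedP h Sh erefl; have := max g Sg; rewrite eqw leq_eqVlt.
by case/orP=> [/eqP eqk|]; [left; apply: sortedP; rewrite ?eqw | right].
Qed.

(** Otherwise take, in the support of x, a word w of least key with descents inside S. If some s in
    S is not a descent of w, then w is sorted in the coarser blocks of S - s. Each word of its orbit
    for these, sorted again in the blocks of S, is w or has smaller key, so the sum over that orbit,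
    which is 0, is a positive multiple of x w. *)
Lemma new_space_det S x : x \in new_space S ->
  (forall w, wDes w = S -> x w = 0) -> x = 0.
Proof.
case/new_spaceP=> /inv_spaceP invx symx x0; apply/ffunP => w0; rewrite [RHS]ffunE.
apply/eqP/negPn/negP => nz0.
have [g0 Sg0 Sw0] := exists_block_sorted S w0.
pose P w := (x w != 0) && (wDes w \subset S).
have {nz0 Sw0} Pw0 : P (wact w0 g0).
  by rewrite /P Sw0 andbT; have /ffunP/(_ w0) := invx g0 Sg0; rewrite ffunE => ->.
case: (arg_minnP key Pw0) => w /andP[nzw Sw] min_w.
have [s Ss nws] : exists2 s, s \in S & s \notin wDes w.
  apply/subsetPn; apply: contra nzw => Sw'; apply/eqP/x0.
  by apply/eqP; rewrite eqEsubset Sw.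
have Sw' : wDes w \subset S :\ s.
  by apply/subsetP => i wi; rewrite !inE (subsetP Sw) // andbT; apply: contraNneq nws => <-.
have sub_stab := stab_lam_sub (subsetDl S [set s]).
have val_x g : g \in stab (lam (S :\ s)) -> x (wact w g) = 0 \/ x (wact w g) = x w.
  move=> Sg; have [h Sh Swgh] := exists_block_sorted S (wact w g).
  have /ffunP/(_ (wact w g)) := invx h Sh; rewrite ffunE => <-.
  rewrite -wactM in Swgh *.
  have [->|lt_key] := key_sorted Sw' (groupM (subsetP sub_stab _ Sh) Sg); first by right.
  by left; apply/eqP; apply: contraTT lt_key => nz; rewrite -leqNgt min_w ?/P ?nz.
have /ffunP/(_ w) := symx s Ss; rewrite sum_ffunE [RHS]ffunE.
under eq_bigr do rewrite ffunE.
pose A := [set g : 'S_n in stab (lam (S :\ s)) | x (wact w g) == x w].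
rewrite (bigID (fun g => x (wact w g) == x w)) /= [X in _ + X]big1 => [|g /andP[Sg]].
  rewrite addr0 (eq_bigr (fun=> x w)) => [|g /andP[_ /eqP]//].
  rewrite (eq_bigl (mem A)) => [|g]; last by rewrite !inE.
  rewrite sumr_const => /eqP; rewrite mulrn_eq0 (negPf nzw) orbF cards_eq0.
  by apply/negP/set0Pn; exists 1%g; rewrite inE group1 wact1 eqxx.
by case: (val_x g Sg) => [->//|->]; rewrite eqxx.
Qed.

End WordAction.

(** * Decomposition of block invariants over subsets of S *)

Section NewSpaces.

Variables n k : nat.
Local Notation word := {ffun 'I_n -> 'I_k}.
Local Notation B := {ffun word -> rat^o}.
Implicit Types (w : word) (g h : 'S_n) (x y : B) (S : {set 'I_n}).

Definition full_set : {set 'I_n} := [set i : 'I_n | (0 < i)%N].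

Lemma inv_space_sub S S' : S' \subset S -> (inv_space k S' <= inv_space k S)%VS.
Proof.
move=> sSS'; apply/subvP => x /inv_spaceP fx; apply/inv_spaceP => g Sg.
by apply: fx; apply: subsetP (stab_lam_sub sSS') _ Sg.
Qed.

Lemma new_space_inv S : (new_space k S <= inv_space k S)%VS.
Proof. by apply/subvP => x /new_spaceP[]. Qed.

Lemma wDes_full w : wDes w \subset full_set.
Proof.
by apply/subsetP => i; rewrite !inE => /existsP[j /andP[/eqP<-]].
Qed.

Lemma inv_space_full : inv_space k full_set = fullv.
Proof.
apply/eqP; rewrite eqEsubv subvf; apply/subvP => x _; apply/inv_spaceP => g /stabP fg.
suff -> : g = 1%g by apply: bact1.
suff lam_inj (i j : 'I_n) : (i < j)%N -> lam full_set i <> lam full_set j.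
  apply/permP => i; rewrite perm1; apply: val_inj.
  by case: (ltngtP (g i) i) => // /lam_inj; rewrite fg.
move=> ij /lam_nonmem/(_ j); rewrite ij leqnn => /(_ isT).
by rewrite inE (leq_trans _ ij).
Qed.

Section Stable.

Variable V : {vspace B}.
Hypothesis Vact : forall g x, x \in V -> bact g x \in V.

Lemma symz_stable f x : x \in V -> symz f x \in V.
Proof. by move=> Vx; apply: memv_suml => g _; apply: Vact. Qed.

(** Induction on S: project orthogonally onto the sum U of the invariants for the sets S - s. The
    remainder d is orthogonal to U. Symmetrization is self-adjoint, so the squared norm of a
    symmetrization of d is a pairing of d with an element of U, and d lies in the new space. *)
Lemma inv_sum_new S :
  (V :&: inv_space k S <= \sum_(S' : {set 'I_n} | S' \subset S) (V :&: new_space k S'))%VS.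
Proof.
move: {2}_.+1 (ltnSn #|S|) => m; elim: m S => // m IHm S ltSm.
pose U := (\sum_(s in S) (V :&: inv_space k (S :\ s)))%VS.
have sU : (U <= V :&: inv_space k S)%VS.
  apply/subv_sumP => s _; rewrite subv_cap capvSl (subv_trans (capvSr _ _)) //.
  by rewrite inv_space_sub ?subsetDl.
apply/subvP => w Vw; have [u Uu [Vwu orth]] := orthogonal_decomposition sU Vw.
rewrite -(subrK u w) rpredD //; last first.
  apply: subvP Uu; apply/subv_sumP => s Ss; apply: subv_trans (IHm _ _) _.
    by have := cardsD1 s S; rewrite Ss; lia.
  apply/subv_sumP => S' sS'; apply: sumv_sup (subvv _).
  exact: subset_trans sS' (subsetDl _ _).
apply: subv_sum_in (subxx S) _; move: Vwu; set d := w - u in orth *.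
rewrite !memv_cap => /andP[Vd Sd]; rewrite Vd; apply/new_spaceP; split=> // s Ss.
apply: dot_eq0; rewrite dot_symz dotC; apply: orth; apply: subv_sum_in Ss _.
rewrite memv_cap !symz_stable //; apply/inv_spaceP => g; exact: bact_symz.
Qed.

End Stable.

(** The spaces span everything, by [inv_sum_new] at the full set. By [new_space_det] each has
    dimension at most the number of words with its descent set, and these numbers add up to the
    dimension of the whole space. *)
Lemma new_space_directv :
  directv (\sum_(S : {set 'I_n} | S \subset full_set) new_space k S).
Proof.
rewrite directvEgeq /=; have -> : (\sum_(S : {set 'I_n} | S \subset full_set) new_space k S = fullv)%VS.
  apply/eqP; rewrite eqEsubv subvf.
  have /inv_sum_new-/(_ full_set) : forall g x, x \in fullv -> bact g x \in fullv.
    by move=> *; apply: memvf.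
  by rewrite inv_space_full capfv; under eq_bigr do rewrite capfv.
rewrite dimvf /dim /= muln1.
apply: (@leq_trans (\sum_(S : {set 'I_n} | S \subset full_set) #|[set w : word | wDes w == S]|)).
  apply: leq_sum => S _; apply: dim_le_det => x /new_space_det x0 xw.
  by apply: x0 => w /eqP wS; apply: xw; rewrite inE.
rewrite -[X in (_ <= X)%N]sum1_card (partition_big (@wDes n k) (fun S => S \subset full_set)) /=.
  by apply: leq_sum => S _; rewrite -sum1_card; apply/eq_leq/eq_bigl => w; rewrite inE.
by move=> w _; apply: wDes_full.
Qed.

Lemma new_space_independent (P : pred {set 'I_n}) (x : {set 'I_n} -> B) :
  (forall S, P S -> S \subset full_set) ->
  (forall S, P S -> x S \in new_space k S) ->
  \sum_(S | P S) x S = 0 -> forall S, P S -> x S = 0.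
Proof.
move=> Pf Px sx0 S PS; have /directv_sum_independent := new_space_directv.
move/(_ (fun S => if P S then x S else 0)) => /(_ _ _ S (Pf S PS)); rewrite PS; apply.
  by move=> S' _; case: ifP => [/Px|_] //; apply: mem0v.
rewrite -[RHS]sx0 -big_mkcondr; apply: eq_bigl => S'.
by apply: andb_idl => /Pf.
Qed.

Lemma dim_inv_new (V : {vspace B}) S :
  (forall g x, x \in V -> bact g x \in V) -> S \subset full_set ->
  \dim (V :&: inv_space k S) =
  (\sum_(S' : {set 'I_n} | S' \subset S) \dim (V :&: new_space k S'))%N.
Proof.
move=> Vact sS.
have -> : (V :&: inv_space k S = \sum_(S' : {set 'I_n} | S' \subset S) (V :&: new_space k S'))%VS.
  apply/eqP; rewrite eqEsubv inv_sum_new //=; apply/subv_sumP => S' sS'.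
  by rewrite capvS // (subv_trans (new_space_inv _)) // inv_space_sub.
suff /directvP-> : directv (\sum_(S' : {set 'I_n} | S' \subset S) (V :&: new_space k S'))%VS by [].
apply/directv_sum_independent => x Vx sx0; apply: new_space_independent sx0.
  by move=> S' sS'; apply: subset_trans sS.
by move=> S' /Vx; rewrite memv_cap => /andP[].
Qed.

End NewSpaces.

(** * Tableaux and Specht polynomials *)

Section Tableaux.

Variables (n : nat) (mu : seq nat).
Hypothesis mu_part : is_partition n mu.
Implicit Types (T : {ffun cell mu -> 'I_n}) (c d : cell mu) (g s : 'S_n).

Lemma part_nth i j : (i <= j)%N -> (nth 0 mu j <= nth 0 mu i)%N.
Proof.
have /and3P[srt _ _] := mu_part; move=> ij.
have [jmu|jmu] := ltnP j (size mu); last by rewrite (nth_default _ jmu).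
apply: (@sorted_leq_nth _ geq _ _ 0%N mu srt) => //.
- by move=> y x z /= yx zy; apply: leq_trans zy yx.
- by move=> x; apply: leqnn.
by rewrite inE (leq_ltn_trans ij).
Qed.

Lemma mk_cell r j : (j < nth 0 mu r)%N ->
  exists c, cell_row c = r /\ cell_col c = j.
Proof.
move=> jr; have rmu : (r < size mu)%N by rewrite ltnNge; apply: contraTN jr => rmu; rewrite (nth_default _ rmu).
by exists (@Tagged _ (Ordinal rmu) (fun r : 'I_(size mu) => 'I_(nth 0 mu r)) (Ordinal jr)).
Qed.

Lemma cell_inj c d : cell_row c = cell_row d -> cell_col c = cell_col d -> c = d.
Proof.
case: c d => [r i] [r' j]; rewrite /cell_row /cell_col /= => /val_inj err.
by subst r' => /val_inj->.
Qed.

Lemma cell_colP c : (cell_col c < nth 0 mu (cell_row c))%N.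
Proof. exact: ltn_ord. Qed.

Lemma card_cell : #|cell mu| = n.
Proof.
have /and3P[_ _ /eqP <-] := mu_part; rewrite card_tagged sumnE big_map.
rewrite (eq_bigr (fun r : 'I_(size mu) => nth 0%N mu r)) => [|r _]; last by rewrite card_ord.
by rewrite big_enum /= sumnE (big_nth 0%N) big_mkord.
Qed.

Section OneTableau.

Variables (T : {ffun cell mu -> 'I_n}) (T_tab : tableau T).

Lemma tab_inj : injective T. Proof. exact/injectiveP. Qed.

Lemma tab_surj j : exists c, T c = j.
Proof.
have [T' TK T'K] : bijective T.
  by apply: (inj_card_bij tab_inj); rewrite card_cell card_ord.
by exists (T' j).
Qed.

Definition tinv j : cell mu := sval (cid (tab_surj j)).

Lemma tinvK j : T (tinv j) = j. Proof. by rewrite /tinv; case: (cid _). Qed.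

Lemma tabK c : tinv (T c) = c. Proof. by apply: tab_inj; rewrite tinvK. Qed.

Definition trow j := cell_row (tinv j).
Definition tcol j := cell_col (tinv j).

Lemma trow_tcol_inj i j : trow i = trow j -> tcol i = tcol j -> i = j.
Proof. by move=> er ec; rewrite -[i]tinvK -[j]tinvK; congr (T _); apply: cell_inj. Qed.

Definition col_injective (f : 'I_n -> nat) :=
  forall i j, tcol i = tcol j -> f i = f j -> i = j.

Definition rk (f : 'I_n -> nat) i := #|[set j | (tcol j == tcol i) && (f j < f i)%N]|.

Lemma rk_leq f i : col_injective f -> (rk f i <= f i)%N.
Proof.
move=> cf; rewrite /rk cardE -(size_map f) -[X in (_ <= X)%N](size_iota 0).
apply: uniq_leq_size => [|m /mapP[j]].
  rewrite map_inj_in_uniq ?enum_uniq // => a b.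
  rewrite !mem_enum !inE => /andP[/eqP ca _] /andP[/eqP cb _].
  by apply: cf; rewrite ca.
by rewrite mem_enum inE mem_iota => /andP[_ ltj] ->.
Qed.

(** Of two entries of a column exactly one has the smaller value, so the sum of ranks counts pairs
    and does not depend on f. *)
Lemma sum_rk f : col_injective f ->
  ((\sum_i rk f i).*2 = \sum_i #|[set j | (tcol j == tcol i) && (j != i)]|)%N.
Proof.
move=> cf; pose b (i j : 'I_n) : nat := (tcol j == tcol i) && (f j < f i)%N.
have sumb : (\sum_i rk f i = \sum_i \sum_j b i j)%N.
  apply: eq_bigr => i _; rewrite /rk -sum1_card big_mkcond.
  by apply: eq_bigr => j _; rewrite inE /b; case: (_ && _).
rewrite -addnn {2}sumb exchange_big sumb -big_split; apply: eq_bigr => i _ /=.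
rewrite -big_split -sum1_card [RHS]big_mkcond; apply: eq_bigr => j _ /=.
rewrite inE /b [in X in (_ + X)%N]eq_sym; case: (eqVneq (tcol j) (tcol i)) => //= eqc.
case: (eqVneq j i) => [->|nij] /=; first by rewrite ltnn.
by case: (ltngtP (f i) (f j)) => // eqf; rewrite (cf _ _ eqc) ?eqf ?eqxx in nij.
Qed.

Lemma trow_injective : col_injective trow.
Proof. by move=> i j ec er; apply: trow_tcol_inj. Qed.

(** All places above a cell are in the diagram, since mu is weakly decreasing. *)
Lemma rk_trow i : rk trow i = trow i.
Proof.
apply/eqP; rewrite eqn_leq (rk_leq _ trow_injective) /=.
have ex_j (r : 'I_(trow i)) : exists j, trow j = r /\ tcol j = tcol i.
  have ltr : (tcol i < nth 0 mu r)%N.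
    by apply: leq_trans (cell_colP _) (part_nth (ltnW (ltn_ord r))).
  by have [c [<- <-]] := mk_cell ltr; exists (T c); rewrite /trow /tcol tabK.
pose F r := sval (cid (ex_j r)).
have FP r : trow (F r) = r /\ tcol (F r) = tcol i by rewrite /F; case: (cid _).
have F_inj : injective F.
  by move=> r r' eF; apply: val_inj => /=; have [<- _] := FP r; rewrite eF; case: (FP r').
apply: (@leq_trans #|[set F r | r in 'I_(trow i)]|).
  by rewrite card_imset // cardT size_enum_ord.
apply/subset_leq_card/subsetP.
by move=> _ /imsetP[r _ ->]; rewrite inE; have [-> ->] := FP r; rewrite eqxx ltn_ord.
Qed.

Lemma sum_trow f : col_injective f -> (\sum_i rk f i = \sum_i trow i)%N.
Proof.
move=> cf; apply: double_inj; rewrite sum_rk // -(sum_rk trow_injective).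
by congr (_.*2); apply: eq_bigr => i _; rewrite rk_trow.
Qed.

Lemma sum_col_injective f : col_injective f -> (\sum_i trow i <= \sum_i f i)%N.
Proof. by move=> cf; rewrite -(sum_trow cf); apply: leq_sum => i _; apply: rk_leq. Qed.

(* The ranks within columns of f and of trow have the same sum, and a rank is  *)
(* at most the value.                                                          *)
Lemma col_injective_rk f : col_injective f -> (\sum_i f i <= \sum_i trow i)%N ->
  forall i, rk f i = f i.
Proof.
move=> cf le_f i; apply/eqP; rewrite eqn_leq rk_leq //= leqNgt; apply/negP => lt_i.
suff : (\sum_i rk f i < \sum_i f i)%N by rewrite sum_trow // ltnNge le_f.
rewrite (bigD1 i) //= [X in (_ < X)%N](bigD1 i) //= -addSn leq_add //.
by apply: leq_sum => j _; apply: rk_leq.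
Qed.

(** Minimality makes the values in each column an initial segment of the integers, as the rows are;
    matching equal values permutes the column. *)
Lemma col_injective_perm f : col_injective f -> (\sum_i f i <= \sum_i trow i)%N ->
  exists2 s : 'S_n, s \in stab tcol & forall i, f i = trow (s i).
Proof.
move=> cf le_f; have rkf := col_injective_rk cf le_f.
have ex_j i : exists j, trow j = f i /\ tcol j = tcol i.
  have [lt_f|le_nth] := ltnP (tcol i) (nth 0 mu (f i)).
    by have [c [<- <-]] := mk_cell lt_f; exists (T c); rewrite /trow /tcol tabK.
  (* Here [f i] would be past the foot of the column, which then has at most [f i] entries, too few
     for the rank of i. *)
  pose A := [set j | tcol j == tcol i].
  have : (rk f i < #|A|)%N.
    apply: proper_card; apply/properP; split.
      by apply/subsetP => j; rewrite !inE => /andP[].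
    by exists i; rewrite !inE ?eqxx // ltnn andbF.
  suff : (#|A| <= f i)%N by rewrite rkf ltnNge => ->.
  rewrite cardE -(size_map trow) -[X in (_ <= X)%N](size_iota 0).
  apply: uniq_leq_size => [|m /mapP[j]].
    rewrite map_inj_in_uniq ?enum_uniq // => a b; rewrite !mem_enum !inE.
    by move=> /eqP ca /eqP cb; apply: trow_injective; rewrite ca.
  rewrite mem_enum inE mem_iota => /eqP cj -> /=; rewrite add0n ltnNge.
  apply: contraL le_nth => le_r; rewrite -ltnNge -cj.
  exact: leq_trans (cell_colP _) (part_nth le_r).
pose F i := sval (cid (ex_j i)).
have FP i : trow (F i) = f i /\ tcol (F i) = tcol i by rewrite /F; case: (cid _).
have F_inj : injective F.
  move=> i j eF; have [fi ci] := FP i; have [fj cj] := FP j.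
  by apply: cf; rewrite -?ci -?cj -?fi -?fj eF.
exists (perm F_inj) => [|i]; last by rewrite permE; case: (FP i).
by apply/stabP => i; rewrite permE; case: (FP i).
Qed.

End OneTableau.
End Tableaux.

(** * Words as exponents of monomials *)

Section WordPolynomials.

Variables n k : nat.
Local Notation word := {ffun 'I_n -> 'I_k}.
Local Notation B := {ffun word -> rat^o}.
Implicit Types (w : word) (s : 'S_n) (x y : B) (p q : {mpoly rat[n]}).

Definition mon w : 'X_{1..n} := [multinom (w i : nat) | i < n].

Lemma mon_inj : injective mon.
Proof.
by move=> w w' /mnmP eqm; apply/ffunP => i; apply: val_inj; have := eqm i; rewrite !mnmE.
Qed.

Lemma mon_wact w s : mon (wact w s) = [multinom mon w (s i) | i < n].
Proof. by apply/mnmP => i; rewrite !mnmE ffunE. Qed.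

Definition wcoef p : B := [ffun w => p@_(mon w)].

Lemma wcoef_linear : linear wcoef.
Proof. by move=> a p q; apply/ffunP => w; rewrite !ffunE mcoeffD mcoeffZ. Qed.

HB.instance Definition _ := GRing.isLinear.Build rat {mpoly rat[n]} B *:%R
  wcoef wcoef_linear.

Lemma wcoef_msym s p : wcoef (msym s p) = bact s (wcoef p).
Proof. by apply/ffunP => w; rewrite !ffunE mcoeff_sym mon_wact. Qed.

Definition wpoly x : {mpoly rat[n]} := \sum_w x w *: 'X_[mon w].

Lemma wpoly_linear : linear wpoly.
Proof.
move=> a x y; rewrite /wpoly scaler_sumr -big_split; apply: eq_bigr => w _.
by rewrite !ffunE scalerDl scalerA.
Qed.

HB.instance Definition _ := GRing.isLinear.Build rat B {mpoly rat[n]} *:%R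
  wpoly wpoly_linear.

Lemma wpolyK : cancel wpoly wcoef.
Proof.
move=> x; apply/ffunP => w; rewrite ffunE /wpoly linear_sum (bigD1 w) //= big1.
  by rewrite mcoeffZ mcoeffX eqxx mulr1 addr0.
by move=> w' /negPf ww'; rewrite mcoeffZ mcoeffX (inj_eq mon_inj) ww' mulr0.
Qed.

Lemma wcoefK p : (forall m, m \in msupp p -> exists w, m = mon w) ->
  wpoly (wcoef p) = p.
Proof.
move=> supp_p; apply/mpolyP => m; have [[w ->]|nw] := pselect (exists w, m = mon w).
  by have /ffunP/(_ w) := wpolyK (wcoef p); rewrite !ffunE.
rewrite [RHS]memN_msupp_eq0; last by apply/negP => /supp_p.
rewrite /wpoly linear_sum big1 // => w _ /=; rewrite mcoeffZ mcoeffX.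
by case: eqP => [mw|_]; rewrite ?mulr0 //; case: nw; exists w.
Qed.

Lemma wpoly_bact s x : wpoly (bact s x) = msym s (wpoly x).
Proof.
rewrite /wpoly linear_sum (reindex_inj (wact_inj (g := s^-1%g))) /=.
apply: eq_bigr => w _; rewrite linearZ /= ffunE -wactM mulgV wact1; congr (_ *: _).
by rewrite msymX mon_wact.
Qed.

End WordPolynomials.

Lemma meval_msym n (s : 'S_n) (p : {mpoly rat[n]}) (v : 'I_n -> rat) :
  (msym s p).@[v] = p.@[fun i => v (s i)].
Proof.
rewrite [p]mpolyE (raddf_sum (msym s)) (raddf_sum (meval v)) (raddf_sum (meval _)) /=; apply: eq_bigr => m _.
rewrite msymZ !mevalZ msymX !mevalX; congr (_ * _).
rewrite (reindex_inj (@perm_inj _ s)); apply: eq_bigr => i _.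
by rewrite mnmE permK.
Qed.

(** Induction on the number of moved points: composing s with the transposition of i and s i fixes i
    and moves no new point. *)
Lemma antisym_generate n k (f : 'I_n -> nat) (x : {ffun {ffun 'I_n -> 'I_k} -> rat^o}) :
  (forall i j, f i = f j -> i != j -> bact (tperm i j) x = - x) ->
  forall s, s \in stab f -> bact s x = (-1) ^+ s *: x.
Proof.
move=> anti s; move: {2}_.+1 (ltnSn #|[set i | s i != i]|) => m.
elim: m s => // m IHm s lt_m fs.
have [->|/eqP/permP neq1] := eqVneq s 1%g; first by rewrite bact1 odd_perm1 scale1r.
have [i nsi] : exists i, s i != i.
  apply/existsP; apply: contraT; rewrite negb_exists => /forallP si.
  by case: neq1 => i; rewrite perm1; apply/eqP; rewrite -[_ == _]negbK.
have fi : f i = f (s i) by move/stabP: fs.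
pose t := tperm i (s i); have ft : t \in stab f by apply: tperm_stab.
rewrite -[s](mulgKV t) bactM tpermV IHm; last by rewrite groupM.
  rewrite linearZ /= anti // 1?eq_sym // scalerN -scaleNr; congr (_ *: _).
  by rewrite !odd_permM odd_tperm eq_sym nsi addbT !signr_addb /= signrN; case: (odd_perm s); rewrite ?expr0 ?expr1 ?opprK.
rewrite -ltnS; apply: leq_trans lt_m; apply/proper_card/properP; split.
  apply/subsetP => j; rewrite !inE permM; apply: contraNN => /eqP sj.
  rewrite sj /t; case: tpermP => // [ji|jsi]; first by rewrite -ji sj ji eqxx in nsi.
  by move: nsi; rewrite -(inj_eq (@perm_inj _ s)) -jsi sj eqxx.
by exists i; rewrite !inE // permM tpermR eqxx.
Qed.

(** * Antisymmetry and support of Specht polynomials *)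

Section SpechtVectors.

Variables (n : nat) (mu : seq nat).
Hypothesis mu_part : is_partition n mu.
Local Notation k := (size mu).
Local Notation word := {ffun 'I_n -> 'I_k}.
Local Notation B := {ffun word -> rat^o}.
Local Notation sp := (@specht_poly n mu).
Implicit Types (T : {ffun cell mu -> 'I_n}) (c d : cell mu) (s : 'S_n).

Definition below c d := (cell_col c == cell_col d) && (cell_row c < cell_row d)%N.

Lemma msym_specht s T : msym s (sp T) = sp [ffun c => s (T c)].
Proof.
rewrite /specht_poly rmorph_prod; apply: eq_bigr => c _.
rewrite rmorph_prod; apply: eq_bigr => d _.
by rewrite rmorphB /= !msymX !ffunE; congr ('X_[_] - 'X_[_]);
  apply/mnmP=> i; rewrite !mnmE -[i in RHS](permKV s) (inj_eq perm_inj).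
Qed.

Lemma specht_pair T :
  sp T = \prod_(u : cell mu * cell mu | below u.1 u.2) ('X_(T u.1) - 'X_(T u.2)).
Proof. by rewrite /specht_poly pair_big_dep. Qed.

(** The left side takes each pair of a column in both orders; reversing an order costs a sign. *)
Lemma specht_sqr T :
  \prod_(u : cell mu * cell mu | (cell_col u.1 == cell_col u.2) && (u.1 != u.2))
    ('X_(T u.1) - 'X_(T u.2)) =
  sp T ^+ 2 * \prod_(u : cell mu * cell mu | below u.1 u.2) (-1) :> {mpoly rat[n]}.
Proof.
rewrite (bigID (fun u : cell mu * cell mu => cell_row u.1 < cell_row u.2)%N) /=.
rewrite expr2 -mulrA; congr (_ * _).
  rewrite specht_pair; apply: eq_bigl => -[c d] /=; rewrite /below.
  case: eqP => //= eqc; case: ltnP; rewrite ?andbF // andbT => lt_cd.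
  by apply: contraTneq lt_cd => ->; rewrite ltnn.
rewrite (reindex_inj (h := fun u : cell mu * cell mu => (u.2, u.1))); last first.
  by move=> [a b] [a' b'] [-> ->].
rewrite specht_pair -big_split /=; apply: eq_big => [[c d]|[c d] _] /=; last first.
  by rewrite mulrN1 opprB.
rewrite /below eq_sym -leqNgt ltn_neqAle; case: eqP => //= eqc; congr (_ && _).
by apply/idP/idP; apply: contraNN => /eqP; [move/cell_inj => ->|move->].
Qed.

Lemma specht_neq0 T : tableau T -> sp T != 0.
Proof.
move=> /injectiveP T_inj; pose v (i : 'I_n) : rat := (i : nat)%:R.
suff : (sp T).@[v] != 0 by apply: contra_neq => ->; rewrite meval0.
rewrite specht_pair rmorph_prod; apply/prodf_neq0 => -[c d] /andP[_ lt_cd].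
rewrite rmorphB /= !mevalXU subr_eq0 eqr_nat; apply: contraTneq lt_cd => /val_inj/T_inj->.
by rewrite ltnn.
Qed.

(* The square is a product over ordered pairs, hence symmetric; evaluating the *)
(* cofactor of 'X_(T c0) - 'X_(T d0) where these variables agree gives the sign. *)
Lemma specht_tperm T c0 d0 : tableau T -> below c0 d0 ->
  msym (tperm (T c0) (T d0)) (sp T) = - sp T.
Proof.
move=> T_tab cd0; have /injectiveP T_inj := T_tab.
set t := tperm _ _; have /andP[/eqP col0 row0] := cd0.
have sqr : msym t (sp T) ^+ 2 = sp T ^+ 2.
  have nz : \prod_(u : cell mu * cell mu | below u.1 u.2) (-1) != 0 :> {mpoly rat[n]}.
    by apply/prodf_neq0 => u _; rewrite oppr_eq0 oner_eq0.
  apply: (mulIf nz); rewrite msym_specht -!specht_sqr.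
  pose tau := tperm c0 d0; pose h (u : cell mu * cell mu) := (tau u.1, tau u.2).
  have h_inj : injective h by move=> [a b] [a' b'] [/perm_inj-> /perm_inj->].
  have col_tau c : cell_col (tau c) = cell_col c.
    by rewrite /tau; case: tpermP => [->|->|].
  rewrite [RHS](reindex_inj h_inj) /=; apply: eq_big => -[c d] /=.
    by rewrite !col_tau (inj_eq perm_inj).
  by rewrite !ffunE -!inj_tperm.
move/eqP: sqr; rewrite eqf_sqr => /orP[|] /eqP // sp_t.
pose q := \prod_(u : cell mu * cell mu | below u.1 u.2 && (u != (c0, d0)))
  ('X_(T u.1) - 'X_(T u.2)) : {mpoly rat[n]}.
have def_sp : sp T = ('X_(T c0) - 'X_(T d0)) * q.
  by rewrite specht_pair (bigD1 (c0, d0)).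
have msymXU (i : 'I_n) : msym t 'X_i = 'X_(t i) :> {mpoly rat[n]}.
  rewrite msymX; congr 'X_[_]; apply/mnmP=> j; rewrite !mnmE.
  by rewrite -[j in RHS](permKV t) (inj_eq perm_inj).
have nz : 'X_(T c0) - 'X_(T d0) != 0 :> {mpoly rat[n]}.
  by apply: contra_neq (specht_neq0 T_tab) => X0; rewrite def_sp X0 mul0r.
have qt : msym t q = - q.
  apply: (mulfI nz); rewrite mulrN -def_sp -sp_t def_sp msymM rmorphB /= !msymXU.
  by rewrite tpermL tpermR -mulNr opprB.
pose v (i : 'I_n) : rat := if i == T d0 then (T c0 : nat)%:R else (i : nat)%:R.
have vt i : v (t i) = v i.
  rewrite /v /t; case: tpermP => [->|->|//]; rewrite ?eqxx //.
    by case: ifP.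
  by case: eqP => // ->.
have q0 : q.@[v] = 0.
  have : q.@[v] = - q.@[v].
    by rewrite -mevalN -qt meval_msym; apply: meval_eq => i; rewrite vt.
  by set r := q.@[v]; lra.
move/eqP: q0; rewrite /q rmorph_prod => /prodf_eq0[[c d] /= /andP[/andP[/eqP colcd rowcd] ncd]].
rewrite rmorphB /= !mevalXU /v subr_eq0 !(inj_eq T_inj).
have ncd' : c != d by apply: contraTneq rowcd => ->; rewrite ltnn.
case: (eqVneq c d0) => [ec|_]; case: (eqVneq d d0) => [ed|_]; rewrite eqr_nat => /eqP/val_inj/T_inj.
- by move=> _; rewrite ec ed eqxx in ncd'.
- by move=> ed; rewrite ec -ed in rowcd; have := ltn_trans row0 rowcd; rewrite ltnn.
- by move=> ec; rewrite ec ed eqxx in ncd.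
by move=> ec; rewrite ec eqxx in ncd'.
Qed.

End SpechtVectors.

Section SpechtSpace.

Variables (n : nat) (mu : seq nat).
Hypothesis mu_part : is_partition n mu.
Local Notation k := (size mu).
Local Notation word := {ffun 'I_n -> 'I_k}.
Local Notation B := {ffun word -> rat^o}.
Local Notation sp := (@specht_poly n mu).
Implicit Types (T : {ffun cell mu -> 'I_n}) (c d : cell mu) (s : 'S_n).
Implicit Types (p q : {mpoly rat[n]}) (m : 'X_{1..n}) (w : word) (x y : B).

Lemma reindex_tab T (F : 'I_n -> nat) : tableau T -> (\sum_i F i = \sum_c F (T c))%N.
Proof.
move=> T_tab; rewrite (reindex T) //; apply: onW_bij.
by exists (tinv mu_part T_tab); [apply: tabK | apply: tinvK].
Qed.

(** The degree of the Specht polynomials, and the least degree of an exponent injective on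
    columns. *)
Definition row_sum : nat := (\sum_(c : cell mu) cell_row c)%N.

Lemma sum_trow_row_sum T (T_tab : tableau T) :
  (\sum_i trow mu_part T_tab i = row_sum)%N.
Proof.
by rewrite (reindex_tab _ T_tab); apply: eq_bigr => c _; rewrite /trow tabK.
Qed.

Definition rword T (T_tab : tableau T) : word :=
  [ffun j => tag (tinv mu_part T_tab j)].

Lemma rwordE T (T_tab : tableau T) j :
  rword T_tab j = trow mu_part T_tab j :> nat.
Proof. by rewrite ffunE. Qed.

Lemma specht_homog T : tableau T -> sp T \is row_sum.-homog.
Proof.
move=> T_tab; rewrite specht_pair.
have -> : row_sum = (\sum_(u : cell mu * cell mu | below u.1 u.2) 1)%N.
  rewrite -(pair_big_dep xpredT (@below mu) (fun _ _ => 1%N)) /= (exchange_big_dep xpredT) //=.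
  apply: eq_bigr => d _; rewrite -[cell_row d](congr1 (@cell_row mu) (tabK mu_part T_tab d)).
  rewrite -[LHS](rk_trow mu_part T_tab (T d)) /rk -sum1_card big_mkcond /=.
  rewrite (reindex_tab _ T_tab) [RHS]big_mkcond; apply: eq_bigr => c _.
  by rewrite inE /tcol /trow !tabK /below.
elim/big_ind2: _ => [|p d q e|u _]; [exact: dhomog1 | exact: dhomogM |].
by rewrite rpredB // dhomogX /= mdeg1.
Qed.

Definition col_antisym T (T_tab : tableau T) p :=
  forall i j, tcol mu_part T_tab i = tcol mu_part T_tab j -> i != j ->
  msym (tperm i j) p = - p.

Lemma specht_antisym T (T_tab : tableau T) : col_antisym T_tab (sp T).
Proof.
move=> i j ecol nij; have [eT eT'] := (tinvK mu_part T_tab i, tinvK mu_part T_tab j).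
have [lt_r|lt_r|eq_r] := ltngtP (trow mu_part T_tab i) (trow mu_part T_tab j).
- by rewrite -eT -eT' specht_tperm // /below -[cell_col _]/(tcol _ _ _) ecol eqxx.
- by rewrite tpermC -eT -eT' specht_tperm // /below -[cell_col _]/(tcol _ _ _) -ecol eqxx.
by rewrite (trow_tcol_inj eq_r ecol) eqxx in nij.
Qed.

Arguments specht_antisym [T] T_tab.

Section OneTableau.

Variables (T : {ffun cell mu -> 'I_n}) (T_tab : tableau T).
Local Notation trow := (trow mu_part T_tab).
Local Notation tcol := (tcol mu_part T_tab).

(** Exchanging two equal exponents in a column fixes m and negates the coefficient. *)
Lemma antisym_supp p m : col_antisym T_tab p -> p@_m != 0 ->
  col_injective mu_part T_tab m.
Proof.
move=> anti_p; apply: contra_neqP => /existsNP[i /existsNP[j /not_implyP[ec /not_implyP[em /eqP nij]]]].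
have /(congr1 (mcoeff m)) := anti_p i j ec nij; rewrite mcoeff_sym mcoeffN.
have -> : [multinom m (tperm i j l) | l < n] = m.
  by apply/mnmP => l; rewrite mnmE; case: tpermP => [->|->|].
by set r := p@_m; lra.
Qed.

Lemma antisym_word p m : col_antisym T_tab p -> p@_m != 0 ->
  (mdeg m <= row_sum)%N ->
  exists2 s, s \in stab tcol & m = mon (wact (rword T_tab) s).
Proof.
move=> anti_p nz le_m; have cm := antisym_supp anti_p nz.
have [|s Cs ms] := col_injective_perm cm; first by rewrite sum_trow_row_sum -mdegE.
by exists s => //; apply/mnmP => i; rewrite mnmE ffunE rwordE.
Qed.

Lemma antisym_wcoef p s : col_antisym T_tab p -> s \in stab tcol ->
  bact s (wcoef k p) = (-1) ^+ s *: wcoef k p.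
Proof.
move=> anti_p; apply: antisym_generate => i j ec nij.
by rewrite -wcoef_msym anti_p // linearN.
Qed.

(** The degree bound leaves only column rearrangements of the row word in the support, where
    coefficients agree up to sign. *)
Lemma antisym_det p : col_antisym T_tab p ->
  (forall m, p@_m != 0 -> (mdeg m <= row_sum)%N) ->
  p@_(mon (rword T_tab)) = 0 -> p = 0.
Proof.
move=> anti_p deg_p p0; apply/mpolyP => m; rewrite mcoeff0.
apply/eqP/negPn/negP => nz; have [s Cs def_m] := antisym_word anti_p nz (deg_p m nz).
have /ffunP/(_ (rword T_tab)) := antisym_wcoef anti_p Cs.
rewrite !ffunE p0 scaler0 -def_m => /eqP; exact/negP.
Qed.

Lemma specht_deg m : (sp T)@_m != 0 -> mdeg m = row_sum.
Proof. by move/dhomogP: (specht_homog T_tab) => h nz; apply: h; rewrite mcoeff_msupp. Qed.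

Lemma specht_rword : (sp T)@_(mon (rword T_tab)) != 0.
Proof.
apply: contra_neq (specht_neq0 T_tab); apply: antisym_det => [|m /specht_deg->//].
exact: specht_antisym.
Qed.

Lemma specht_wcoefK : wpoly (wcoef k (sp T)) = sp T.
Proof.
apply: wcoefK => m; rewrite mcoeff_msupp => nz.
have [|s _ ->] := antisym_word (specht_antisym T_tab) nz; first by rewrite specht_deg.
by exists (wact (rword T_tab) s).
Qed.

End OneTableau.

Definition specht_vec T : B := wcoef k (sp T).

Definition specht_space : {vspace B} := <<[seq specht_vec T | T in @tableau n mu]>>.

Lemma specht_vec_mem T : tableau T -> specht_vec T \in specht_space.
Proof. by move=> T_tab; apply/memv_span/map_f; rewrite mem_enum. Qed.

Lemma specht_space_ind (P : {pred B}) : submod_closed P ->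
  (forall T, tableau T -> specht_vec T \in P) -> forall x, x \in specht_space -> x \in P.
Proof.
move=> cP PT x Vx; rewrite -(mem_pvs cP); apply: subvP Vx; apply/span_subvP.
by move=> _ /mapP[T + ->]; rewrite mem_enum mem_pvs; apply: PT.
Qed.

Lemma bact_specht_vec s T : bact s (specht_vec T) = specht_vec [ffun c => s (T c)].
Proof. by rewrite /specht_vec -msym_specht wcoef_msym. Qed.

Lemma tableau_perm s T : tableau T -> tableau [ffun c => s (T c)].
Proof.
move=> /injectiveP T_inj; apply/injectiveP => c d; rewrite !ffunE.
by move/perm_inj/T_inj.
Qed.

Lemma specht_space_act s x : x \in specht_space -> bact s x \in specht_space.
Proof.
move=> Vx; rewrite [_ \in _](_ : _ = (x \in [pred x | bact s x \in specht_space])) //.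
move: x Vx; apply: specht_space_ind => [|T T_tab].
  split=> [|a x y]; rewrite !inE ?linear0 ?mem0v // => Vx Vy.
  by rewrite linearP rpredD ?rpredZ.
by rewrite inE bact_specht_vec specht_vec_mem ?tableau_perm.
Qed.

Lemma specht_vec_supp T (T_tab : tableau T) w : specht_vec T w != 0 ->
  exists2 s, s \in stab (tcol mu_part T_tab) & w = wact (rword T_tab) s.
Proof.
rewrite ffunE => nz.
have [|s Cs /mon_inj->] := antisym_word (specht_antisym T_tab) nz; last by exists s.
by rewrite (specht_deg T_tab nz).
Qed.

Lemma specht_space_supp x w : x \in specht_space -> x w != 0 ->
  (\sum_i w i = row_sum)%N /\ forall r, #|[set j | w j == r :> nat]| = nth 0%N mu r.
Proof.
set Q := (X in _ -> _ -> X) => Vx nz; apply: contra_neqP nz => nQ.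
suff : x \in [pred x : B | x w == 0] by move/eqP.
move: x Vx; apply: specht_space_ind => [|T T_tab].
  split=> [|a x y]; rewrite !inE ffunE // => /eqP x0 /eqP y0.
  by rewrite ffunE x0 y0 scaler0 addr0.
rewrite inE; apply/negPn/negP => nz; apply: nQ.
have [s Cs def_w] := specht_vec_supp T_tab nz; split.
  by move: nz; rewrite ffunE => /specht_deg<- //; rewrite mdegE; apply: eq_bigr => i _; rewrite mnmE.
move=> r; rewrite -sum1_card big_mkcond def_w (reindex_inj (@perm_inj _ s^-1%g)) /=.
rewrite (reindex_tab _ T_tab).
rewrite (eq_bigr (fun c : cell mu => if tag c == r :> nat then 1 else 0)%N) => [|c _]; last first.
  by rewrite inE !ffunE permKV tabK.
rewrite -big_mkcond /= sum1dep_card.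
have [rk|rk] := ltnP r k; last first.
  rewrite nth_default //; apply: eq_card0 => c; rewrite inE; apply/negbTE.
  by rewrite neq_ltn (leq_trans (ltn_ord _) rk).
rewrite -[RHS]card_ord -(card_imset (f := fun j : 'I_(nth 0%N mu r) =>
  @Tagged _ (Ordinal rk) (fun r : 'I_k => 'I_(nth 0%N mu r)) j)); last first.
  by move=> i j /eqP; rewrite eq_Tagged /= => /eqP.
apply: eq_card => c; rewrite inE /=; apply/eqP/imsetP => [er|[i _ ->] //].
have jr : (cell_col c < nth 0%N mu r)%N by rewrite -er cell_colP.
by exists (Ordinal jr) => //; apply: cell_inj.
Qed.

End SpechtSpace.

Arguments specht_antisym [n mu mu_part T] T_tab.

(** * Lattice words and standard tableaux *)

Section StandardTableaux.

Variables (n : nat) (mu : seq nat).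
Hypothesis mu_part : is_partition n mu.
Local Notation k := (size mu).
Local Notation word := {ffun 'I_n -> 'I_k}.
Local Notation B := {ffun word -> rat^o}.
Local Notation sp := (@specht_poly n mu).
Implicit Types (T : {ffun cell mu -> 'I_n}) (c d : cell mu) (s : 'S_n).
Implicit Types (p : {mpoly rat[n]}) (m : 'X_{1..n}) (w : word) (x y : B).

(** The operator [raise] in terms of exponents; [raise_mseq] compares the two. *)
Definition pol_raise i p m : rat :=
  \sum_(j < n) (if m j == i then p@_(m + U_(j)) else 0).

(* The left side is still antisymmetric along columns, but its degree is too   *)
(* small for a column-injective exponent.                                      *)
Lemma pol_raise_specht T i m : tableau T -> pol_raise i (sp T) m = 0.
Proof.
move=> T_tab; apply/eqP/negPn/negP => nz.
have cm : col_injective mu_part T_tab m.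
  move=> a b ec em; apply/eqP; apply: contra_neqT nz => nab.
  pose t := tperm a b; suff : pol_raise i (sp T) m = - pol_raise i (sp T) m.
    by set r := pol_raise _ _ _; lra.
  rewrite {1}/pol_raise (reindex_inj (@perm_inj _ t)) /= -sumrN.
  have mt j : m (t j) = m j by rewrite /t; case: tpermP => [->|->|].
  apply: eq_bigr => j _; rewrite mt; case: ifP => _; last by rewrite oppr0.
  rewrite -mcoeffN -(specht_antisym T_tab _ _ ec nab) mcoeff_sym; congr (_@_ _).
  apply/mnmP => l; rewrite !mnmE mt; congr (_ + _)%N; congr nat_of_bool.
  by rewrite -(inj_eq (@perm_inj _ t)) tpermK.
have [j nzj] : exists j, (sp T)@_(m + U_(j)) != 0.
  apply/existsP; apply: contraNT nz; rewrite negb_exists => /forallP z.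
  by apply/eqP/big1 => j _; have := z j; rewrite negbK => /eqP->; rewrite if_same.
have := sum_col_injective cm; rewrite sum_trow_row_sum -mdegE -(specht_deg mu_part T_tab nzj).
by rewrite mdegD mdeg1 addn1 ltnn.
Qed.

Lemma pol_raise0 i x m : x \in specht_space n mu -> pol_raise i (wpoly x) m = 0.
Proof.
move=> Vx; apply/eqP; rewrite -[_ == _]/(x \in [pred x : B | pol_raise i (wpoly x) m == 0]).
move: x Vx; apply: (specht_space_ind) => [|T T_tab].
  split=> [|a x y]; rewrite !inE.
    by rewrite /pol_raise big1 // => j _; rewrite linear0 mcoeff0 if_same.
  move=> /eqP x0 /eqP y0; rewrite /pol_raise (eq_bigr (fun j : 'I_n =>
    a * (if m j == i then (wpoly x)@_(m + U_(j)) else 0) +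
    (if m j == i then (wpoly y)@_(m + U_(j)) else 0))).
    by rewrite big_split /= -mulr_sumr -/(pol_raise i (wpoly x) m) x0 mulr0 add0r; apply/eqP.
  by move=> j _; rewrite linearP mcoeffD mcoeffZ; case: ifP; rewrite ?mulr0 ?addr0.
by rewrite inE (specht_wcoefK mu_part T_tab) pol_raise_specht.
Qed.

(* The head of the list is the last letter of the word: removing it from a     *)
(* lattice word removes the largest entry of the corresponding tableau.        *)
Definition mseq (u : seq nat) : 'X_{1..n} := [multinom nth 0%N u (rev_ord j) | j < n].

Lemma raiseE i g (u : seq nat) : raise i g u =
  \sum_(q < size u) (if nth 0%N u q == i then g (set_nth 0%N u q i.+1) else 0).
Proof.
elim: u g => [|a u IHu] g; first by rewrite big_ord0.
by rewrite /= IHu big_ord_recl.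
Qed.

Lemma raise_mseq i p u : size u = n ->
  raise i (fun v => p@_(mseq v)) u = pol_raise i p (mseq u).
Proof.
move=> szu; rewrite raiseE szu /pol_raise (reindex_inj rev_ord_inj) /=.
apply: eq_bigr => j _; rewrite mnmE; case: eqP => // uj; congr (p@_ _).
apply/mnmP => l; rewrite !mnmE nth_set_nth /= -[(_ == _ - _)%N]/(rev_ord l == rev_ord j).
rewrite (inj_eq rev_ord_inj) eq_sym; case: eqP => [<-|_]; last by rewrite addn0.
by rewrite uj addn1.
Qed.

Lemma count_drop (r q : nat) (u : seq nat) : size u = n ->
  count_mem r (drop q u) = #|[set j : 'I_n | (j < n - q)%N && (mseq u j == r)]|.
Proof.
move=> szu; rewrite -sum1_count (big_nth 0%N) size_drop szu.
rewrite (eq_bigl (fun i => nth 0%N u (i + q) == r)) => [|i]; last by rewrite nth_drop addnC.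
rewrite -(big_addn _ _ _ (fun i => nth 0%N u i == r) (fun _ => 1%N)) big_geq_mkord.
rewrite -sum1_card (reindex_inj rev_ord_inj) /=; apply: eq_bigl => j.
by rewrite inE mnmE andbC /=; congr (_ && _); have := ltn_ord j; lia.
Qed.

Lemma count_mseq (r : nat) (u : seq nat) : size u = n -> count_mem r u = #|[set j | mseq u j == r]|.
Proof.
move=> szu; rewrite -{1}[u]drop0 count_drop //; apply: eq_card => j.
by rewrite !inE subn0 ltn_ord.
Qed.

Lemma lattice_drop q u : lattice u -> lattice (drop q u).
Proof. by elim: u q => [|a u IHu] [|q] //= /andP[/IHu]. Qed.

Section FromWord.

Variable w : word.
Hypothesis w_content : forall r, #|[set j | w j == r :> nat]| = nth 0%N mu r.
Hypothesis w_lattice : forall (l r : nat), (l <= n)%N ->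
  (#|[set j : 'I_n | (j < l)%N && (w j == r.+1 :> nat)]| <=
   #|[set j : 'I_n | (j < l)%N && (w j == r :> nat)]|)%N.

(** The column that j will occupy: its rank among the positions with the same letter, that is, in
    its row. *)
Definition occ (j : 'I_n) := #|[set i : 'I_n | (i < j)%N && (w i == w j)]|.

Lemma occ_lt j : (occ j < nth 0%N mu (w j))%N.
Proof.
rewrite -w_content; apply: proper_card; apply/properP; split.
  by apply/subsetP => i; rewrite !inE => /andP[_ /eqP->].
by exists j; rewrite !inE ?eqxx // ltnn.
Qed.

Definition wcell j : cell mu :=
  @Tagged _ (w j) (fun r : 'I_k => 'I_(nth 0%N mu r)) (Ordinal (occ_lt j)).

Lemma occ_mono i j : w i = w j -> (i < j)%N -> (occ i < occ j)%N.
Proof.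
move=> wij ij; apply: proper_card; apply/properP; split.
  by apply/subsetP => l; rewrite !inE wij => /andP[li ->]; rewrite (ltn_trans li ij).
by exists i; rewrite !inE ?ij ?wij ?eqxx // ltnn.
Qed.

Lemma wcell_inj : injective wcell.
Proof.
move=> i j eq_ij; have ew : w i = w j by have := congr1 (@tag _ _) eq_ij.
have eo : occ i = occ j by have := congr1 (@cell_col mu) eq_ij.
by apply: val_inj; case: (ltngtP i j) => // /occ_mono; rewrite ew eo ltnn => /(_ erefl).
Qed.

(** Rows increase by construction. If d, lower in the column of c, held a smaller entry, then among
    the entries up to that of d the row of d would outnumber the row of c, against the lattice
    condition. *)
Lemma standard_of_word :
  exists T, exists T_tab : tableau T, standard T /\ rword mu_part T_tab = w.
Proof.
have [cinv wK invK] : bijective wcell.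
  by apply: (inj_card_bij wcell_inj); rewrite (card_cell mu_part) card_ord.
pose T : {ffun cell mu -> 'I_n} := [ffun c => cinv c].
have TK : cancel T wcell by move=> c; rewrite ffunE invK.
have T_tab : tableau T by apply/injectiveP/(can_inj TK).
have rowT c : w (T c) = tag c by rewrite -[in RHS](TK c).
have colT c : occ (T c) = cell_col c by rewrite -[in RHS](TK c).
exists T, T_tab; split; last first.
  by apply/ffunP => j; rewrite ffunE -rowT tinvK.
apply/forallP => c; apply/forallP => d; apply/andP; split; apply/implyP.
  move=> /andP[/eqP/val_inj er lt_c]; rewrite ltnNge; apply: contraL lt_c.
  rewrite leq_eqVlt -leqNgt -!colT => /orP[/eqP/val_inj->//|dc].
  by apply/ltnW/occ_mono; rewrite // !rowT er.
move=> /andP[/eqP ec lt_r]; rewrite ltnNge; apply/negP; rewrite leq_eqVlt.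
case/orP=> [/eqP/val_inj eT|dc].
  by move/injectiveP: T_tab => /(_ _ _ eT) edc; rewrite edc ltnn in lt_r.
pose N l r := #|[set j : 'I_n | (j < l)%N && (w j == r :> nat)]|.
have N_dec l r r' : (l <= n)%N -> (r <= r')%N -> (N l r' <= N l r)%N.
  move=> ln; elim: r' => [|r' IHr']; first by rewrite leqn0 => /eqP->.
  rewrite leq_eqVlt => /orP[/eqP->//|/IHr']; apply: leq_trans; exact: w_lattice.
have le1 : (N (T d).+1 (cell_row d) <= N (T d).+1 (cell_row c))%N.
  by apply: N_dec; rewrite ?ltn_ord // ltnW.
have le2 : (N (T d).+1 (cell_row c) <= occ (T c))%N.
  apply/subset_leq_card/subsetP => j; rewrite !inE rowT => /andP[jd /eqP/val_inj->].
  by rewrite eqxx andbT (leq_trans jd).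
have : (occ (T d) < N (T d).+1 (cell_row d))%N.
  apply: proper_card; apply/properP; split.
    apply/subsetP => j; rewrite !inE rowT => /andP[jd /eqP->].
    by rewrite eqxx ltnS (ltnW jd).
  by exists (T d); rewrite !inE ?ltnn // ltnSn rowT eqxx.
move/leq_trans/(_ le1)/leq_trans/(_ le2); rewrite !colT ec ltnn //.
Qed.

End FromWord.

(** By [pol_raise0] x is a highest weight vector, of weight mu, so [lattice_det] applies; lattice
    words of content mu are row words of standard tableaux. *)
Lemma specht_space_det x : x \in specht_space n mu ->
  (forall T (T_tab : tableau T), standard T -> x (rword mu_part T_tab) = 0) -> x = 0.
Proof.
move=> Vx x0; suff p0 : wpoly x = 0 by rewrite -[x]wpolyK p0 linear0.
have supp m : (wpoly x)@_m != 0 -> exists2 w, m = mon w & x w != 0.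
  rewrite /wpoly linear_sum /= => nz.
  have [w nzw] : exists w, (x w *: 'X_[mon w])@_m != 0.
    apply/existsP; apply: contraNT nz; rewrite negb_exists => /forallP z.
    by apply/eqP/big1 => w _; have := z w; rewrite negbK => /eqP.
  move: nzw; rewrite mcoeffZ mcoeffX mulf_eq0 negb_or => /andP[nzx].
  by rewrite pnatr_eq0 eqb0 negbK => /eqP <-; exists w.
apply/mpolyP => m; rewrite mcoeff0.
pose u := [seq m (rev_ord j) | j <- enum 'I_n].
have szu : size u = n by rewrite size_map size_enum_ord.
have -> : m = mseq u.
  apply/mnmP => j; rewrite mnmE (nth_map j) ?size_enum_ord ?ltn_ord //.
  by rewrite nth_ord_enum rev_ordK.
apply: (@lattice_det k n (nth 0%N mu) (fun v => (wpoly x)@_(mseq v))) => //.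
- by move=> i; apply: (part_nth mu_part (leqnSn i)).
- by move=> i ki; rewrite nth_default.
- move=> v szv /supp[w def_w nzw] i; rewrite count_mseq // def_w.
  have [_ <-] := specht_space_supp mu_part Vx nzw.
  by apply: eq_card => j; rewrite !inE mnmE.
- by move=> i v szv; rewrite raise_mseq // pol_raise0.
move=> v szv lat_v; apply/eqP/negPn/negP => /supp[w def_w nzw].
have [_ w_cont] := specht_space_supp mu_part Vx nzw.
have [|T [T_tab [T_std def_T]]] := standard_of_word w_cont; last first.
  by move: nzw; rewrite -def_T x0 ?eqxx.
move=> l r ln; have := lattice_count r (lattice_drop (n - l) lat_v).
rewrite !count_drop // subKn // def_w.
have eqA r' : [set j : 'I_n | (j < l)%N && (mon w j == r')] =
    [set j : 'I_n | (j < l)%N && (w j == r' :> nat)].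
  by apply/setP => j; rewrite !inE mnmE.
by rewrite !eqA.
Qed.

End StandardTableaux.

Lemma dim_span_indep (K : fieldType) (vT : vectType K) (I : finType) (A : {set I})
    (F : I -> vT) :
  (forall a : I -> K, \sum_(i in A) a i *: F i = 0 -> forall i, i \in A -> a i = 0) ->
  \dim <<[seq F i | i in A]>> = #|A|.
Proof.
move=> indF; apply/eqP; rewrite eqn_leq (leq_trans (dim_span _)) ?size_map -?cardE //=.
pose Phi (a : {ffun {i | i \in A} -> K^o}) := \sum_u a u *: F (val u).
have Phi_lin : linear Phi.
  move=> b x y; rewrite /Phi scaler_sumr -big_split; apply: eq_bigr => u _ /=.
  by rewrite !ffunE scalerDl scalerA.
pose Phil : {linear {ffun {i | i \in A} -> K^o} -> vT} :=
  HB.pack Phi (GRing.isLinear.Build K _ _ *:%R Phi Phi_lin).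
have ker0 : (fullv :&: lker (linfun Phil) = 0)%VS.
  apply/eqP; rewrite capfv -subv0; apply/subvP => a; rewrite memv_ker lfunE memv0 /=.
  move=> /eqP Phi0; apply/eqP/ffunP => u; rewrite [RHS]ffunE.
  pose b i := oapp a 0 (insub i : option {i | i \in A}).
  rewrite -(_ : b (val u) = a u); last by rewrite /b valK.
  apply: indF (valP u); rewrite -[RHS]Phi0 (big_sub A) /=.
  by apply: eq_bigr => v _; rewrite /b valK.
have := limg_dim_eq ker0; rewrite dimvf /dim /= muln1 card_sig => <-.
apply/dimvS/subvP => _ /memv_imgP[a _ ->]; rewrite (lfunE Phil); apply: memv_suml => u _.
by apply/memvZ/memv_span/map_f; rewrite mem_enum (valP u).
Qed.

(** * Standard tableaux and invariants of Young subgroups *)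

Section StandardBasis.

Variables (n : nat) (mu : seq nat).
Hypothesis mu_part : is_partition n mu.
Local Notation k := (size mu).
Local Notation word := {ffun 'I_n -> 'I_k}.
Local Notation B := {ffun word -> rat^o}.
Local Notation V := (specht_space n mu).
Implicit Types (T : {ffun cell mu -> 'I_n}) (c d : cell mu) (s g : 'S_n).
Implicit Types (w : word) (x y : B) (S : {set 'I_n}).

Lemma SYT_tab T : T \in SYT n mu -> tableau T. Proof. by rewrite inE => /andP[]. Qed.
Lemma SYT_std T : T \in SYT n mu -> standard T. Proof. by rewrite inE => /andP[]. Qed.

Lemma standard_row T c d : standard T -> cell_row c = cell_row d ->
  (cell_col c < cell_col d)%N -> (T c < T d)%N.
Proof.
move=> /forallP/(_ c)/forallP/(_ d)/andP[/implyP h _] er lt_c.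
by apply: h; rewrite er eqxx.
Qed.

Lemma standard_col T c d : standard T -> below c d -> (T c < T d)%N.
Proof. by move=> /forallP/(_ c)/forallP/(_ d)/andP[_ /implyP]; apply. Qed.

Section OneTableau.

Variables (T : {ffun cell mu -> 'I_n}) (T_tab : tableau T).
Hypothesis T_std : standard T.
Local Notation row_of := (trow mu_part T_tab).
Local Notation col_of := (tcol mu_part T_tab).

(** Along a row of a standard tableau, smaller entries are those to the left. Hence the row word
    determines the tableau. *)
Lemma tcol_occ j : col_of j = #|[set i : 'I_n | (i < j)%N && (row_of i == row_of j)]|.
Proof.
have eqA : [set i : 'I_n | (i < j)%N && (row_of i == row_of j)] =
    [set i | (row_of i == row_of j) && (col_of i < col_of j)%N].
  apply/setP => i; rewrite !inE andbC; case: eqP => //= er.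
  have [lt|lt|eq] := ltngtP (col_of i) (col_of j).
  - by rewrite -[i](tinvK mu_part T_tab) -[j](tinvK mu_part T_tab) standard_row.
  - rewrite ltnNge; apply/negbTE/negPn/ltnW.
    by rewrite -[i](tinvK mu_part T_tab) -[j](tinvK mu_part T_tab) standard_row.
  by rewrite (trow_tcol_inj er eq) ltnn.
have ex_i (q : 'I_(col_of j)) : exists i, row_of i = row_of j /\ col_of i = q.
  have ltq : (q < nth 0 mu (row_of j))%N by apply: ltn_trans (ltn_ord q) (cell_colP _).
  have [c [<- <-]] := mk_cell ltq.
  by exists (T c); rewrite /trow /tcol tabK.
pose F q := sval (cid (ex_i q)).
have FP q : row_of (F q) = row_of j /\ col_of (F q) = q by rewrite /F; case: (cid _).
have F_inj : injective F.
  by move=> q q' eF; apply: val_inj => /=; have [_ <-] := FP q; rewrite eF; case: (FP q').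
rewrite eqA -[LHS]card_ord -(card_imset _ F_inj); apply: eq_card => i; rewrite inE.
apply/imsetP/andP => [[q _ ->]|[/eqP er lt_c]].
  by have [-> ->] := FP q; rewrite eqxx ltn_ord.
exists (Ordinal lt_c) => //; have [er' ec'] := FP (Ordinal lt_c).
by apply: (@trow_tcol_inj _ _ mu_part _ T_tab); rewrite ?er' ?ec'.
Qed.

Lemma Des_adj (i j : 'I_n) : i.+1 = j :> nat -> j \notin Des T -> (row_of j <= row_of i)%N.
Proof.
move=> ij; apply: contraNleq => lt_r; rewrite inE; apply/existsP.
exists (tinv mu_part T_tab i); apply/existsP; exists (tinv mu_part T_tab j).
by rewrite !tinvK ij !eqxx; exact: lt_r.
Qed.

Lemma Des_chain (i j : 'I_n) : (i <= j)%N ->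
  (forall l : 'I_n, (i < l <= j)%N -> l \notin Des T) -> (row_of j <= row_of i)%N.
Proof.
move def_m: (j - i)%N => m ij; elim: m j def_m ij => [|m IHm] j def_m ij Dij.
  by have -> : i = j by apply: val_inj => /=; lia.
have j0 : (j.-1 < n)%N by have := ltn_ord j; lia.
have := IHm (Ordinal j0); move/(_ _ _ _)/(leq_trans _); apply => /=; try lia.
  apply: Des_adj => /=; first by lia.
  by apply: Dij; rewrite leqnn andbT; lia.
by move=> l lij; apply: Dij; lia.
Qed.

Variable S : {set 'I_n}.
Hypothesis Des_S : Des T \subset S.

Lemma block_row (i j : 'I_n) : (i <= j)%N -> lam S i = lam S j -> (row_of j <= row_of i)%N.
Proof.
move=> ij eqf; apply: Des_chain => // l lij.
by apply: contra (lam_nonmem eqf lij); apply: subsetP.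
Qed.

(** Without descents inside a block, entries move weakly upwards along it, so a block never meets a
    column twice. *)
Lemma below_lam c d : below c d -> (lam S (T d) < lam S (T c))%N.
Proof.
move=> cd; have ltT := standard_col T_std cd.
rewrite ltn_neqAle lam_leq ?(ltnW ltT) // andbT; apply/eqP => eqf.
have := block_row (ltnW ltT) (esym eqf).
by rewrite /trow !tabK leqNgt; case/andP: cd => _ ->.
Qed.

Definition cokey w : nat := \sum_(i < n) lam S i * w i.

(** A supporting word rearranges rows within columns, and [lam] strictly decreases down each column;
    by the rearrangement inequality only the row word attains the minimum. *)
Lemma cokey_min w : specht_vec T w != 0 -> w != rword mu_part T_tab ->
  (cokey (rword mu_part T_tab) < cokey w)%N.
Proof.
move=> /(specht_vec_supp mu_part T_tab)[s Cs def_w].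
pose rw := rword mu_part T_tab.
have [s0 Cs0 min0] := arg_minnP (fun g => cokey (wact rw g)) (group1 (stab_group col_of)).
suff w0E s' : s' \in stab col_of -> cokey (wact rw s') = cokey (wact rw s0) -> wact rw s' = rw.
  move=> neq; rewrite ltn_neqAle -[X in (X <= _)%N](congr1 cokey (w0E s0 Cs0 erefl)).
  rewrite def_w min0 // andbT; apply: contraNneq neq => eqk; rewrite def_w w0E //.
  by rewrite -eqk w0E.
move=> Cs' eqk; set w0 := wact rw s'.
have w0row i : w0 i = row_of (s' i) :> nat by rewrite ffunE rwordE.
have tcs i : col_of (s' i) = col_of i by move/stabP: Cs'.
(* An inversion within a column could be exchanged so as to lower [cokey]. *)
have noinv i j : col_of i = col_of j -> (row_of i < row_of j)%N -> (w0 i <= w0 j)%N.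
  move=> ec lt_r; rewrite leqNgt; apply/negP => lt_w.
  have cd : below (tinv mu_part T_tab i) (tinv mu_part T_tab j).
    by rewrite /below lt_r andbT; apply/eqP.
  have := below_lam cd; rewrite !tinvK => lt_f.
  have Ct : tperm j i \in stab col_of by apply: tperm_stab.
  have := min0 (tperm j i * s')%g (groupM Ct Cs'); rewrite wactM -/w0 -eqk leqNgt.
  move/negP; apply; rewrite /cokey.
  have := @swap_sum n (lam S) (fun l => wact w0 (tperm j i) l) j i lt_f.
  have wt l : wact w0 (tperm j i) l = w0 (tperm j i l) by rewrite ffunE.
  rewrite !wt tpermL tpermR => /(_ lt_w).
  by rewrite [X in (_ < X)%N -> _](eq_bigr (fun l => lam S l * w0 l)%N) // => l _; rewrite wt tpermK.
have c0 : col_injective mu_part T_tab (fun i => w0 i).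
  move=> i j ec; rewrite !w0row => er; apply: (@perm_inj _ s').
  by apply: (trow_tcol_inj er); rewrite !tcs.
have le0 : (\sum_i w0 i <= \sum_i row_of i)%N.
  by rewrite [X in (_ <= X)%N](reindex_inj (@perm_inj _ s')) leq_eqVlt; apply/orP; left;
    apply/eqP/eq_bigr => i _; rewrite w0row.
apply/ffunP => j; apply: val_inj; rewrite /= -(col_injective_rk c0 le0).
rewrite /rw rwordE -(rk_trow mu_part T_tab); apply: eq_card => i; rewrite !inE.
case: eqP => //= ec; have [lt|lt|er] := ltngtP (row_of i) (row_of j).
- rewrite ltn_neqAle noinv // andbT; apply/eqP => /(c0 _ _ ec) eij.
  by rewrite eij ltnn in lt.
- by apply/negbTE; rewrite -leqNgt noinv.
by rewrite (trow_tcol_inj er ec) !ltnn.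
Qed.

Lemma cokey_wact w g : g \in stab (lam S) -> cokey (wact w g) = cokey w.
Proof.
move=> /stabP Sg; rewrite /cokey [RHS](reindex_inj (@perm_inj _ g)).
by apply: eq_bigr => i _; rewrite ffunE Sg.
Qed.

End OneTableau.

(** Row words weakly decrease on blocks, so reversing the letters makes both words block-sorted in
    one orbit, hence equal. Equal rows give equal columns by [tcol_occ]. *)
Lemma rword_unique S T T' (T_tab : tableau T) (T'_tab : tableau T') g :
  standard T -> standard T' -> Des T \subset S -> Des T' \subset S ->
  g \in stab (lam S) -> wact (rword mu_part T_tab) g = rword mu_part T'_tab -> T = T'.
Proof.
move=> T_std T'_std TS T'S Sg eqw.
pose rv w : word := [ffun i => rev_ord (w i)].
have rvS T1 (T1_tab : tableau T1) : Des T1 \subset S -> standard T1 ->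
    wDes (rv (rword mu_part T1_tab)) \subset S.
  move=> T1S T1_std; apply/subsetP => i; rewrite inE => /existsP[j /andP[/eqP ji]].
  rewrite !ffunE ltnNge; apply: contraNT => nSi.
  have le : (trow mu_part T1_tab i <= trow mu_part T1_tab j)%N.
    by apply: Des_adj ji _; apply: contra nSi; apply: subsetP.
  by apply: leq_sub2l; rewrite ltnS.
have rvg : wact (rv (rword mu_part T_tab)) g = rv (rword mu_part T'_tab).
  by rewrite -eqw; apply/ffunP => i; rewrite !ffunE.
have rvE : rv (rword mu_part T'_tab) = rv (rword mu_part T_tab).
  rewrite -rvg; apply: (@block_sorted_unique _ _ S) => //; first exact: rvS.
  by rewrite rvg rvS.
have er j : trow mu_part T'_tab j = trow mu_part T_tab j.
  by have /ffunP/(_ j) := rvE; rewrite !ffunE => /rev_ord_inj/(congr1 val).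
have ec j : tcol mu_part T'_tab j = tcol mu_part T_tab j.
  by rewrite !tcol_occ //; apply: eq_card => i; rewrite !inE !er.
apply/ffunP => c; rewrite -[RHS](tinvK mu_part T_tab); congr (T _).
by rewrite -[LHS](tabK mu_part T'_tab); apply: cell_inj; [exact: er | exact: ec].
Qed.

Definition std_in S : {set {ffun cell mu -> 'I_n}} :=
  [set T in SYT n mu | Des T \subset S].

Lemma std_inP S T : T \in std_in S -> [/\ tableau T, standard T & Des T \subset S].
Proof. by rewrite !inE => /andP[/andP[]]. Qed.

(** Triangularity: among tableaux with nonzero coefficient take T0 of least cokey and evaluate at
    its row word. Only T0 contributes there, through permutations fixing that word, all with the
    same nonzero value. *)
Lemma symz_specht_indep S (a : {ffun cell mu -> 'I_n} -> rat) :
  \sum_(T in std_in S) a T *: symz (lam S) (specht_vec T) = 0 ->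
  forall T, T \in std_in S -> a T = 0.
Proof.
move=> sum0 T1 T1S; apply/eqP/negPn/negP => nz1.
pose ck T := (\sum_c lam S (T c) * cell_row c)%N.
have ckE T (T_tab : tableau T) : cokey S (rword mu_part T_tab) = ck T.
  rewrite /cokey (reindex_tab mu_part _ T_tab); apply: eq_bigr => c _.
  by rewrite rwordE /trow tabK.
pose P T := (T \in std_in S) && (a T != 0).
have P1 : P T1 by rewrite /P T1S.
case: (arg_minnP ck P1) => T0 /andP[T0S nz0] min0.
have [T0_tab T0_std D0] := std_inP T0S.
pose w0 := rword mu_part T0_tab.
have hit T g : T \in std_in S -> a T != 0 -> g \in stab (lam S) ->
    specht_vec T (wact w0 g) != 0 -> T = T0 /\ wact w0 g = w0.
  move=> TS nza Sg nz; have [T_tab T_std DT] := std_inP TS.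
  have eqw : wact w0 g = rword mu_part T_tab.
    apply/eqP; apply: contraT => neq.
    have := cokey_min T_std DT nz neq; rewrite cokey_wact // !ckE ltnNge min0 //.
    by rewrite /P TS.
  have eT : T0 = T := rword_unique T0_std T_std D0 DT Sg eqw.
  by subst T; split=> //; rewrite eqw /w0; congr rword; apply: bool_irrelevance.
have /ffunP/(_ w0) := sum0; rewrite sum_ffunE [RHS]ffunE (bigD1 T0) //= big1.
  rewrite addr0 ffunE /symz sum_ffunE => /eqP; rewrite mulf_eq0 (negPf nz0) /=.
  rewrite (eq_bigr (fun g => if wact w0 g == w0 then specht_vec T0 w0 else 0)).
    rewrite -big_mkcondr sumr_const mulrn_eq0 ffunE (negPf (specht_rword _ _)) orbF.
    move/eqP/card0_eq/(_ 1%g)/negbT/negP; apply.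
    by rewrite unfold_in /= wact1 eqxx andbT (group1 (stab_group _)).
  move=> g Sg; rewrite ffunE; case: eqP => [->//|ne].
  by apply/eqP; apply: contraT => /(hit T0 g T0S nz0 Sg)[].
move=> T /andP[TS neT]; rewrite ffunE; have [->|nza] := eqVneq (a T) 0.
  by rewrite scale0r.
rewrite /symz sum_ffunE big1 ?scaler0 // => g Sg; rewrite ffunE.
by apply/eqP; apply: contraT => /(hit T g TS nza Sg)[eT]; rewrite eT eqxx in neT.
Qed.

End StandardBasis.

(** * The standard basis and the dimension of the invariants *)

Section StandardSpan.

Variables (n : nat) (mu : seq nat).
Hypothesis mu_part : is_partition n mu.
Local Notation k := (size mu).
Local Notation word := {ffun 'I_n -> 'I_k}.
Local Notation B := {ffun word -> rat^o}.
Local Notation V := (specht_space n mu).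
Implicit Types (T : {ffun cell mu -> 'I_n}) (c d : cell mu) (s g : 'S_n).
Implicit Types (w : word) (x y : B) (S : {set 'I_n}).

Lemma Des_full T : Des T \subset full_set n.
Proof.
by apply/subsetP => i; rewrite !inE => /existsP[c /existsP[d /and3P[/eqP<-]]].
Qed.

Lemma std_in_full : std_in mu (full_set n) = SYT n mu.
Proof. by apply/setP => T; rewrite inE Des_full andbT. Qed.

Lemma symz_full x : symz (lam (full_set n)) x = #|stab (lam (full_set n))|%:R *: x.
Proof.
apply: symz_fixed; apply/inv_spaceP; rewrite inv_space_full; exact: memvf.
Qed.

Lemma tab_first_ord (j : 'I_n) : (0 < k)%N.
Proof.
have /and3P[_ _] := mu_part; case: mu => //= /eqP n0.
by have := ltn_ord j; lia.
Qed.

(** The row word as a total function of the filling, so that its image over a set of tableaux can be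
    counted; for a tableau the default letter never occurs. *)
Definition tab_word T : word :=
  [ffun j => odflt (Ordinal (tab_first_ord j)) (omap (@tag _ _) [pick c | T c == j])].

Lemma tab_wordE T (T_tab : tableau T) : tab_word T = rword mu_part T_tab.
Proof.
apply/ffunP => j; rewrite !ffunE; case: pickP => [c /eqP eT|/(_ (tinv mu_part T_tab j))].
  by rewrite -[in RHS]eT tabK.
by rewrite tinvK eqxx.
Qed.

(** Independence is [symz_specht_indep] at the full set, where the stabilizer is trivial;
    [specht_space_det] bounds dim V by the number of standard tableaux. *)
Lemma specht_space_std : V = <<[seq specht_vec T | T in SYT n mu]>>%VS.
Proof.
have free_std : \dim <<[seq specht_vec T | T in SYT n mu]>> = #|SYT n mu|.
  apply: dim_span_indep => a sum0; rewrite -std_in_full in sum0 *.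
  apply: (symz_specht_indep mu_part).
  under eq_bigr do rewrite symz_full scalerA mulrC -scalerA.
  by rewrite -scaler_sumr sum0 scaler0.
symmetry; apply/eqP; rewrite eqEdim free_std; apply/andP; split.
  apply/span_subvP => _ /mapP[T + ->]; rewrite mem_enum => /SYT_tab.
  exact: specht_vec_mem.
apply: leq_trans (_ : #|[set tab_word T | T in SYT n mu]| <= _)%N; last exact: leq_imset_card.
apply: dim_le_det => x Vx x0; apply: (specht_space_det (mu_part := mu_part) Vx) => T T_tab T_std.
by rewrite -tab_wordE x0 // imset_f // inE T_tab.
Qed.

Lemma tperm_adj_lt (a b x y : 'I_n) : a.+1 = b :> nat -> (x < y)%N ->
  ~ (x = a /\ y = b) -> (tperm a b x < tperm a b y)%N.
Proof.
move=> ab xy nxy; have nv (i j : 'I_n) : i <> j -> i <> j :> nat by move=> h /val_inj.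
have neqs : ~ (x = a :> nat /\ y = b :> nat) by case=> /val_inj ? /val_inj ?; apply: nxy.
by do 2![case: tpermP => [?|?|/nv ? /nv ?]]; subst=> //=; lia.
Qed.

(** Induction on the sum of entry times row. At a descent outside S exchange the two consecutive
    entries, which lie in one block. In one column this negates the vector, so its symmetrization is
    0; otherwise the new tableau is standard, has the same symmetrization and a smaller sum. *)
Lemma symz_specht_span S T : T \in SYT n mu ->
  symz (lam S) (specht_vec T) \in <<[seq symz (lam S) (specht_vec T) | T in std_in mu S]>>%VS.
Proof.
pose meas T := (\sum_c T c * cell_row c)%N.
move: {2}_.+1 (ltnSn (meas T)) => m; elim: m T => // m IHm T lt_m TS.
have [T_tab T_std] := (SYT_tab TS, SYT_std TS).
have [DS|] := boolP (Des T \subset S).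
  by apply/memv_span/map_f; rewrite mem_enum inE TS.
case/subsetPn=> i + nSi; rewrite inE => /existsP[c /existsP[d /and3P[/eqP ci /eqP di rcd]]].
pose t := tperm (T c) (T d); rewrite -di in ci nSi.
have St : t \in stab (lam S).
  by apply: tperm_stab; rewrite (lam_adj S ci) (negPf nSi) addn0.
have [ec|nec] := eqVneq (cell_col c) (cell_col d).
  suff -> : symz (lam S) (specht_vec T) = 0 by apply: mem0v.
  have : symz (lam S) (specht_vec T) = - symz (lam S) (specht_vec T).
    rewrite -{1}(symz_bact _ St) /specht_vec -wcoef_msym.
    by rewrite specht_tperm // /below ?ec ?eqxx // !linearN.
  move/eqP; rewrite -addr_eq0 -mulr2n -scaler_nat scaler_eq0 pnatr_eq0 /=.
  by move/eqP.
rewrite -(symz_bact _ St) bact_specht_vec; apply: IHm.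
  rewrite -ltnS; apply: leq_trans lt_m; rewrite ltnS.
  have -> : meas [ffun e => t (T e)] = (\sum_(j < n) j * trow mu_part T_tab (t j))%N.
    rewrite (reindex_inj (@perm_inj _ t)) (reindex_tab mu_part _ T_tab).
    by apply: eq_bigr => e _; rewrite ffunE /t tpermK /trow tabK.
  have -> : meas T = (\sum_(j < n) j * trow mu_part T_tab (t (t j)))%N.
    rewrite (reindex_tab mu_part _ T_tab); apply: eq_bigr => e _.
    by rewrite /t tpermK /trow tabK.
  apply: (@swap_sum n (@nat_of_ord n) (fun j => trow mu_part T_tab (t j))).
    by rewrite -ci.
  by rewrite /t tpermL tpermR /trow !tabK.
have T_inj := tab_inj T_tab.
rewrite inE tableau_perm //=; apply/forallP => c'; apply/forallP => d'.
apply/andP; split; apply/implyP => h; rewrite !ffunE; apply: tperm_adj_lt => //.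
- by case/andP: h => /eqP er; apply: standard_row.
- case=> /T_inj ec' /T_inj ed'; case/andP: h => /eqP er _; subst c' d'.
  by rewrite er ltnn in rcd.
- exact: standard_col.
case=> /T_inj ec' /T_inj ed'; case/andP: h => ec _; subst c' d'.
by rewrite ec in nec.
Qed.

Lemma dim_specht_inv S : \dim (V :&: inv_space k S) = #|std_in mu S|.
Proof.
rewrite -(dim_span_indep (@symz_specht_indep _ _ mu_part S)); congr (\dim _).
apply/eqP; rewrite eqEsubv; apply/andP; split; last first.
  apply/span_subvP => _ /mapP[T + ->]; rewrite mem_enum => /std_inP[T_tab _ _].
  rewrite memv_cap symz_stable ?specht_vec_mem //; last exact: specht_space_act.
  by apply/inv_spaceP => g; apply: bact_symz.
apply/subvP => x; rewrite memv_cap => /andP[Vx /inv_spaceP/symz_fixed Sx].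
have -> : x = #|stab (lam S)|%:R^-1 *: symz (lam S) x.
  by rewrite Sx scalerA mulVf ?scale1r ?card_stab_neq0.
apply: memvZ; move: Vx; rewrite specht_space_std.
move=> /(memv_img (linfun (symz (lam S)))); rewrite lfunE limg_span.
apply: subvP; apply/span_subvP => _ /mapP[_ /mapP[T + ->] ->].
by rewrite mem_enum lfunE; apply: symz_specht_span.
Qed.

(** The equality [dim_specht_inv] splits over the subsets of S, by [dim_inv_new] on one side and by
    descent sets on the other; induction cancels the proper subsets. *)
Lemma dim_specht_new S : S \subset full_set n ->
  \dim (V :&: new_space k S) = #|[set T in SYT n mu | Des T == S]|.
Proof.
move: {2}_.+1 (ltnSn #|S|) => m; elim: m S => // m IHm S lt_m Sfull.
have := dim_inv_new (@specht_space_act n mu) Sfull; rewrite dim_specht_inv.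
rewrite -sum1_card (partition_big (@Des n mu) (fun S' => S' \subset S)) /=; last first.
  by move=> T /std_inP[].
have sumE S' : S' \subset S -> (\sum_(T in std_in mu S | Des T == S') 1 =
    #|[set T in SYT n mu | Des T == S']|)%N.
  move=> sS'; rewrite -sum1_card; apply: eq_bigl => T; rewrite !inE -andbA.
  by congr (_ && _); rewrite andbC; case: eqP => [->|] //; rewrite sS'.
rewrite (bigD1 S) //= [RHS](bigD1 S) //= sumE // => /eqP.
rewrite (eq_bigr (fun S' => \dim (V :&: new_space k S'))); last first.
  move=> S' /andP[sS' neS]; rewrite sumE // IHm //; last exact: subset_trans Sfull.
  have : S' \proper S by rewrite properEneq neS.
  by move/proper_card/leq_trans; apply.
by rewrite eqn_add2r => /eqP.
Qed.

End StandardSpan.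

(** * Dominance and monomials *)

Section Dominance.

Variable n : nat.
Implicit Types (f : 'I_n -> nat) (g h : 'S_n) (m : 'X_{1..n}) (i j : 'I_n).

Definition nonincreasing f := forall i j, (i <= j)%N -> (f j <= f i)%N.

(* Compare with the threshold th = f i0: off the first block f <= th, and the  *)
(* excess of f over th is carried by the first block alone.                    *)
Lemma top_sum_set f i0 (A : {set 'I_n}) : nonincreasing f ->
  #|A| = #|[set j : 'I_n | (j <= i0)%N]| ->
  (\sum_(j in A) f j <= \sum_(j in [set j : 'I_n | (j <= i0)%N]) f j)%N /\
  (\sum_(j in A) f j = \sum_(j in [set j : 'I_n | (j <= i0)%N]) f j ->
   forall j, if j \in A then (f i0 <= f j)%N else (f j <= f i0)%N)%N.
Proof.
move=> f_dec cardA; set I0 := [set j : 'I_n | (j <= i0)%N].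
have sumI0 : (\sum_(j in I0) f j = #|A| * f i0 + \sum_j (f j - f i0))%N.
  rewrite cardA -sum_nat_const [X in (_ + X)%N](bigID (mem I0)) /=.
  rewrite [X in (_ + (_ + X))%N]big1 => [|j]; last first.
    by rewrite inE -ltnNge => /ltnW/f_dec; rewrite -subn_eq0 => /eqP.
  rewrite addn0 -big_split; apply: eq_bigr => j; rewrite inE => /f_dec le_f.
  by rewrite /= subnKC.
have sumA : (\sum_(j in A) f j + (\sum_(j in A) (f i0 - f j) + \sum_(j in ~: A) (f j - f i0)) =
    \sum_(j in I0) f j)%N.
  rewrite sumI0 -sum_nat_const [X in (_ = _ + X)%N](bigID (mem A)) /= addnA addnA -!big_split /=.
  congr (_ + _)%N; last by apply: eq_bigl => j; rewrite inE.
  by apply: eq_bigr => j _; lia.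
split=> [|eqA j]; first by rewrite -sumA leq_addr.
move: sumA; rewrite -eqA => /eqP; rewrite -[X in _ == X]addn0 eqn_add2l addn_eq0.
rewrite !sum_nat_eq0 => /andP[/forallP/(_ j)/implyP inA /forallP/(_ j)/implyP outA].
by case: ifP => jA; rewrite -subn_eq0; [apply: inA | apply: outA; rewrite inE jA].
Qed.

Lemma top_sum f (l : nat) g : nonincreasing f ->
  (\sum_(j < n | (j < l)%N) f (g j) <= \sum_(j < n | (j < l)%N) f j)%N.
Proof.
move=> f_dec; have [ln|nl] := leqP l n; last first.
  rewrite (reindex_inj (@perm_inj _ g^-1%g)) leq_eqVlt; apply/orP; left; apply/eqP.
  by apply: eq_big => [j|j _]; rewrite ?permKV // !(ltn_trans (ltn_ord _) nl).
case: l ln => [|l] ln; first by rewrite !big_pred0.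
pose I0 := [set j : 'I_n | (j <= Ordinal ln)%N].
have [le_sum _] := @top_sum_set f (Ordinal ln) (g @: I0) f_dec (card_imset _ (@perm_inj _ g)).
move: le_sum; rewrite big_imset /=; last by move=> a b _ _; apply: perm_inj.
have eI (F : 'I_n -> nat) : (\sum_(j in I0) F j = \sum_(j < n | (j < l.+1)%N) F j)%N.
  by apply: eq_bigl => j; rewrite inE.
by rewrite !eI.
Qed.

Lemma exp_part_nth m : exists g, forall i : 'I_n, nth 0%N (exp_part m) i = m (g i).
Proof.
have /tuple_permP[g eg] : perm_eq (sort_tuple geq [tuple of m]) [tuple of m].
  by rewrite /= perm_sort.
exists g => i; rewrite /exp_part -[sort _ _]/(tval (sort_tuple geq [tuple of m])) eg.
rewrite (nth_map i) ?size_enum_ord ?ltn_ord // nth_ord_enum; by rewrite (tnth_nth 0%N) (mnm_nth 0%N).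
Qed.

Lemma size_exp_part m : size (exp_part m) = n.
Proof. by rewrite size_sort size_tuple. Qed.

Lemma sumn_take (s : seq nat) (l : nat) : size s = n ->
  sumn (take l s) = (\sum_(j < n | (j < l)%N) nth 0 s j)%N.
Proof.
move=> szs; rewrite sumnE (big_nth 0%N) size_take_min szs big_mkord.
rewrite (big_ord_widen n (nth 0%N (take l s)) (geq_minr l n)).
apply: eq_big => [j|j]; first by rewrite leq_min ltn_ord andbT.
by rewrite leq_min => /andP[jl _]; rewrite nth_take.
Qed.

Lemma nth_mnm m i : nth 0%N m i = m i.
Proof. by rewrite -mnm_nth. Qed.

End Dominance.

(** * A numerical level compatible with degree and dominance *)

Section Levels.

Variable n : nat.
Implicit Types (g h : 'S_n) (m : 'X_{1..n}) (i j : 'I_n).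

(** Summation by parts; c is the surplus carried over from the prefixes already removed. *)
Lemma abel_sum (a b : seq nat) (c : nat) : size a = size b -> sorted geq a ->
  (forall l, sumn (take l a) <= c + sumn (take l b))%N ->
  (\sum_(j < size a) nth 0 a j * nth 0 a j <=
   head 0 a * c + \sum_(j < size a) nth 0 a j * nth 0 b j)%N.
Proof.
elim: a b c => [|x a IHa] [|y b] c //=.
move=> [szab] a_srt le_ab.
rewrite !big_ord_recl /=.
have le1 : (x <= c + y)%N by have := le_ab 1%N; rewrite /= !take0 /= !addn0.
have a_srt' : sorted geq a by apply: path_sorted a_srt.
have := IHa b (c + y - x)%N szab a_srt' => /(_ _)/leq_trans IH.
have hd : (head 0 a <= x)%N by case: (a) a_srt => //= z a' /andP[].
have {}IH : (\sum_(j < size a) nth 0 a j * nth 0 a j <=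
    head 0 a * (c + y - x) + \sum_(j < size a) nth 0 a j * nth 0 b j)%N.
  by apply: IH => // l; have := le_ab l.+1; rewrite /=; lia.
have : (head 0 a * (c + y - x) <= x * (c + y - x))%N by rewrite leq_mul2r hd orbT.
have : (x * x <= x * c + x * y)%N by rewrite -mulnDr leq_mul2l le1 orbT.
move: IH; rewrite mulnBr mulnDr.
set A := (\sum_(_ < _) _)%N; set C := (\sum_(_ < _) _)%N => IH le2 le3.
rewrite /= -/A -/C; lia.
Qed.

(** By [abel_sum] the sum of squares of a is at most that of the products, and 2xy <= x^2 + y^2 is
    strict where the entries differ. *)
Lemma dominated_sq (a b : seq nat) : size a = size b -> sorted geq a ->
  dominated a b -> a <> b ->
  (\sum_(j < size a) nth 0 a j ^ 2 < \sum_(j < size a) nth 0 b j ^ 2)%N.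
Proof.
move=> szab a_srt [_ le_ab] neq.
have := @abel_sum a b 0 szab a_srt le_ab; rewrite muln0 add0n => le1.
have lt1 : (2 * \sum_(j < size a) nth 0 a j * nth 0 b j <
    \sum_(j < size a) (nth 0 a j ^ 2 + nth 0 b j ^ 2))%N.
  rewrite big_distrr /= ltn_neqAle leq_sum ?andbT => [|j _]; last by rewrite nat_Cauchy.
  apply/eqP => /eqP eq_sum; apply: neq; apply: (@eq_from_nth _ 0%N) => // j ja.
  have := leqif_sum (fun (j : 'I_(size a)) (_ : true) => nat_Cauchy (nth 0%N a j) (nth 0%N b j)).
  by case=> _; rewrite eq_sum => /esym/forallP/(_ (Ordinal ja))/eqP.
have sqE : (\sum_(j < size a) nth 0 a j ^ 2 = \sum_(j < size a) nth 0 a j * nth 0 a j)%N.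
  by apply: eq_bigr => j _; rewrite mulnn.
move: lt1; rewrite big_split /= sqE; move: le1.
set A := (\sum_(j < size a) nth 0 a j * nth 0 a j)%N; set C := (\sum_(j < size a) nth 0 a j * nth 0 b j)%N.
by set D := (\sum_(j < size a) nth 0 b j ^ 2)%N; lia.
Qed.

(* Degree first, then the sum of squares, which strictly increases with        *)
(* dominance.                                                                  *)
Definition lvl m : nat := (mdeg m ^ 3 + \sum_i m i ^ 2)%N.

(** In degree d the sum of squares is at most d^2, and d^3 + d^2 < (d+1)^3. *)
Lemma lvl_deg m m' : (mdeg m < mdeg m')%N -> (lvl m < lvl m')%N.
Proof.
move=> lt_m; rewrite /lvl.
have : (\sum_i m i ^ 2 <= mdeg m ^ 2)%N.
  rewrite -[X in (_ <= X)%N]mulnn {2}mdegE big_distrr /=; apply: leq_sum => i _.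
  by rewrite -mulnn leq_mul2r mdegE (bigD1 i) //= leq_addr orbT.
move: lt_m; set d := mdeg m; set e := mdeg m'; set q := (\sum_i m i ^ 2)%N.
set q' := (\sum_i _)%N => lt_de le_q.
have : (d.+1 ^ 3 <= e ^ 3)%N by rewrite leq_exp2r.
rewrite !expnS !expn0; rewrite !expnS expn0 in le_q; nia.
Qed.

Lemma sum_exp_part (F : nat -> nat) m : (\sum_(j < n) F (nth 0 (exp_part m) j) = \sum_i F (m i))%N.
Proof.
have [g eg] := exp_part_nth m.
by rewrite [RHS](reindex_inj (@perm_inj _ g)); apply: eq_bigr => j _; rewrite eg.
Qed.

Lemma mdeg_sumn m : mdeg m = sumn m.
Proof.
rewrite mdegE sumnE (big_nth 0%N) size_tuple big_mkord.
by apply: eq_bigr => i _; rewrite nth_mnm.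
Qed.

Lemma mdeg_exp_part m : sumn (exp_part m) = mdeg m.
Proof. by rewrite mdeg_sumn; apply/perm_sumn; rewrite perm_sort. Qed.

Lemma exp_part_sorted m : sorted geq (exp_part m).
Proof. by apply: sort_sorted => x y; apply: leq_total. Qed.

Lemma lvl_dom m m' : dominated (exp_part m) m' -> exp_part m <> m' -> (lvl m < lvl m')%N.
Proof.
move=> dom neq; have [eq_sum _] := dom.
rewrite /lvl -(mdeg_exp_part m) eq_sum -mdeg_sumn ltn_add2l.
have sz : size (exp_part m) = size m' by rewrite size_exp_part size_tuple.
have := dominated_sq sz (exp_part_sorted m) dom neq; rewrite size_exp_part.
rewrite (sum_exp_part (fun x => x ^ 2)%N) => /leq_trans; apply.
by apply/eq_leq/eq_bigr => i _; rewrite nth_mnm.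
Qed.

Lemma exp_part_id m : nonincreasing m -> exp_part m = m.
Proof.
move=> dec; apply: sorted_sort; first by move=> y x z /= yx zy; apply: leq_trans zy yx.
apply/(sortedP 0%N) => j; rewrite size_tuple => jn.
by have := dec (Ordinal (ltnW jn)) (Ordinal jn) (leqnSn j); rewrite -!nth_mnm.
Qed.

Lemma exists_sorted_mnm m : exists m' g,
  nonincreasing m' /\ m = [multinom m' (g i) | i < n].
Proof.
have [g eg] := exp_part_nth m.
exists [multinom nth 0%N (exp_part m) i | i < n], g^-1%g; split.
  move=> i j ij; rewrite !mnmE; apply: (@sorted_leq_nth _ geq _ _ 0%N _ (exp_part_sorted m)) => //.
  - by move=> y x z /= yx zy; apply: leq_trans zy yx.
  - by move=> x; apply: leqnn.
  - by rewrite inE size_exp_part.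
  by rewrite inE size_exp_part.
by apply/mnmP => i; rewrite !mnmE eg permKV.
Qed.

Lemma lvl_perm m g : lvl [multinom m (g i) | i < n] = lvl m.
Proof.
rewrite /lvl mdeg_mperm; congr (_ + _)%N; rewrite [RHS](reindex_inj (@perm_inj _ g)).
by apply: eq_bigr => i _; rewrite mnmE.
Qed.

End Levels.

Lemma mem_span (F : fieldType) (gT : finGroupType) (W : rep F gT) (X : W -> Prop) v :
  X v -> v \in span_pred X.
Proof.
move=> Xv; apply/span_predP; exists 1%N, (fun=> 1), (fun=> v).
by split=> //; rewrite big_ord1 scale1r.
Qed.

(** * Products of a monomial with an elementary symmetric polynomial *)

Section SymmetricMultiples.

Variables (n : nat) (l' : 'X_{1..n}) (i0 : 'I_n).
Hypothesis l'_dec : nonincreasing l'.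
Implicit Types (g h : 'S_n) (m : 'X_{1..n}) (i j : 'I_n).

Definition om : 'X_{1..n} := [multinom ((i <= i0)%N : nat) | i < n].
Definition lraise : 'X_{1..n} := (l' + om)%MM.
(** A positive multiple of the elementary symmetric polynomial of degree i0 + 1. *)
Definition orbit_sum : {mpoly rat[n]} := \sum_(g : 'S_n) msym g 'X_[om].
Definition shifted g : 'X_{1..n} := (l' + [multinom om (g i) | i < n])%MM.

Lemma om_dec : nonincreasing om.
Proof. by move=> i j ij; rewrite !mnmE; case: (leqP j i0) => // ji; rewrite (leq_trans ij ji). Qed.

Lemma lraise_dec : nonincreasing lraise.
Proof. by move=> i j ij; rewrite !mnmDE leq_add ?l'_dec ?om_dec. Qed.

Lemma mdeg_om : (0 < mdeg om)%N.
Proof. by rewrite mdegE (bigD1 i0) //= mnmE leqnn. Qed.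

Lemma mdeg_lraise : (mdeg l' < mdeg lraise)%N.
Proof. by rewrite mdegD -[X in (X < _)%N]addn0 ltn_add2l mdeg_om. Qed.

Lemma shifted_dom g : dominated (exp_part (shifted g)) lraise.
Proof.
split; first by rewrite mdeg_exp_part -mdeg_sumn !mdegD mdeg_mperm.
move=> l; have [h eh] := exp_part_nth (shifted g).
rewrite !(@sumn_take n) ?size_exp_part ?size_tuple //.
under eq_bigr do rewrite eh !mnmDE mnmE -permM.
under [X in (_ <= X)%N]eq_bigr do rewrite nth_mnm mnmDE.
by rewrite !big_split leq_add ?top_sum //; apply: om_dec.
Qed.

Lemma orbit_sum_sym : orbit_sum \is symmetric.
Proof.
apply/issymP => s; rewrite /orbit_sum (raddf_sum (msym s)) [RHS](reindex_inj (mulIg s)).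
by apply: eq_bigr => g _; rewrite /= msymMm.
Qed.

Lemma orbit_sum_const : orbit_sum@_0%MM = 0.
Proof.
rewrite /orbit_sum raddf_sum big1 // => g _ /=; rewrite msymX mcoeffX.
by rewrite -mdeg_eq0 mdeg_mperm; have := mdeg_om; case: (mdeg om).
Qed.

(** The raised places must carry the largest entries of l', and any such set of places is moved to
    the first i0 + 1 places by a permutation preserving l'. *)
Lemma good_shift g : exp_part (shifted g) = lraise ->
  exists2 h, h \in stab l' & forall i, om (g i) = om (h i).
Proof.
move=> eq_exp; pose A := [set j : 'I_n | (g j <= i0)%N]; pose I0 := [set j : 'I_n | (j <= i0)%N].
have cardA h : #|[set j : 'I_n | (h j <= i0)%N]| = #|I0|.
  have -> : [set j : 'I_n | (h j <= i0)%N] = h @^-1: I0 by apply/setP => j; rewrite !inE.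
  by rewrite card_preimset //; apply: perm_inj.
have sumA h : (\sum_j l' j * om (h j) = \sum_(j in [set j : 'I_n | (h j <= i0)%N]) l' j)%N.
  rewrite [RHS]big_mkcond; apply: eq_bigr => j _; rewrite inE mnmE.
  by case: leqP; rewrite ?muln1 ?muln0.
have eq_cross : (\sum_(j in A) l' j = \sum_(j in I0) l' j)%N.
  (* Only the cross term depends on h, so equal sums of squares give equal sums of l' over the
     raised places. *)
  have sq h : (\sum_j shifted h j ^ 2 = \sum_j l' j ^ 2 + 2 * \sum_j l' j * om (h j) + \sum_j om j ^ 2)%N.
    rewrite [X in (_ = _ + X)%N](reindex_inj (@perm_inj _ h)) big_distrr /= -!big_split /=.
    by apply: eq_bigr => j _; rewrite mnmDE mnmE; ring.
  have shift1 : shifted 1%g = lraise by apply/mnmP => j; rewrite !mnmE perm1.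
  have : (\sum_j shifted g j ^ 2 = \sum_j shifted 1%g j ^ 2)%N.
    rewrite -(sum_exp_part (fun x => x ^ 2)%N) eq_exp shift1.
    by apply: eq_bigr => j _; rewrite nth_mnm.
  rewrite !sq !sumA /A; have -> : [set j : 'I_n | ((1%g : 'S_n) j <= i0)%N] = I0.
    by apply/setP => j; rewrite !inE perm1.
  by lia.
have [_ /(_ eq_cross) A_th] := top_sum_set l'_dec (cardA g).
have [_ I0_th] := top_sum_set (A := I0) l'_dec erefl.
have {}I0_th := I0_th erefl.
(* Choose h to send as much of A as possible into the first places. If a in A is missed, some b
   outside A is sent there; both carry the value [l' i0], and exchanging them improves h. *)
pose meet h := #|[set j : 'I_n in A | (h j <= i0)%N]|.
have [h Sh maxh] := arg_maxnP meet (group1 (stab_group l')).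
have A_sub : A \subset [set j : 'I_n | (h j <= i0)%N].
  apply/subsetP => a Aa; rewrite inE leqNgt; apply/negP => ha.
  have [b hb nAb] : exists2 b, (h b <= i0)%N & b \notin A.
    have : ~~ ([set j : 'I_n | (h j <= i0)%N] \subset A).
      apply/negP => sA; have /eqP eqA : [set j : 'I_n | (h j <= i0)%N] == A.
        by rewrite eqEcard sA !cardA /=.
      by move: Aa; rewrite -eqA inE leqNgt ha.
    by case/subsetPn => b; rewrite inE => ? ?; exists b.
  have /stabP fh := Sh.
  have la : l' a = l' i0.
    have := A_th a; rewrite Aa; have := I0_th (h a); rewrite inE leqNgt ha /= fh.
    by move=> le1 le2; apply/eqP; rewrite eqn_leq le1.
  have lb : l' b = l' i0.
    have := A_th b; rewrite (negPf nAb); have := I0_th (h b); rewrite inE hb fh.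
    by move=> le1 le2; apply/eqP; rewrite eqn_leq le1 andbT.
  have St : tperm a b \in stab l' by apply: tperm_stab; rewrite la.
  have := maxh (tperm a b * h)%g (groupM St Sh); rewrite /meet /= leqNgt => /negP; apply.
  apply/proper_card/properP; split.
    apply/subsetP => j; rewrite !inE permM => /andP[Aj hj]; rewrite Aj.
    case: tpermP => [_|jb|_ _ //]; first by rewrite hb.
    by move: nAb Aj; rewrite inE jb => /negPf->.
  exists a; first by move: Aa; rewrite !inE permM tpermL hb andbT.
  by apply/negP; rewrite inE => /andP[_]; rewrite leqNgt ha.
exists h => // i; rewrite !mnmE.
have /setP/(_ i) : A = [set j : 'I_n | (h j <= i0)%N] by apply/eqP; rewrite eqEcard A_sub !cardA /=.
by rewrite !inE => ->.
Qed.

(** Expand the product into monomials [shifted g] and sum over the stabilizer of l'. Shifts with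
    sorted exponent other than [lraise] are strictly dominated and go to r; by [good_shift] each of
    the N others gives the orbit sum of [lraise]. *)
Lemma sym_orbit_lraise : exists N r, [/\ (0 < N)%N, r \in sr_mem (P_lt n lraise) &
  N%:R *: \sum_(h in stab l') msym h 'X_[lraise] =
  #|stab l'|%:R *: ('X_[l'] * orbit_sum) - r].
Proof.
pose good g := exp_part (shifted g) == lraise :> seq nat.
pose r : poly_rep n := \sum_(h in stab l') \sum_(g | ~~ good g) Defs.act h ('X_[shifted g] : poly_rep n).
exists #|[set g : 'S_n | good g]|, r; split.
- apply/card_gt0P; exists 1%g; rewrite inE /good.
  have -> : shifted 1%g = lraise by apply/mnmP => j; rewrite !mnmE perm1.
  by rewrite exp_part_id //; apply: lraise_dec.
- apply: rpred_sum => h _; apply: rpred_sum => g /eqP bad; apply: sr_act.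
  apply: mem_span; exists (shifted g) => //; split; last exact: bad.
  exact: shifted_dom.
have expand : 'X_[l'] * orbit_sum = \sum_g 'X_[shifted g] :> {mpoly rat[n]}.
  rewrite /orbit_sum big_distrr (reindex_inj invg_inj) /=; apply: eq_bigr => g _.
  by rewrite msymX invgK -mpolyXD.
have inv_h h : h \in stab l' -> msym h ('X_[l'] * orbit_sum) = 'X_[l'] * orbit_sum.
  move=> Sh; rewrite msymM (issymP _ orbit_sum_sym) msymX; congr ('X_[_] * _).
  by apply/mnmP => i; rewrite mnmE; have := groupVr Sh => /stabP->.
have -> : #|stab l'|%:R *: ('X_[l'] * orbit_sum) =
    \sum_(h in stab l') msym h (\sum_g 'X_[shifted g] : {mpoly rat[n]}).
  by rewrite -expand (eq_bigr _ inv_h) sumr_const scaler_nat.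
rewrite /r -sumrB.
transitivity (\sum_(h in stab l') \sum_(g | good g) msym h ('X_[shifted g] : {mpoly rat[n]})); last first.
  apply: eq_bigr => h _; rewrite (raddf_sum (msym h)) [X in _ = X - _](bigID good) /=.
  exact: (esym (addrK _ _)).
rewrite [RHS]exchange_big -sum1_card; set Z := \sum_(h in stab l') _.
rewrite (eq_bigl good) => [|g]; last by rewrite inE.
rewrite natr_sum scaler_suml; apply: eq_bigr => g /eqP/good_shift[k Sk ek].
rewrite scale1r /Z (reindex_inj (mulgI k^-1%g)) /=; apply: eq_big => h.
  by rewrite groupMl ?groupV.
rewrite groupMl ?groupV // => Sh; rewrite msymMm; congr msym; rewrite msymX invgK.
congr 'X_[_]; apply/mnmP => i; rewrite mnmE !mnmDE [in RHS]mnmE ek.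
by have /stabP-> := Sk.
Qed.

End SymmetricMultiples.

(** * Homomorphisms from evaluation on a regular orbit *)

Section Evaluation.

Variables n k : nat.
Local Notation word := {ffun 'I_n -> 'I_k}.
Local Notation B := {ffun word -> rat^o}.
Implicit Types (g h s : 'S_n) (m : 'X_{1..n}) (i j : 'I_n) (S : {set 'I_n}).
Implicit Types (p q : {mpoly rat[n]}) (v x : B).

Definition pt g : 'I_n -> rat := fun i => (g i : nat)%:R.

(* Evaluate p on the orbit of the regular point (0, ..., n-1), and apply the   *)
(* homomorphism from the regular representation that sends 1 to v.             *)
Definition ev_map v p : B := \sum_(g : 'S_n) p.@[pt g] *: bact g^-1%g v.

Lemma ev_map_linear v : linear (ev_map v).
Proof.
move=> a p q; rewrite /ev_map scaler_sumr -big_split; apply: eq_bigr => g _.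
by rewrite mevalD mevalZ scalerDl scalerA.
Qed.

HB.instance Definition _ v :=
  GRing.isLinear.Build rat {mpoly rat[n]} B *:%R (ev_map v) (ev_map_linear v).

Lemma ev_mapDl p a v x : ev_map (a *: v + x) p = a *: ev_map v p + ev_map x p.
Proof.
rewrite /ev_map scaler_sumr -big_split; apply: eq_bigr => g _.
by rewrite linearP /= scalerDr !scalerA mulrC.
Qed.

Lemma ev_map_msym v s p : ev_map v (msym s p) = bact s (ev_map v p).
Proof.
rewrite /ev_map linear_sum [RHS](reindex_inj (mulgI s)) /=; apply: eq_bigr => g _.
rewrite linearZ /= -bactM invMg mulgKV meval_msym; congr (_ *: _).
by apply: meval_eq => i; rewrite /pt permM.
Qed.

(** A symmetric polynomial is constant on the orbit. *)
Lemma ev_map_sym v p q : q \is symmetric -> ev_map v (p * q) = q.@[pt 1%g] *: ev_map v p.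
Proof.
move=> /issymP q_sym; rewrite /ev_map scaler_sumr; apply: eq_bigr => g _.
rewrite mevalM scalerA mulrC; congr (_ * _ *: _).
by rewrite -{1}(q_sym g^-1%g) meval_msym; apply: meval_eq => i; rewrite /pt permKV perm1.
Qed.

(** Some polynomial vanishes on the orbit except at its base point; so [ev_map v] is zero only for v
    = 0. *)
Lemma ev_map_neq0 : exists p c, c != 0 /\ forall v, ev_map v p = c *: v.
Proof.
pose p : {mpoly rat[n]} := \prod_i \prod_(j | j != i) ('X_i - (j : nat)%:R%:MP).
have pE g : p.@[pt g] = \prod_i \prod_(j | j != i) ((g i : nat)%:R - (j : nat)%:R).
  rewrite rmorph_prod; apply: eq_bigr => i _; rewrite rmorph_prod; apply: eq_bigr => j _.
  by rewrite rmorphB /= mevalXU mevalC.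
exists p, p.@[pt 1%g]; split=> [|v].
  rewrite pE; apply/prodf_neq0 => i _; apply/prodf_neq0 => j ji.
  by rewrite perm1 subr_eq0 eqr_nat eq_sym.
rewrite /ev_map (bigD1 1%g) //= invg1 bact1 big1 ?addr0 // => g neg.
suff -> : p.@[pt g] = 0 by rewrite scale0r.
have [i gi] : exists i, g i != i.
  apply/existsP; apply: contraNT neg; rewrite negb_exists => /forallP gi.
  by apply/eqP/permP => i; rewrite perm1; apply/eqP; rewrite -[_ == _]negbK.
apply/eqP; rewrite pE; apply/prodf_eq0; exists i => //.
by apply/prodf_eq0; exists (g i) => //; rewrite subrr.
Qed.

Definition lamm S : 'X_{1..n} := [multinom lam S i | i < n].

Lemma lammE S : (lamm S : 'I_n -> nat) = lam S.
Proof. by apply/funext => i; rewrite mnmE. Qed.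

Lemma lamm_dec S : nonincreasing (lamm S).
Proof. by rewrite lammE => i j; apply: lam_leq. Qed.

Lemma lamm_lraise S (s : 'I_n) : S \subset full_set n -> s \in S ->
  exists i0, lamm S = lraise (lamm (S :\ s)) i0.
Proof.
move=> Sfull Ss; have := subsetP Sfull s Ss; rewrite inE => s0.
have i0P : (s.-1 < n)%N by have := ltn_ord s; lia.
(* Removing s lowers by one exactly the first s entries, those of index at most s - 1. *)
exists (Ordinal i0P); apply/mnmP => i; rewrite !mnmE /= /lam.
have -> : (i <= s.-1)%N = (i < s)%N by lia.
rewrite (cardsD1 s) inE Ss /= addnC; congr (_ + _)%N.
by apply: eq_card => j; rewrite !inE andbA.
Qed.

(** If m ends in 0 and drops by at most one at a time, S is the set of its drops. Otherwise there is
    a larger drop after i0, or i0 is last with positive value; lowering the entries up to i0 by one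
    keeps the order and merges no blocks. *)
Lemma nonincreasing_cases m : nonincreasing m ->
  (exists2 S : {set 'I_n}, S \subset full_set n & m = lamm S) \/
  (exists (l : 'X_{1..n}) (i0 : 'I_n), [/\ nonincreasing l, m = lraise l i0 & stab l \subset stab m]).
Proof.
move=> m_dec.
pose bad i0 := (0 < m i0)%N && [forall j : 'I_n, (i0 < j)%N ==> ((m j).+2 <= m i0)%N].
have [/existsP[i0 /andP[m0 /forallP gap]]|] := boolP [exists i0, bad i0].
  right; pose l : 'X_{1..n} := [multinom (m i - (i <= i0))%N | i < n].
  have lE i : l i = (m i - (i <= i0))%N by rewrite mnmE.
  have gap' j : (i0 < j)%N -> ((m j).+2 <= m i0)%N by move=> h; apply: (implyP (gap j)).
  have big i : (i <= i0)%N -> (m i0 <= m i)%N by apply: m_dec.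
  exists l, i0; split.
  - move=> i j ij; rewrite !lE; have := m_dec i j ij.
    case: (leqP j i0) => [ji0|i0j]; first by rewrite (leq_trans ij ji0); lia.
    by have := gap' j i0j; case: (leqP i i0) => [/big|_]; lia.
  - apply/mnmP => i; rewrite mnmDE lE mnmE; case: (leqP i i0) => [/big|_] /=; lia.
  apply/subsetP => g /stabP gl; apply/stabP => i; have := gl i; rewrite !lE.
  case: (leqP (g i) i0) => [/big|/gap']; case: (leqP i i0) => [/big|/gap']; lia.
rewrite negb_exists => /forallP good; left.
pose S := [set j : 'I_n | [exists i : 'I_n, (i.+1 == j :> nat) && (m j < m i)%N]].
exists S; first by apply/subsetP => j; rewrite !inE => /existsP[i /andP[/eqP<-]].
apply/mnmP => i; rewrite mnmE; move def_d: (n - i)%N => d.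
elim: d i def_d => [|d IHd] i def_d; first by have := ltn_ord i; lia.
have := good i; rewrite negb_and -leqNgt negb_forall.
have [lt_j|le_j] := ltnP i.+1 n; last first.
  move=> goodi; have -> : m i = 0%N.
    case/orP: goodi => [|/existsP[j]]; first by rewrite leqn0 => /eqP.
    by rewrite negb_imply; have := ltn_ord j; lia.
  symmetry; apply/eqP; rewrite cards_eq0; apply/eqP/setP => s; rewrite !inE.
  by apply/negbTE; rewrite negb_and; have := ltn_ord s; lia.
pose j := Ordinal lt_j => goodi.
rewrite (@lam_adj _ S i j) // -IHd /=; last by lia.
have -> : (j \in S) = (m j < m i)%N.
  rewrite inE; apply/existsP/idP => [[i' /andP[/eqP [] /val_inj->]]|lt_m] //.
  by exists i; rewrite eqxx.
have := m_dec i j (leqnSn i); case/orP: goodi => [|/existsP[j']]; first by lia.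
rewrite negb_imply -ltnNge => /andP[ij' lt_j'].
by have := m_dec j j' ij'; lia.
Qed.

Section StableSpace.

Variable V : {vspace B}.
Hypothesis Vact : forall g x, x \in V -> bact g x \in V.

Lemma ev_map_mem v p : v \in V -> ev_map v p \in V.
Proof. by move=> Vv; apply: memv_suml => g _; apply/memvZ/Vact. Qed.

Lemma span_kernel (f : {linear {mpoly rat[n]} -> B}) (P : seq nat -> Prop) (r : poly_rep n) :
  (forall m, P (exp_part m) -> f 'X_[m] = 0) ->
  r \in span_pred (@monomial_in n P) -> f r = 0.
Proof.
move=> fP /span_predP[l [a [x [Xx ->]]]]; rewrite (linear_sum f) big1 // => i _.
by have [m Pm ->] := Xx i; rewrite linearZ /= fP ?scaler0.
Qed.

(** Apply [ev_map] to [sym_orbit_lraise]: the product goes to a multiple of the value at x^l, of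
    smaller degree, and r is strictly dominated, so both vanish by the level hypothesis. *)
Lemma ev_map_lraise v (l : 'X_{1..n}) i0 : nonincreasing l ->
  (forall m, (lvl m < lvl (lraise l i0))%N -> ev_map v 'X_[m] = 0) ->
  symz l (ev_map v 'X_[lraise l i0]) = 0.
Proof.
move=> l_dec low; have [N [r [N0 rP eqN]]] := sym_orbit_lraise i0 l_dec.
have symE : ev_map v (\sum_(h in stab l) msym h 'X_[lraise l i0]) =
    symz l (ev_map v 'X_[lraise l i0]).
  by rewrite (raddf_sum (ev_map v)); apply: eq_bigr => g _; apply: ev_map_msym.
have := congr1 (ev_map v) eqN.
rewrite linearZ linearB linearZ /= ev_map_sym ?orbit_sum_sym // symE.
rewrite (low l) ?lvl_deg ?mdeg_lraise // !scaler0 sub0r.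
rewrite (span_kernel (f := ev_map v) _ rP) => [|m [dom neq]]; last by rewrite /= low ?lvl_dom.
by move/eqP; rewrite oppr0 scaler_eq0 pnatr_eq0 -leqn0 leqNgt N0 /= => /eqP.
Qed.

Lemma bact_ev_map g v m : bact g (ev_map v 'X_[m]) = ev_map v 'X_[[multinom m (g^-1%g i) | i < n]].
Proof. by rewrite -ev_map_msym msymX. Qed.

Lemma ev_map_fixed g v m : g \in stab m -> bact g (ev_map v 'X_[m]) = ev_map v 'X_[m].
Proof.
move=> Sg; rewrite bact_ev_map; congr (ev_map v 'X_[_]); apply/mnmP => i; rewrite mnmE.
have Sg' : g^-1%g \in stab m by rewrite groupV.
by have /stabP-> := Sg'.
Qed.

Lemma ev_map_new v S : v \in V -> S \subset full_set n ->
  (forall m, (lvl m < lvl (lamm S))%N -> ev_map v 'X_[m] = 0) ->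
  ev_map v 'X_[lamm S] \in (V :&: new_space k S)%VS.
Proof.
move=> Vv Sfull low; rewrite memv_cap ev_map_mem //=; apply/new_spaceP; split.
  by apply/inv_spaceP => g Sg; apply: ev_map_fixed; rewrite lammE.
move=> s Ss; have [i0 eqS] := lamm_lraise Sfull Ss; rewrite -lammE eqS.
by apply: ev_map_lraise; [apply: lamm_dec | rewrite -eqS].
Qed.

(** In the second case of [nonincreasing_cases] the stabilizer of l fixes the value, so the sum in
    [ev_map_lraise] is a nonzero multiple of it. *)
Lemma ev_map_other v m : nonincreasing m ->
  (forall m', (lvl m' < lvl m)%N -> ev_map v 'X_[m'] = 0) ->
  (exists2 S : {set 'I_n}, S \subset full_set n & m = lamm S) \/ ev_map v 'X_[m] = 0.
Proof.
move=> m_dec low; case: (nonincreasing_cases m_dec) => [|[l [i0 [l_dec eqm sub]]]]; first by left.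
right; have := @ev_map_lraise v l i0 l_dec; rewrite -eqm => /(_ low).
rewrite symz_fixed => [/eqP|g Sg]; last by apply: ev_map_fixed; apply: (subsetP sub).
by rewrite scaler_eq0 (negPf (card_stab_neq0 _)) => /eqP.
Qed.

Definition level_pred d : {pred B} := fun v =>
  `[< v \in V /\ forall m, (lvl m < d)%N -> ev_map v 'X_[m] = 0 >].

Lemma level_closed d : submod_closed (level_pred d).
Proof.
split=> [|a x y /asboolP[Vx x0] /asboolP[Vy y0]]; apply/asboolP; split.
- exact: mem0v.
- by move=> m _; rewrite /ev_map big1 // => g _; rewrite raddf0 scaler0.
- by rewrite rpredD ?rpredZ.
by move=> m lt_m; rewrite ev_mapDl x0 ?y0 // scaler0 addr0.
Qed.

Definition level d : {vspace B} := pvs (level_closed d).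

Lemma levelP d v :
  reflect (v \in V /\ forall m, (lvl m < d)%N -> ev_map v 'X_[m] = 0) (v \in level d).
Proof. by rewrite [_ \in level d]mem_pvs; apply: asboolP. Qed.

Definition at_level d : pred {set 'I_n} := fun S => (S \subset full_set n) && (lvl (lamm S) == d).

(** On [level d] the summands lie in independent spaces, so their sum still determines each of
    them. *)
Definition lead d v : B := \sum_(S | at_level d S) ev_map v 'X_[lamm S].

Lemma lead_linear d : linear (lead d).
Proof.
by move=> a x y; rewrite /lead scaler_sumr -big_split; apply: eq_bigr => S _; rewrite ev_mapDl.
Qed.

HB.instance Definition _ d :=
  GRing.isLinear.Build rat B B *:%R (lead d) (lead_linear d).

Definition level_new d : {vspace B} := (\sum_(S | at_level d S) (V :&: new_space k S))%VS.

Lemma level_mem_new d v S : v \in level d -> at_level d S ->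
  ev_map v 'X_[lamm S] \in (V :&: new_space k S)%VS.
Proof.
by move=> /levelP[Vv low] /andP[Sfull /eqP eqd]; apply: ev_map_new; rewrite ?eqd.
Qed.

Lemma lead_level d : (linfun (lead d) @: level d <= level_new d)%VS.
Proof.
apply/subvP => _ /memv_imgP[v Lv ->]; rewrite lfunE; apply: memv_suml => S dS.
exact: subv_sum_in dS (level_mem_new Lv dS).
Qed.

(** Independence gives 0 at each [lamm S], [ev_map_other] at the other sorted exponents, and
    equivariance at the rest. *)
Lemma lead_ker d : (level d :&: lker (linfun (lead d)) <= level d.+1)%VS.
Proof.
apply/subvP => v; rewrite memv_cap memv_ker lfunE => /andP[Lv /eqP lead0].
have /levelP[Vv low] := Lv; apply/levelP; split=> // m; rewrite ltnS leq_eqVlt.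
case/orP=> [/eqP eqd|]; last exact: low.
have [m' [g [m'_dec def_m]]] := exists_sorted_mnm m.
have eq_lvl : lvl m' = d by rewrite -eqd def_m lvl_perm.
suff m'0 : ev_map v 'X_[m'] = 0.
  have -> : ev_map v 'X_[m] = bact g^-1%g (ev_map v 'X_[m']).
    by rewrite bact_ev_map invgK def_m.
  by rewrite m'0 raddf0.
have [|[S Sfull eqS]|] := @ev_map_other v m' m'_dec; rewrite ?eq_lvl //.
have dS : at_level d S by rewrite /at_level Sfull -eqS eq_lvl eqxx.
rewrite eqS; apply: (@new_space_independent n k (at_level d) (fun S => ev_map v 'X_[lamm S])) dS => //.
  by move=> S' /andP[].
by move=> S' /(level_mem_new Lv); rewrite memv_cap => /andP[].
Qed.

Lemma level_vanish d : exists2 D, (d < D)%N & level D = 0%VS.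
Proof.
have [p [c [nzc pc]]] := ev_map_neq0.
exists (maxn d (\max_(m <- msupp p) lvl m)).+1; first by rewrite ltnS leq_maxl.
apply/eqP; rewrite -subv0; apply/subvP => v /levelP[_ low]; rewrite memv0.
suff : c *: v == 0 by rewrite scaler_eq0 (negPf nzc).
rewrite -pc [p]mpolyE (linear_sum (ev_map v)) big_seq big1 //= => m mp.
rewrite linearZ /= low ?scaler0 // ltnS leq_max; apply/orP; right.
exact: leq_bigmax_seq.
Qed.

Lemma dim_level_new d : \dim (level_new d) = (\sum_(S | at_level d S) \dim (V :&: new_space k S))%N.
Proof.
suff /directvP-> : directv (\sum_(S | at_level d S) (V :&: new_space k S))%VS by [].
apply/directv_sum_independent => x Vx sx0; apply: new_space_independent sx0.
  by move=> S /andP[].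
by move=> S /Vx; rewrite memv_cap => /andP[].
Qed.

(* Summing over all levels, the dimensions of the images add up to at least    *)
(* dim V, while those of the targets add up to at most dim V.                  *)
Lemma lead_surjective d : (linfun (lead d) @: level d)%VS = level_new d.
Proof.
apply/eqP; rewrite eqEdim lead_level /=.
pose a e := \dim (linfun (lead e) @: level e); pose b e := \dim (level_new e).
have le_ab e : (a e <= b e)%N by apply/dimvS/lead_level.
have [[//|D] dD levD] := level_vanish d.
have step e : (\dim (level e) <= \dim (level e.+1) + a e)%N.
  by rewrite -(limg_ker_dim (linfun (lead e)) (level e)) leq_add2r dimvS ?lead_ker.
have low : (\dim V <= \sum_(e < D.+1) a e)%N.
  have -> : V = level 0.
    by apply/eqP; rewrite eqEsubv; apply/andP; split; apply/subvP => v;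
      [move=> Vv; apply/levelP | case/levelP].
  suff : (\dim (level 0) <= \dim (level D.+1) + \sum_(e < D.+1) a e)%N by rewrite levD dimv0.
  elim: D.+1 => [|e IHe].
    by rewrite big_ord0 addn0.
  rewrite big_ord_recr /=; apply: leq_trans IHe _; rewrite addnA addnAC leq_add2r.
  exact: step.
have up : (\sum_(e < D.+1) b e <= \dim V)%N.
  rewrite -[V]capvf -(inv_space_full n k) dim_inv_new //.
  rewrite (bigID (fun S => lvl (lamm S) < D.+1)%N) /= (leq_trans _ (leq_addr _ _)) //.
  rewrite (partition_big (fun S => inord (lvl (lamm S)) : 'I_D.+1) xpredT) //=.
  apply: leq_sum => e _; rewrite /b dim_level_new.
  apply/eq_leq/eq_bigl => S; rewrite /at_level -andbA; congr (_ && _).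
  apply/eqP/andP => [->|[lt_D /eqP <-]].
    by rewrite ltn_ord; split=> //; apply/eqP/val_inj; rewrite /= inordK.
  by rewrite inordK.
rewrite leqNgt; apply/negP => lt_d.
have : (\sum_(e < D.+1) a e < \sum_(e < D.+1) b e)%N.
  rewrite (bigD1 (Ordinal dD)) //= [X in (_ < X)%N](bigD1 (Ordinal dD)) //= -addSn.
  by apply: leq_add => //; apply: leq_sum => e _.
by rewrite ltnNge (leq_trans up).
Qed.

(** Surjectivity yields u with total leading value v; independence puts all of v in the summand at
    S. *)
Lemma ev_map_realize S v : S \subset full_set n -> v \in (V :&: new_space k S)%VS ->
  exists u, [/\ u \in V, ev_map u 'X_[lamm S] = v &
    forall m, (lvl m < lvl (lamm S))%N -> ev_map u 'X_[m] = 0].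
Proof.
move=> Sfull Vv; pose d := lvl (lamm S).
have dS : at_level d S by rewrite /at_level Sfull eqxx.
have : v \in level_new d by apply: subv_sum_in dS Vv.
rewrite -lead_surjective => /memv_imgP[u Lu]; rewrite lfunE /= => def_v.
have /levelP[Vu low] := Lu; exists u; split=> //.
apply/eqP; rewrite -subr_eq0; apply/eqP.
pose x S' := ev_map u 'X_[lamm S'] - (if S' == S then v else 0).
have -> : ev_map u 'X_[lamm S] - v = x S by rewrite /x eqxx.
apply: (@new_space_independent n k (at_level d) x) dS.
- by move=> S' /andP[].
- move=> S' dS'; move: Vv; rewrite memv_cap => /andP[_ Nv].
  have := level_mem_new Lu dS'; rewrite memv_cap => /andP[_ Nu].
  by rewrite rpredB //; case: eqP => [->|_] //; apply: mem0v.
rewrite sumrB -[X in X - _]/(lead d u) -def_v -big_mkcondr /=.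
rewrite (eq_bigl (pred1 S)) ?big_pred1_eq ?subrr // => S'.
by apply: andb_idl => /eqP->; rewrite /at_level Sfull eqxx.
Qed.

End StableSpace.
End Evaluation.

(** * Finite dimension and complete reducibility *)

Lemma finite_span_vector (F : fieldType) (W : lmodType F) (I : finType) (e : I -> W) :
  (forall w, exists c : I -> F, w = \sum_i c i *: e i) ->
  exists d (r : W -> 'rV[F]_d), linear r /\ bijective r.
Proof.
move=> spanW; pose sT := {ffun I -> F^o}; pose comb (c : sT) := \sum_i c i *: e i.
have comb_lin : linear comb.
  move=> a x y; rewrite /comb scaler_sumr -big_split; apply: eq_bigr => i _.
  by rewrite !ffunE scalerDl scalerA.
pose combl : {linear sT -> W} := HB.pack comb (GRing.isLinear.Build F _ _ *:%R comb comb_lin).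
have ker_closed : submod_closed [pred c : sT | combl c == 0].
  split=> [|a x y]; rewrite !inE ?linear0 // => /eqP x0 /eqP y0.
  by rewrite linearP x0 y0 scaler0 addr0.
pose C := ((pvs ker_closed)^C)%VS.
pose beta (x : subvs_of C) := combl (vsval x).
have beta_lin : linear beta by move=> a x y; rewrite /beta !linearP.
pose betal : {linear subvs_of C -> W} := HB.pack beta (GRing.isLinear.Build F _ _ *:%R beta beta_lin).
have beta_inj : injective betal.
  apply: raddf_inj => x bx0; apply: val_inj; apply/eqP; rewrite -memv0 -(capv_compl (pvs ker_closed)).
  by rewrite memv_cap mem_pvs subvsP andbT inE; apply/eqP.
have beta_surj w : exists x, betal x = w.
  have [c ->] := spanW w; pose c' : sT := [ffun i => c i].
  have : c' \in (pvs ker_closed + C)%VS by rewrite addv_complf memvf.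
  case/memv_addP=> a Ka [b Cb def_c]; exists (vsproj C b).
  rewrite /betal /= /beta vsprojK //; move: Ka; rewrite mem_pvs inE => /eqP a0.
  transitivity (combl c'); last by apply: eq_bigr => i _; rewrite ffunE.
  by rewrite def_c linearD a0 add0r.
pose inv w := sval (cid (beta_surj w)).
have invK w : betal (inv w) = w by rewrite /inv; case: (cid _).
have betaK x : inv (betal x) = x by apply: beta_inj; rewrite invK.
have inv_lin : linear inv by move=> a x y; apply: beta_inj; rewrite linearP !invK.
have bas := vbasisP {:subvs_of C}.
exists _, (passmx.rVof (vbasis {:subvs_of C}) \o inv); split.
  by move=> a x y; rewrite /= inv_lin passmx.rVof_linear.
apply: bij_comp.
  by exists (passmx.vecof (vbasis {:subvs_of C})); [apply: passmx.rVofK | apply: passmx.vecofK].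
by exists betal.
Qed.

Section Maschke.

Variables (gT : finGroupType) (W : rep rat gT) (d : nat).
Variable r : W -> 'rV[rat]_d.
Hypotheses (r_lin : linear r) (r_bij : bijective r).
Implicit Types (A U K : subrep W) (g : gT) (w : W).

Let vT : vectType rat :=
  HB.pack (rep_sort W) (Lmodule_hasFinDim.Build rat W (exist2 _ _ r r_lin r_bij)).

Definition vs_of U : {vspace vT} := pvs (vT := vT) (sr_closed U).

Lemma mem_vs_of U w : (w \in vs_of U) = (w \in sr_mem U).
Proof. exact: mem_pvs. Qed.

(** Maschke: p averages a linear projection onto U over the group, and K is its kernel in A. *)
Lemma subrep_complement U A : {subset sr_mem U <= sr_mem A} ->
  exists K (p : W -> W), [/\ linear p, {subset sr_mem K <= sr_mem A},
    forall w, w \in sr_mem A -> p w \in sr_mem U /\ w - p w \in sr_mem K,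
    forall u, u \in sr_mem U -> p u = u & forall w, w \in sr_mem K -> p w = 0].
Proof.
move=> sUA; pose q (w : W) : W := projv (vs_of U) w.
have q_lin : linear q by move=> a x y; rewrite /q (linearP (projv (vs_of U))).
pose p w : W := #|gT|%:R^-1 *: \sum_g Defs.act g^-1%g (q (Defs.act g w)).
have card0 : #|gT|%:R != 0 :> rat by rewrite pnatr_eq0 -lt0n; apply/card_gt0P; exists 1%g.
have p_lin : linear p.
  move=> a x y; rewrite /p scalerA mulrC -scalerA -scalerDr; congr (_ *: _).
  rewrite scaler_sumr -big_split; apply: eq_bigr => g _ /=.
  by rewrite linearP q_lin linearP.
have qU w : q w \in sr_mem U by rewrite -mem_vs_of; apply: memv_proj.
have pU w : p w \in sr_mem U.
  by apply: rpredZ; apply: rpred_sum => g _; apply: sr_act.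
have p_id u : u \in sr_mem U -> p u = u.
  move=> Uu; rewrite /p (eq_bigr (fun=> u)) => [|g _].
    by rewrite sumr_const -scaler_nat scalerA mulVf ?scale1r.
  have -> : q (Defs.act g u) = Defs.act g u.
    by apply: (@projv_id _ vT); rewrite mem_vs_of sr_act.
  by rewrite -Defs.actM mulgV Defs.act1.
have p_act g w : p (Defs.act g w) = Defs.act g (p w).
  rewrite /p [RHS]linearZ [in RHS]linear_sum /=; congr (_ *: _).
  rewrite (reindex_inj (mulgI g^-1%g)) /=; apply: eq_bigr => h _.
  by rewrite -Defs.actM mulKVg invMg invgK Defs.actM.
have pB x y : p (x - y) = p x - p y.
  by have := p_lin (-1) y x; rewrite !scaleN1r [- y + x]addrC [- p y + p x]addrC.
have p0 : p 0 = 0 by have := pB 0 0; rewrite !subrr.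
pose Kp : {pred W} := [pred w | (w \in sr_mem A) && (p w == 0)].
have Kc : submod_closed Kp.
  split=> [|a x y]; rewrite !inE; first by rewrite rpred0 p0 eqxx.
  move=> /andP[Ax /eqP x0] /andP[Ay /eqP y0].
  by rewrite rpredD ?rpredZ // p_lin x0 y0 scaler0 addr0 eqxx.
have Ka g w : w \in Kp -> Defs.act g w \in Kp.
  by rewrite !inE => /andP[Aw /eqP w0]; rewrite sr_act // p_act w0 linear0 eqxx.
exists (Subrep Kc Ka), p; split=> //.
- by move=> w /andP[].
- move=> w Aw; split=> //; rewrite inE; apply/andP; split.
    by rewrite rpredB // sUA.
  by rewrite pB (p_id (p w)) ?subrr.
by move=> w /andP[_ /eqP].
Qed.

Lemma minimal_subrep A w0 : w0 \in sr_mem A -> w0 != 0 ->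
  exists U, {subset sr_mem U <= sr_mem A} /\ irreducible_rep (sub_rep U).
Proof.
move=> Aw0 nz0.
pose P e := `[< exists U, [/\ {subset sr_mem U <= sr_mem A},
  exists2 w, w \in sr_mem U & w != 0 & \dim (vs_of U) = e] >].
have exP : exists e, P e by exists (\dim (vs_of A)); apply/asboolP; exists A; split=> //; exists w0.
case: (ex_minnP exP) => e /asboolP[U [sUA [w Uw nzw] dimU]] min_e.
exists U; split=> //; split.
  by exists (SubElt Uw); apply: contra nzw => /eqP/(congr1 (@sub_val _ _ _ U))/= ->.
move=> X; have [[x Xx nzx]|noX] := pselect (exists2 x, x \in sr_mem X & x != 0); last first.
  by left=> v Xv; apply/eqP; apply: contra_notT noX => nzv; exists v.
right; pose Yp : {pred W} := fun w => `[< exists2 x, x \in sr_mem X & sub_val x = w >].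
have Yc : submod_closed Yp.
  split=> [|a _ _ /asboolP[y Xy <-] /asboolP[z Xz <-]]; apply/asboolP.
    by exists 0; rewrite ?rpred0.
  by exists (a *: y + z); rewrite // rpredD ?rpredZ.
have Ya g v : v \in Yp -> Defs.act g v \in Yp.
  by move=> /asboolP[y Xy <-]; apply/asboolP; exists (Defs.act g y); rewrite ?sr_act.
pose Y := Subrep Yc Ya.
have sYU : {subset sr_mem Y <= sr_mem U} by move=> _ /asboolP[y Xy <-]; apply: sub_valP.
have sYU' : (vs_of Y <= vs_of U)%VS by apply/subvP => v; rewrite !mem_vs_of; apply: sYU.
have eqYU : vs_of Y == vs_of U.
  rewrite eqEdim sYU' dimU min_e //; apply/asboolP; exists Y; split=> //.
    by move=> v /sYU/sUA.
  exists (sub_val x); first by apply/asboolP; exists x.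
  by apply: contra nzx => /eqP x0; apply/eqP/val_inj.
move=> v; have : sub_val v \in sr_mem Y.
  by rewrite -mem_vs_of (eqP eqYU) mem_vs_of sub_valP.
by case/asboolP=> y Xy /val_inj <-.
Qed.

Lemma subrep_decomposition A : exists (k : nat) (U : 'I_k -> subrep W),
  [/\ forall i, irreducible_rep (sub_rep (U i)), forall i, {subset sr_mem (U i) <= sr_mem A} &
  forall w, w \in sr_mem A -> exists! u : {ffun 'I_k -> W},
    (forall i, u i \in sr_mem (U i)) /\ w = \sum_i u i].
Proof.
move: {2}_.+1 (ltnSn (\dim (vs_of A))) => m; elim: m A => // m IHm A lt_m.
have [[w0 Aw0 nz0]|A0] := pselect (exists2 w, w \in sr_mem A & w != 0); last first.
  exists 0%N, (fun=> A); split=> [[]|[]|w Aw] //.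
  have -> : w = 0 by apply/eqP; apply: contra_notT A0 => nz; exists w.
  exists [ffun=> 0]; split; first by split=> [[]|] //; rewrite big_ord0.
  by move=> u _; apply/ffunP => -[].
have [U0 [sUA irrU0]] := minimal_subrep Aw0 nz0.
have [K [p [p_lin sKA pA pU pK]]] := subrep_complement sUA.
have lt_K : (\dim (vs_of K) < m)%N.
  rewrite -ltnS; apply: leq_trans lt_m; rewrite ltnS ltn_neqAle.
  have sKA' : (vs_of K <= vs_of A)%VS by apply/subvP => w; rewrite !mem_vs_of; apply: sKA.
  rewrite dimvS // andbT; apply/eqP => eqd.
  have /eqP eqKA : vs_of K == vs_of A by rewrite eqEdim sKA' eqd /=.
  have [[u nzu] _] := irrU0; case/eqP: nzu; apply: val_inj => /=.
  rewrite -(pU _ (sub_valP u)); apply: pK.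
  by rewrite -mem_vs_of eqKA mem_vs_of sUA ?sub_valP.
have [k [U [irrU sUK decK]]] := IHm K lt_K.
pose U' (i : 'I_k.+1) := oapp U U0 (unlift ord0 i).
exists k.+1, U'; split=> [i|i|w Aw]; rewrite ?/U'.
- by case: (unlift ord0 i) => [j|] /=.
- by case: (unlift ord0 i) => [j|] //= w /sUK/sKA.
have [Up Kw] := pA w Aw; have [u [[uU sum_u] uniq_u]] := decK _ Kw.
exists [ffun i => oapp u (p w) (unlift ord0 i)]; split.
  split=> [i|]; first by rewrite ffunE; case: (unlift ord0 i) => [j|] /=.
  rewrite big_ord_recl ffunE unlift_none /=.
  under eq_bigr do rewrite ffunE liftK /=.
  by rewrite -sum_u addrC subrK.
move=> v [vU sum_v]; pose v' : {ffun 'I_k -> W} := [ffun j => v (lift ord0 j)].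
have v'U j : v' j \in sr_mem (U j) by have := vU (lift ord0 j); rewrite ffunE liftK.
have v0U : v ord0 \in sr_mem U0 by have := vU ord0; rewrite unlift_none.
have p0 : p 0 = 0 by have := p_lin (-1) 0 0; rewrite scaler0 add0r scaleN1r addNr.
have pD x y : p (x + y) = p x + p y by have := p_lin 1 x y; rewrite !scale1r.
have sum_v' : w = v ord0 + \sum_j v' j.
  by rewrite sum_v big_ord_recl; congr (_ + _); apply: eq_bigr => j _; rewrite ffunE.
have Ksum : \sum_j v' j \in sr_mem K by apply: rpred_sum => j _; apply: sUK (v'U j).
have pw : p w = v ord0 by rewrite sum_v' pD pU // (pK _ Ksum) addr0.
have eq_v : u = v'.
  by apply: uniq_u; split=> //; rewrite pw {1}sum_v' addrC addKr.
apply/ffunP => i; rewrite ffunE; case: unliftP => [j|] -> /=; last by [].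
by rewrite eq_v ffunE.
Qed.

End Maschke.

(** * Irreducibility and multiplicities *)

Section SpechtIrreducible.

Variables (n : nat) (mu : seq nat).
Hypothesis mu_part : is_partition n mu.
Local Notation k := (size mu).
Local Notation word := {ffun 'I_n -> 'I_k}.
Local Notation B := {ffun word -> rat^o}.
Local Notation V := (specht_space n mu).
Local Notation sp := (@specht_poly n mu).
Implicit Types (T : {ffun cell mu -> 'I_n}) (g s : 'S_n) (x y : B).

Section ColumnAntisymmetrizer.

Variables (T : {ffun cell mu -> 'I_n}) (T_tab : tableau T).
Local Notation tcol := (tcol mu_part T_tab).

Definition kappa x : B := \sum_(s in stab tcol) (-1) ^+ s *: bact s x.

Lemma bact_kappa s x : s \in stab tcol -> bact s (kappa x) = (-1) ^+ s *: kappa x.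
Proof.
move=> Cs; rewrite /kappa linear_sum scaler_sumr [RHS](reindex_inj (mulIg s)) /=.
apply: eq_big => [t|t _]; first by rewrite groupMr.
by rewrite linearZ /= bactM scalerA odd_permM signr_addb mulrCA -signr_addb addbb expr0 mulr1.
Qed.

Lemma dot_kappa x y : dot (kappa x) y = dot x (kappa y).
Proof.
rewrite dotC /kappa !linear_sum [RHS](reindex_inj invg_inj) /=.
apply: eq_big => [s|s _]; rewrite ?groupV // !linearZ /= odd_permV.
by rewrite dotC dot_bactV.
Qed.

Lemma kappa_specht : kappa (specht_vec T) = #|stab tcol|%:R *: specht_vec T.
Proof.
rewrite /kappa (eq_bigr (fun=> specht_vec T)) => [|s Cs].
  by rewrite sumr_const scaler_nat.
rewrite /specht_vec (antisym_wcoef (specht_antisym T_tab) Cs) scalerA -signr_addb addbb.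
by rewrite scale1r.
Qed.

(** The vector [kappa x] is antisymmetric on columns and of degree [row_sum], so [antisym_det]
    reduces it to its value at the row word. *)
Lemma kappa_line x : x \in V -> exists c, kappa x = c *: specht_vec T.
Proof.
move=> Vx; pose w0 := rword mu_part T_tab.
have nz0 : specht_vec T w0 != 0 by rewrite ffunE specht_rword.
exists (kappa x w0 / specht_vec T w0); apply/eqP; rewrite -subr_eq0; apply/eqP.
set y := _ - _; suff p0 : wpoly y = 0 by rewrite -[y]wpolyK p0 linear0.
have Vk : kappa x \in V.
  by apply: memv_suml => s _; apply/memvZ/specht_space_act.
have Vy : y \in V by rewrite rpredB ?rpredZ ?specht_vec_mem.
apply: (@antisym_det _ _ mu_part T T_tab) => [i j ec nij|m nz|].
- have Ct : tperm i j \in stab tcol by apply: tperm_stab.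
  rewrite -wpoly_bact -linearN; congr wpoly; rewrite linearB linearZ /= bact_kappa //.
  rewrite /specht_vec (antisym_wcoef (specht_antisym T_tab) Ct) odd_tperm nij expr1.
  by rewrite !scaleN1r scalerN opprB opprK addrC.
- have [w def_m] : exists w : word, m = mon w.
    apply: contrapT => nw; move/negP: nz; apply; rewrite /wpoly linear_sum big1 // => w _ /=.
    rewrite mcoeffZ mcoeffX; case: eqP => [eqm|_]; last by rewrite mulr0.
    by case: nw; exists w.
  have yw : y w != 0 by move: nz; rewrite def_m; have /ffunP/(_ w) := wpolyK y; rewrite ffunE => ->.
  have [eq_sum _] := specht_space_supp mu_part Vy yw.
  by rewrite -eq_sum def_m mdegE; apply/eq_leq/eq_bigr => i _; rewrite mnmE.
have /ffunP/(_ w0) := wpolyK y; rewrite ffunE => ->.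
have add_at (z z' : B) : (z - z') w0 = z w0 - z' w0 by rewrite !ffunE.
have scale_at a (z : B) : (a *: z) w0 = a * z w0 by rewrite ffunE.
by rewrite add_at scale_at divfK ?subrr.
Qed.

End ColumnAntisymmetrizer.

Lemma transport_tableau T T' : tableau T -> tableau T' ->
  exists g, T' = [ffun c => g (T c)].
Proof.
move=> T_tab T'_tab.
have inj : injective (fun j => T' (tinv mu_part T_tab j)).
  move=> i j /(tab_inj T'_tab)/(congr1 T); by rewrite !tinvK.
by exists (perm inj); apply/ffunP => c; rewrite ffunE permE tabK.
Qed.

Lemma exists_tableau : exists T : {ffun cell mu -> 'I_n}, tableau T.
Proof.
have eq_card : #|cell mu| = n := card_cell mu_part.
exists [ffun c => cast_ord eq_card (enum_rank c)]; apply/injectiveP => c d.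
by rewrite !ffunE => /cast_ord_inj/enum_rank_inj.
Qed.

(* James: kappa maps U into the line of specht_vec T, so either this vector    *)
(* lies in U, or U is killed by kappa, hence orthogonal to V by                *)
(* self-adjointness.                                                           *)
Lemma specht_space_irreducible (U : {pred B}) : submod_closed U ->
  (forall g x, x \in U -> bact g x \in U) -> {subset U <= V} ->
  (forall x, x \in U -> x = 0) \/ {subset V <= U}.
Proof.
move=> cU actU sUV; have [T T_tab] := exists_tableau.
have closedZ a x : x \in U -> a *: x \in U.
  by move=> Ux; have := cU.2 a x 0 Ux cU.1; rewrite addr0.
have [[x [Ux nz]]|all0] := pselect (exists x, x \in U /\ kappa T_tab x != 0).
  right; have Ukx : kappa T_tab x \in U.
    have sum_closed (A : {pred 'S_n}) (F : 'S_n -> B) :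
        (forall s, F s \in U) -> \sum_(s in A) F s \in U.
      move=> UF; elim/big_ind: _ => // [|y z Uy Uz]; first exact: cU.1.
      by have := cU.2 1 y z Uy Uz; rewrite scale1r.
    by apply: sum_closed => s; apply/closedZ/actU.
  have [c def_k] := kappa_line T_tab (sUV _ Ux).
  have nzc : c != 0 by apply: contra_neq nz => c0; rewrite def_k c0 scale0r.
  have UT : specht_vec T \in U.
    by rewrite -[specht_vec T](scalerK nzc) -def_k; apply: closedZ.
  move=> y; apply: (specht_space_ind cU) => T' T'_tab.
  have [g ->] := transport_tableau T_tab T'_tab.
  by rewrite -bact_specht_vec; apply: actU.
left=> x Ux; apply: dot_eq0.
have orthT y : y \in U -> dot y (specht_vec T) = 0.
  move=> Uy; have /eqP ky0 : kappa T_tab y == 0.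
    by apply: contra_notT all0 => nz; exists y.
  have := dot_kappa T_tab y (specht_vec T); rewrite ky0 kappa_specht dotC linear0 linearZ => /esym/eqP.
  by rewrite mulf_eq0 (negPf (card_stab_neq0 _)) => /eqP.
have cl : submod_closed [pred z : B | dot x z == 0].
  split=> [|a y z]; rewrite !inE ?linear0 // => /eqP y0 /eqP z0.
  by rewrite linearP /= y0 z0 scaler0 addr0.
have := specht_space_ind cl _ (sUV _ Ux); rewrite inE => h; apply/eqP/h => T' T'_tab.
have [g ->] := transport_tableau T_tab T'_tab.
rewrite inE -bact_specht_vec -[g]invgK -dot_bactV orthT ?eqxx //.
exact: actU.
Qed.

(** Homomorphisms to the Specht module, with values kept as functions on words; [wpoly] and [wcoef]
    translate to [specht_rep]. *)
Definition specht_hom (W : rep rat 'S_n) (f : W -> B) : Prop :=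
  [/\ linear f, forall g w, f (Defs.act g w) = bact g (f w) & forall w, f w \in V].

Lemma wpoly_specht x : x \in V ->
  wpoly x \in span_pred (@is_specht_poly n mu).
Proof.
have [S0 Sl] := span_closed (@is_specht_poly n mu).
have cl : submod_closed [pred x : B | wpoly x \in span_pred (@is_specht_poly n mu)].
  split=> [|a y z]; rewrite !inE; first by rewrite linear0.
  by rewrite linearP; apply: Sl.
move=> Vx; apply: (specht_space_ind cl _ Vx) => T T_tab.
by rewrite inE (specht_wcoefK mu_part T_tab); apply: mem_span; exists T.
Qed.

Lemma wcoef_specht (p : poly_rep n) : p \in span_pred (@is_specht_poly n mu) ->
  wcoef k p \in V /\ wpoly (wcoef k p) = p.
Proof.
move=> /span_predP[l [a [x [Xx ->]]]].
rewrite (linear_sum (@wcoef n k)) (linear_sum (@wpoly n k)) /=; split.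
  apply: memv_suml => i _; have [T T_tab ->] := Xx i.
  by rewrite linearZ; apply/memvZ/specht_vec_mem.
apply: eq_bigr => i _; have [T T_tab ->] := Xx i.
by rewrite !linearZ /= (specht_wcoefK mu_part T_tab).
Qed.

Lemma specht_hom_iso (W : rep rat 'S_n) (f : W -> B) :
  irreducible_rep W -> specht_hom f -> (exists w, f w != 0) -> rep_iso W (specht_rep n mu).
Proof.
move=> [_ irrW] [f_lin f_act f_V] [w1 nz1].
pose fl : {linear W -> B} := HB.pack f (GRing.isLinear.Build rat _ _ *:%R f f_lin).
have ker_cl : submod_closed [pred w : W | fl w == 0].
  split=> [|a x y]; rewrite !inE ?linear0 // => /eqP x0 /eqP y0.
  by rewrite linearP x0 y0 scaler0 addr0.
have ker_act g w : w \in [pred w : W | fl w == 0] -> Defs.act g w \in [pred w : W | fl w == 0].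
  by rewrite !inE /= f_act => /eqP->; rewrite linear0.
have f_inj : injective fl.
  apply: raddf_inj => w fw0.
  have [|all] := irrW (Subrep ker_cl ker_act); first by apply; rewrite inE fw0.
  by have := all w1; rewrite inE (negPf nz1).
pose im : {pred B} := fun x => `[< exists w, fl w = x >].
have im_cl : submod_closed im.
  split=> [|a _ _ /asboolP[x <-] /asboolP[y <-]]; apply/asboolP.
    by exists 0; rewrite linear0.
  by exists (a *: x + y); rewrite linearP.
have f_surj x : x \in V -> exists w, fl w = x.
  have [||im0|sV] := specht_space_irreducible im_cl.
  - by move=> g _ /asboolP[w <-]; apply/asboolP; exists (Defs.act g w); apply: f_act.
  - by move=> _ /asboolP[w <-]; apply: f_V.
  - by case/eqP: nz1; apply: im0; apply/asboolP; exists w1.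
  by move/sV/asboolP.
pose Sp := span_subrep (@is_specht_poly_act n mu).
pose phi w : sub_sort Sp := SubElt (wpoly_specht (f_V w) : wpoly (f w) \in sr_mem Sp).
have phi_lin : linear phi.
  by move=> a x y; apply: val_inj; rewrite /= f_lin linearP.
pose phil : {linear W -> specht_rep n mu} :=
  HB.pack phi (GRing.isLinear.Build rat W (specht_rep n mu) *:%R phi phi_lin).
have ex_psi (p : specht_rep n mu) : exists w, phi w = p.
  have [Vp pK] := wcoef_specht (sub_valP p); have [w def_w] := f_surj _ Vp.
  by exists w; apply: val_inj; rewrite /= -[f w]/(fl w) def_w.
exists phil.
  exists (fun p => sval (cid (ex_psi p))) => [w|p]; last by case: (cid _).
  case: (cid _) => w' /= /(congr1 (@sub_val _ _ _ Sp))/= /(can_inj (@wpolyK n k)).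
  exact: f_inj.
by move=> g w; apply: val_inj; rewrite /= f_act wpoly_bact.
Qed.

Lemma iso_specht_hom (W : rep rat 'S_n) : rep_iso W (specht_rep n mu) ->
  exists f : W -> B, [/\ specht_hom f, injective f & forall x, x \in V -> exists w, f w = x].
Proof.
case=> phi [psi phiK psiK] phi_act; pose f w := wcoef k (sub_val (phi w)).
have fE w : f w \in V /\ wpoly (f w) = sub_val (phi w) by exact: (wcoef_specht (sub_valP (phi w))).
exists f; split.
- split=> [a x y|g w|w]; last by case: (fE w).
    by rewrite /f linearP /= linearP.
  by rewrite /f phi_act /= wcoef_msym.
- move=> w w' eqf; apply: (can_inj phiK); apply: val_inj => /=.
  by have [_ <-] := fE w; rewrite eqf; case: (fE w').
move=> x Vx; pose p : sub_sort (span_subrep (@is_specht_poly_act n mu)) :=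
  SubElt (wpoly_specht Vx : wpoly x \in sr_mem (span_subrep (@is_specht_poly_act n mu))).
by exists (psi p); rewrite /f psiK wpolyK.
Qed.

(** Schur's lemma with rational scalars. A preimage w0 of a polytabloid is an eigenvector of the
    column antisymmetrizer, so [f' w0] lies in the line of [kappa_line]; the translates of w0
    span. *)
Lemma specht_hom_scalar (W : rep rat 'S_n) (f f' : W -> B) :
  specht_hom f -> injective f -> (forall x, x \in V -> exists w, f w = x) ->
  specht_hom f' -> exists c, forall w, f' w = c *: f w.
Proof.
move=> [f_lin f_act f_V] f_inj f_surj [f'_lin f'_act f'_V].
pose fl : {linear W -> B} := HB.pack f (GRing.isLinear.Build rat _ _ *:%R f f_lin).
pose fl' : {linear W -> B} := HB.pack f' (GRing.isLinear.Build rat _ _ *:%R f' f'_lin).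
have [T T_tab] := exists_tableau.
have [w0 def_w0] := f_surj _ (specht_vec_mem T_tab).
have [c def_c] := kappa_line T_tab (f'_V w0).
pose N : rat := #|stab (tcol mu_part T_tab)|%:R.
pose kw := \sum_(s in stab (tcol mu_part T_tab)) (-1) ^+ s *: Defs.act s w0 : W.
have kwE : kw = N *: w0.
  apply: f_inj; have -> : f (N *: w0) = N *: f w0 by rewrite -[f (_ *: _)]/(fl _) linearZ.
  rewrite def_w0 -kappa_specht; transitivity (fl kw) => //; rewrite (linear_sum fl).
  by apply: eq_bigr => s _; rewrite linearZ /= f_act def_w0.
have f'w0 : f' w0 = (N^-1 * c) *: f w0.
  rewrite def_w0 -scalerA -def_c.
  have -> : kappa T_tab (f' w0) = fl' kw.
    by rewrite /kw (linear_sum fl'); apply: eq_bigr => s _; rewrite linearZ /= f'_act.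
  by rewrite kwE linearZ scalerA mulVf ?scale1r // /N card_stab_neq0.
exists (N^-1 * c) => w; set b := N^-1 * c in f'w0 *.
pose P : {pred B} := fun x => `[< exists2 u, f u = x & f' u = b *: f u >].
have P_cl : submod_closed P.
  split=> [|a _ _ /asboolP[u <- eu] /asboolP[u' <- eu']]; apply/asboolP.
    by exists 0; rewrite -?[f 0]/(fl 0) -?[f' 0]/(fl' 0) !linear0 ?scaler0.
  exists (a *: u + u'); first exact: f_lin.
  by rewrite f'_lin f_lin eu eu' scalerDr !scalerA mulrC.
have /asboolP[u /f_inj <-] // : f w \in P.
apply: (specht_space_ind P_cl _ (f_V w)) => T' T'_tab; apply/asboolP.
have [g ->] := transport_tableau T_tab T'_tab.
exists (Defs.act g w0); first by rewrite f_act def_w0 bact_specht_vec.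
by rewrite f'_act f_act f'w0 linearZ.
Qed.

End SpechtIrreducible.

Section Components.

Variables (F : fieldType) (gT : finGroupType) (W : rep F gT) (k : nat).
Variables (U : 'I_k -> subrep W) (U_dec : direct_decomposition U).
Implicit Types (w : W) (i j : 'I_k) (g : gT).

Definition component w : {ffun 'I_k -> W} := sval (cid (U_dec w)).

Lemma componentP w : (forall i, component w i \in sr_mem (U i)) /\ w = \sum_i component w i.
Proof. exact: (proj1 (svalP (cid (U_dec w)))). Qed.

Lemma component_unique w (u : {ffun 'I_k -> W}) :
  (forall i, u i \in sr_mem (U i)) -> w = \sum_i u i -> component w = u.
Proof. by move=> Uu sum_u; case: (svalP (cid (U_dec w))) => _; apply. Qed.

Lemma component_linear a w w' i :
  component (a *: w + w') i = a *: component w i + component w' i.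
Proof.
rewrite (@component_unique _ [ffun i => a *: component w i + component w' i]) ?ffunE // => [j|].
  by rewrite ffunE rpredD ?rpredZ //; case: (componentP w); case: (componentP w').
rewrite {1}(proj2 (componentP w)) {1}(proj2 (componentP w')).
by rewrite scaler_sumr -big_split; apply: eq_bigr => j _; rewrite ffunE.
Qed.

Lemma component_act g w i : component (Defs.act g w) i = Defs.act g (component w i).
Proof.
rewrite (@component_unique _ [ffun i => Defs.act g (component w i)]) ?ffunE // => [j|].
  by rewrite ffunE sr_act //; case: (componentP w).
rewrite {1}(proj2 (componentP w)) linear_sum.
by apply: eq_bigr => j _; rewrite ffunE.
Qed.

Lemma component_mem w i j : w \in sr_mem (U i) ->
  component w j = if j == i then w else 0.
Proof.
move=> Uw; rewrite (@component_unique _ [ffun j => if j == i then w else 0]) ?ffunE //.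
  by move=> l; rewrite ffunE; case: eqP => [->|_] //; apply: rpred0.
rewrite (bigD1 i) //= ffunE eqxx big1 ?addr0 // => l /negPf li.
by rewrite ffunE li.
Qed.

Definition component_elt w i : sub_rep (U i) := SubElt (proj1 (componentP w) i).

End Components.

(** Evaluation at the generator z identifies the homomorphisms W -> V with D. Decompose W into
    irreducibles: the projections to the summands isomorphic to V, followed by the isomorphisms, are
    a basis of these homomorphisms by Schur's lemma. *)
Lemma multiplicity_dim n mu (W : rep rat 'S_n) (z : W)
    (D : {vspace {ffun {ffun 'I_n -> 'I_(size mu)} -> rat^o}}) :
  is_partition n mu ->
  (forall w, exists c : 'S_n -> rat, w = \sum_g c g *: Defs.act g z) ->
  (forall f : W -> _, @specht_hom n mu W f -> f z \in D) ->
  (forall v, v \in D -> exists2 f, @specht_hom n mu W f & f z = v) ->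
  has_multiplicity (specht_rep n mu) W (\dim D).
Proof.
move=> mu_part gen_z homD Dhom.
have [d [r [r_lin r_bij]]] := finite_span_vector gen_z.
have full_cl : submod_closed (predT : {pred W}) by [].
pose full := Subrep full_cl (fun g v Pv => isT : Defs.act g v \in predT).
have [k [U [irrU _ decU]]] := subrep_decomposition r_lin r_bij full.
have U_dec : direct_decomposition U by move=> w; apply: decU.
exists k, U; split=> //; pose iso i := rep_iso (sub_rep (U i)) (specht_rep n mu).
pose J : {set 'I_k} := [set i | `[< iso i >]].
have JP i : i \in J <-> iso i by rewrite inE; split=> /asboolP.
exists J => //.
have ex_f i : exists f : sub_rep (U i) -> {ffun {ffun 'I_n -> 'I_(size mu)} -> rat^o},
    iso i -> [/\ specht_hom f, injective f & forall x, x \in specht_space n mu -> exists w, f w = x].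
  have [/iso_specht_hom[//|f fP]|no] := pselect (iso i); first by exists f.
  by exists (fun=> 0).
pose f i := sval (cid (ex_f i)).
have fP i : i \in J -> [/\ specht_hom (f i), injective (f i) &
    forall x, x \in specht_space n mu -> exists w, f i w = x].
  by move=> /JP; rewrite /f; case: (cid _).
pose fc i w := f i (component_elt U_dec w i).
have eltP i a w w' : component_elt U_dec (a *: w + w') i =
    a *: component_elt U_dec w i + component_elt U_dec w' i.
  by apply: val_inj; rewrite /= component_linear.
have elt_act i g w : component_elt U_dec (Defs.act g w) i = Defs.act g (component_elt U_dec w i).
  by apply: val_inj; rewrite /= component_act.
have elt_in i (w : sub_rep (U i)) : component_elt U_dec (sub_val w) i = w.
  by apply: val_inj; rewrite /= (component_mem _ _ (sub_valP w)) eqxx.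
have fcP i : i \in J -> @specht_hom n mu W (fc i).
  move=> /fP[[f_lin f_act f_V] _ _]; split=> [a x y|g w|w]; last exact: f_V.
    by rewrite /fc eltP f_lin.
  by rewrite /fc elt_act f_act.
have hom0 i (h : sub_rep (U i) -> _) : @specht_hom n mu (sub_rep (U i)) h -> i \notin J -> forall w, h w = 0.
  move=> hP /negP nJ w; apply/eqP; apply: contra_notT nJ => nz; apply/JP.
  by apply: (specht_hom_iso mu_part (irrU i) hP); exists w.
have gen_ext (h h' : W -> _) : @specht_hom n mu W h -> @specht_hom n mu W h' ->
    h z = h' z -> h =1 h'.
  move=> [h_lin h_act _] [h'_lin h'_act _] eqz w; have [c ->] := gen_z w.
  pose hl : {linear W -> _} := HB.pack h (GRing.isLinear.Build rat W _ *:%R h h_lin).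
  pose hl' : {linear W -> _} := HB.pack h' (GRing.isLinear.Build rat W _ *:%R h' h'_lin).
  rewrite -[LHS]/(hl _) -[RHS]/(hl' _) !linear_sum; apply: eq_bigr => g _.
  by rewrite !linearZ /= h_act h'_act eqz.
have comb_hom (a : 'I_k -> rat) : @specht_hom n mu W (fun w => \sum_(i in J) a i *: fc i w).
  split=> [b x y|g w|w].
  - rewrite scaler_sumr -big_split; apply: eq_bigr => i Ji.
    by have [fc_lin _ _] := fcP i Ji; rewrite fc_lin scalerDr !scalerA [a i * b]mulrC.
  - rewrite linear_sum; apply: eq_bigr => i Ji; have [_ fc_act _] := fcP i Ji.
    by rewrite linearZ /= fc_act.
  by apply: memv_suml => i Ji; have [_ _ fc_V] := fcP i Ji; apply/memvZ/fc_V.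
have zero_hom : @specht_hom n mu W (fun=> 0).
  by split=> [a x y|g w|w]; rewrite ?scaler0 ?addr0 ?linear0 ?mem0v.
rewrite -(@dim_span_indep _ _ _ J (fun i => fc i z)) => [|a sum0 i Ji].
  congr (\dim _); apply/eqP; rewrite eqEsubv; apply/andP; split.
    by apply/span_subvP => _ /mapP[i + ->]; rewrite mem_enum => /fcP/homD.
  apply/subvP => v /Dhom[h hP <-]; have [h_lin h_act h_V] := hP.
  pose hl : {linear W -> _} := HB.pack h (GRing.isLinear.Build rat W _ *:%R h h_lin).
  have -> : h z = \sum_i h (component U_dec z i).
    by rewrite {1}(proj2 (componentP U_dec z)) -[LHS]/(hl _) linear_sum.
  apply: memv_suml => i _.
  have hiP : @specht_hom n mu (sub_rep (U i)) (fun w => h (sub_val w)).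
    split=> [a x y|g w|w]; [exact: h_lin | exact: h_act | exact: h_V].
  rewrite -[component U_dec z i]/(sub_val (component_elt U_dec z i)).
  have [Ji|nJi] := boolP (i \in J); last by rewrite (hom0 i _ hiP nJi) mem0v.
  have [fi_hom fi_inj fi_surj] := fP i Ji.
  have [c ->] := specht_hom_scalar mu_part fi_hom fi_inj fi_surj hiP.
  by apply/memvZ/memv_span/mapP; exists i; rewrite ?mem_enum.
have all0 := gen_ext _ _ (comb_hom a) zero_hom sum0.
have [[u nzu] _] := irrU i; have := all0 (sub_val u).
rewrite (bigD1 i) //= big1 ?addr0 => [|j /andP[Jj nji]].
  rewrite /fc elt_in => /eqP; rewrite scaler_eq0 => /orP[/eqP//|/eqP fu0].
  have [[f_lin _ _] f_inj _] := fP i Ji; case/eqP: nzu; apply: f_inj; rewrite fu0.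
  by have := f_lin (-1) 0 0; rewrite scaler0 addr0 scaleN1r addNr.
have -> : fc j (sub_val u) = 0; last exact: scaler0.
have [[f_lin _ _] _ _] := fP j Jj.
have -> : fc j (sub_val u) = f j 0.
  by congr (f j); apply: val_inj; rewrite /= (component_mem _ _ (sub_valP u)) (negPf nji).
by have := f_lin (-1) 0 0; rewrite scaler0 addr0 scaleN1r addNr.
Qed.

(** * The descent representation *)

Section SectionClass.

Variables (F : fieldType) (gT : finGroupType) (W : rep F gT) (U A B : subrep W).
Implicit Types (w : W) (g : gT).
Local Notation R := (section_rep (im_subrep U A) (im_subrep U B)).

Lemma im_mem w : w \in sr_mem A -> quo_proj U w \in sr_mem (im_subrep U A).
Proof. by move=> Aw; apply/asboolP; exists w. Qed.

(** Defined on all of W so that it applies to polynomials directly; outside A the value 0 is a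
    dummy. *)
Definition cls w : R :=
  if pselect (w \in sr_mem A) is left Aw
  then quo_proj (restrict_subrep (im_subrep U A) (im_subrep U B)) (SubElt (im_mem Aw))
  else 0.

Lemma clsE w (Aw : w \in sr_mem A) :
  cls w = quo_proj (restrict_subrep (im_subrep U A) (im_subrep U B)) (SubElt (im_mem Aw)).
Proof.
by rewrite /cls; case: pselect => // Aw'; congr (quo_proj _ _); apply: val_inj.
Qed.

Lemma cls_linear a w w' : w \in sr_mem A -> w' \in sr_mem A ->
  cls (a *: w + w') = a *: cls w + cls w'.
Proof.
move=> Aw Aw'; have Aww : a *: w + w' \in sr_mem A by rewrite rpredD ?rpredZ.
rewrite !clsE -linearP; congr (quo_proj _ _); apply: val_inj => /=.
by rewrite linearP.
Qed.

Lemma cls_act g w : w \in sr_mem A -> cls (Defs.act g w) = Defs.act g (cls w).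
Proof.
move=> Aw; have Agw : Defs.act g w \in sr_mem A by apply: sr_act.
rewrite !clsE /= -quo_projJ; congr (quo_proj _ _); apply: val_inj => /=.
by rewrite quo_projJ.
Qed.

Lemma cls_surj (x : R) : exists2 w, w \in sr_mem A & cls w = x.
Proof.
pose u := repr x : sub_rep (im_subrep U A).
have /asboolP[w Aw def_u] := sub_valP u; exists w => //.
rewrite (clsE Aw) -[RHS]quo_reprK; congr (quo_proj _ _); apply: val_inj.
by rewrite /= -def_u.
Qed.

Lemma cls_eq0 w : w \in sr_mem A ->
  cls w = 0 <-> exists2 w2, w2 \in sr_mem B & w - w2 \in sr_mem U.
Proof.
move=> Aw; rewrite (clsE Aw) -[0](linear0 (quo_proj _)).
split=> [/quo_projP|[w2 Bw2 Uw]].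
  by rewrite subr0 => /asboolP[w2 Bw2 /quo_projP]; exists w2.
by apply/quo_projP; rewrite subr0; apply/asboolP; exists w2 => //=; apply/quo_projP.
Qed.

End SectionClass.

Lemma pihomog_mulX n (m : 'X_{1..n}) (s : {mpoly rat[n]}) d :
  pihomog mdeg d ('X_[m] * s) =
  if (mdeg m <= d)%N then 'X_[m] * pihomog mdeg (d - mdeg m) s else 0.
Proof.
rewrite [s]mpolyE mulr_sumr !raddf_sum /= mulr_sumr.
transitivity (\sum_(m' <- msupp s) if (mdeg m <= d)%N
    then 'X_[m] * pihomog mdeg (d - mdeg m) (s@_m' *: 'X_[m']) else 0); last first.
  by case: ifP => // _; rewrite big1.
apply: eq_bigr => m' _; rewrite -scalerAr -mpolyXD !linearZ /= !pihomogX /= mdegD.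
case: leqP => [le_d|lt_d]; last by rewrite gtn_eqF ?scaler0 // ltn_addr.
have -> : (mdeg m' == d - mdeg m)%N = (mdeg m + mdeg m' == d)%N by lia.
case: eqP => _; last by rewrite !scaler0 mulr0.
by rewrite -scalerAr mpolyXD.
Qed.

Lemma pihomog0_const n (s : {mpoly rat[n]}) : s@_0%MM = 0 -> pihomog mdeg 0 s = 0.
Proof.
move=> s0; rewrite pihomogE big1 // => m /eqP/= m0.
have /eqP-> : m == 0%MM by rewrite -mdeg_eq0 m0.
by rewrite s0 scale0r.
Qed.

Lemma lambda_setE n (S : {set 'I_n}) : lambda_set S = lamm S :> seq nat.
Proof.
apply: (@eq_from_nth _ 0%N) => [|j]; first by rewrite size_map size_iota size_tuple.
rewrite size_map size_iota => jn.
by rewrite (nth_map 0%N) ?size_iota // nth_iota // -[j in RHS]/(val (Ordinal jn)) nth_mnm mnmE.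
Qed.

Section DescentRep.

Variables (n : nat) (mu : seq nat) (S : {set 'I_n}).
Hypotheses (mu_part : is_partition n mu) (S_full : S \subset full_set n).
Local Notation word := {ffun 'I_n -> 'I_(size mu)}.
Local Notation B := {ffun word -> rat^o}.
Local Notation V := (specht_space n mu).
Local Notation lm := (lamm S).
Local Notation I := (coinv_ideal n).
Local Notation A := (P_le n lm).
Local Notation A' := (P_lt n lm).
Local Notation class := (cls I A A').
Implicit Types (p q : poly_rep n) (g : 'S_n).

Lemma dominated_mem m : dominated (exp_part m) lm -> ('X_[m] : poly_rep n) \in sr_mem A.
Proof. by move=> dom; apply: mem_span; exists m. Qed.

Lemma lamm_dominated : dominated (exp_part lm) lm.
Proof. by rewrite exp_part_id; [split | apply: lamm_dec]. Qed.

Lemma top_monomial_mem : ('X_[lm] : poly_rep n) \in sr_mem A.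
Proof. exact/dominated_mem/lamm_dominated. Qed.

Lemma P_lt_sub_P_le p : p \in sr_mem A' -> p \in sr_mem A.
Proof.
move=> /span_predP[k [a [x [Xx ->]]]]; apply: rpred_sum => i _; apply: rpredZ.
by have [m [dom _] ->] := Xx i; apply: dominated_mem.
Qed.

Lemma P_le_homog p : p \in sr_mem A -> (p : {mpoly rat[n]}) \is (mdeg lm).-homog.
Proof.
move=> /span_predP[k [a [x [Xx ->]]]]; apply: rpred_sum => i _; apply: rpredZ.
have [m [eq_sum _] ->] := Xx i.
by rewrite dhomogX /= -(mdeg_exp_part m) eq_sum -mdeg_sumn.
Qed.

Definition top_class := class ('X_[lm] : poly_rep n).

(** A monomial of [P_le] is either a permutation of x^lambda_S or strictly dominated, with class
    0. *)
Lemma top_class_generates x : exists c : 'S_n -> rat, x = \sum_g c g *: Defs.act g top_class.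
Proof.
pose gen x := exists c : 'S_n -> rat, x = \sum_g c g *: Defs.act g top_class.
have gen0 : gen 0 by exists (fun=> 0); rewrite big1 // => g _; rewrite scale0r.
have genD a y y' : gen y -> gen y' -> gen (a *: y + y').
  move=> [c ->] [c' ->]; exists (fun g => a * c g + c' g).
  rewrite scaler_sumr -big_split; apply: eq_bigr => g _.
  by rewrite scalerDl scalerA.
have genX m : dominated (exp_part m) lm -> gen (class 'X_[m]).
  move=> dom; have [eqm|neq] := pselect (exp_part m = lm); last first.
    have -> // : class 'X_[m] = 0.
    apply/cls_eq0; first exact: dominated_mem.
    by exists 'X_[m]; [apply: mem_span; exists m | rewrite subrr rpred0].
  have [g eg] := exp_part_nth m.
  have -> : 'X_[m] = Defs.act g ('X_[lm] : poly_rep n).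
    rewrite /= msymX; congr 'X_[_]; apply/mnmP => i; rewrite mnmE -[RHS]nth_mnm -eqm eg.
    by rewrite permKV.
  rewrite cls_act ?top_monomial_mem //; exists (fun h => (h == g)%:R).
  rewrite (bigD1 g) //= eqxx scale1r big1 ?addr0 // => h /negPf hg.
  by rewrite hg scale0r.
have [p Ap <-] := cls_surj x; move: Ap => /span_predP[k [a [y [Xy ->]]]].
suff [] : (\sum_i a i *: y i \in sr_mem A) /\ gen (class (\sum_i a i *: y i)) by [].
elim/big_rec: _ => [|i q _ [Aq gq]].
  split; first exact: rpred0.
  have -> // : class 0 = 0.
  by apply/cls_eq0; [exact: rpred0 | exists 0; rewrite ?subrr rpred0].
have [m dom eqy] := Xy i; have Ay : y i \in sr_mem A by rewrite eqy; apply: dominated_mem.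
split; first by rewrite rpredD ?rpredZ.
by rewrite cls_linear //; apply: genD => //; rewrite eqy; apply: genX.
Qed.

(** Invariance is that of the monomial. For s in S, [sym_orbit_lraise] puts a positive multiple of
    the sum over the stabilizer for S - s into the ideal plus strictly dominated terms. *)
Lemma top_class_new (f : section_rep (im_subrep I A) (im_subrep I A') -> B) :
  @specht_hom n mu _ f -> f top_class \in (V :&: new_space (size mu) S)%VS.
Proof.
move=> [f_lin f_act f_V]; rewrite memv_cap f_V /=.
pose fl : {linear section_rep (im_subrep I A) (im_subrep I A') -> B} :=
  HB.pack f (GRing.isLinear.Build rat _ _ *:%R f f_lin).
apply/new_spaceP; split.
  apply/inv_spaceP => g Sg; rewrite -f_act /top_class -cls_act ?top_monomial_mem //.
  congr (f (class _)); rewrite /= msymX; congr 'X_[_]; apply/mnmP => i; rewrite mnmE !mnmE.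
  by have /stabP-> : g^-1%g \in stab (lam S) by rewrite groupV.
move=> s Ss; have [i0 eqS] := lamm_lraise S_full Ss.
have [N [r [N0 rP eqN]]] := sym_orbit_lraise i0 (@lamm_dec _ (S :\ s)).
rewrite -eqS in rP eqN.
have -> : symz (lam (S :\ s)) (f top_class) =
    f (\sum_(g in stab (lam (S :\ s))) Defs.act g top_class).
  by rewrite -[RHS]/(fl _) linear_sum; apply: eq_bigr => g _; rewrite -f_act.
suff -> : \sum_(g in stab (lam (S :\ s))) Defs.act g top_class = 0.
  by rewrite -[LHS]/(fl 0) linear0.
have [Asum sumE] : (\sum_(g in stab (lam (S :\ s))) Defs.act g ('X_[lm] : poly_rep n) \in sr_mem A) /\
    class (\sum_(g in stab (lam (S :\ s))) Defs.act g ('X_[lm] : poly_rep n)) =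
    \sum_(g in stab (lam (S :\ s))) Defs.act g top_class.
  elim/big_rec2: _ => [|g y q _ [Aq qE]].
    split; first exact: rpred0.
    by apply/cls_eq0; [exact: rpred0 | exists 0; rewrite ?subrr rpred0].
  have Ag : Defs.act g ('X_[lm] : poly_rep n) \in sr_mem A by rewrite sr_act ?top_monomial_mem.
  split; first by rewrite rpredD.
  by have := cls_linear I A' 1 Ag Aq; rewrite !scale1r qE cls_act ?top_monomial_mem.
rewrite -sumE; set q := (\sum_(g in _) _) in Asum sumE *.
have : N%:R *: class q = 0.
  have := cls_linear I A' N%:R Asum (rpred0 _ : 0 \in sr_mem A); rewrite addr0.
  have -> : class 0 = 0.
    by apply/cls_eq0; [exact: rpred0 | exists 0; rewrite ?subrr rpred0].
  rewrite addr0 => <-; apply/cls_eq0; first exact: rpredZ.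
  exists (- r); first by rewrite rpredN.
  have -> : N%:R *: q - - r = #|stab (lam (S :\ s))|%:R *: ('X_[lamm (S :\ s)] * orbit_sum i0).
    by rewrite opprK -lammE; rewrite lammE in eqN *; rewrite [X in X + r]eqN subrK.
  apply: rpredZ; apply/asboolP; exists 1%N, (fun=> 'X_[lamm (S :\ s)]), (fun=> orbit_sum i0).
  by rewrite big_ord1; split=> // _; split; [exact: orbit_sum_sym | exact: orbit_sum_const].
by move/eqP; rewrite scaler_eq0 pnatr_eq0 -leqn0 leqNgt N0 /= => /eqP.
Qed.

(** The map [ev_map u] from [ev_map_realize] has the right value at x^lambda_S; it descends to the
    quotient because it kills [P_lt] and the part of the ideal in the degree of lambda_S. *)
Lemma new_top_class v : v \in (V :&: new_space (size mu) S)%VS ->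
  exists2 f : section_rep (im_subrep I A) (im_subrep I A') -> B,
    @specht_hom n mu _ f & f top_class = v.
Proof.
move=> Nv; have [u [Vu def_v low]] := ev_map_realize (@specht_space_act n mu) S_full Nv.
pose e : {linear {mpoly rat[n]} -> B} := ev_map u.
have kill p p' : p \in sr_mem A -> p' \in sr_mem A' -> p - p' \in sr_mem I -> e p = 0.
  move=> Ap A'p' /asboolP[k [q [s [s_ok def_p]]]].
  have ep' : e p' = 0.
    by apply: (span_kernel (f := e) _ A'p') => m [dom neq]; apply: low; apply: lvl_dom.
  (* The difference is homogeneous, so only this degree of the products [q i * s i] matters. *)
  have -> : p = p' + pihomog mdeg (mdeg lm) (p - p' : {mpoly rat[n]}).
    rewrite pihomog_dE ?subrKC // ?[p' + _]addrC ?subrK //.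
    by apply: rpredB; apply: P_le_homog => //; apply: P_lt_sub_P_le.
  rewrite linearD ep' add0r def_p (raddf_sum (pihomog mdeg (mdeg lm))) (linear_sum e) big1 // => i _.
  have [s_sym s0] := s_ok i.
  rewrite [q i]mpolyE mulr_suml (raddf_sum (pihomog mdeg (mdeg lm))) (linear_sum e) big1 //= => m _.
  rewrite -scalerAl linearZ linearZ /= pihomog_mulX; case: leqP => [le_m|_]; last by rewrite linear0 scaler0.
  rewrite ev_map_sym; last exact: pihomog_sym.
  (* In smaller degree x^m has lower level; in equal degree its cofactor is the constant term of
     [s i], which is 0. *)
  move: le_m; rewrite leq_eqVlt => /orP[/eqP eqm|lt_m]; last first.
    by rewrite low ?scaler0 // lvl_deg.
  by rewrite eqm subnn pihomog0_const // meval0 scale0r scaler0.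
have ex_w (x : section_rep (im_subrep I A) (im_subrep I A')) :
    exists w, w \in sr_mem A /\ class w = x.
  by have [w Aw <-] := cls_surj x; exists w.
pose w x := sval (cid (ex_w x)).
have wP x : w x \in sr_mem A /\ class (w x) = x by rewrite /w; case: (cid _).
have e_ext p p' : p \in sr_mem A -> p' \in sr_mem A -> class p = class p' -> e p = e p'.
  move=> Ap Ap' eqc; apply/eqP; rewrite -subr_eq0 -linearB /=; apply/eqP.
  have Ad : p - p' \in sr_mem A by rewrite rpredB.
  have : class (p - p') = 0.
    by have := cls_linear I A' (-1) Ap' Ap; rewrite !scaleN1r addrC => ->; rewrite eqc addNr.
  by move/(cls_eq0 _ _ Ad) => [p2 A'p2 Ip2]; apply: (kill _ p2).
exists (fun x => e (w x)); last first.
  by rewrite -def_v; have [Aw eqw] := wP top_class; apply: e_ext => //; apply: top_monomial_mem.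
split=> [a x y|g x|x]; last exact: ev_map_mem (@specht_space_act n mu) _ _ Vu.
  have [Ax ex] := wP x; have [Ay ey] := wP y; have [Axy exy] := wP (a *: x + y).
  rewrite -linearP; apply: e_ext => //; first by rewrite rpredD ?rpredZ.
  by rewrite cls_linear // ex ey exy.
have [Ax ex] := wP x; have [Agx egx] := wP (Defs.act g x).
rewrite -ev_map_msym; apply: e_ext => //; first exact: (sr_act g Ax).
by rewrite egx -[in LHS]ex -cls_act.
Qed.

End DescentRep.

Theorem theorem4p1 (n : nat) (S : {set 'I_n}) (mu : seq nat) :
  (forall i, i \in S -> (0 < i)%N) ->
  is_partition n mu ->
  has_multiplicity (specht_rep n mu) (R_rep n (lambda_set S))
    #|[set T in SYT n mu | Des T == S]|.
Proof.
move=> S_pos mu_part.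
have S_full : S \subset full_set n by apply/subsetP => i /S_pos; rewrite inE.
rewrite -(dim_specht_new mu_part S_full) /R_rep lambda_setE.
apply: (multiplicity_dim (z := top_class S)) => //.
- exact: top_class_generates.
- exact: top_class_new.
exact: new_top_class.
Qed.
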